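(* Let $\Sigma$ be a Riemann surface of hyperbolic type and let $M$ be a complete flat surface which is not isometric to the Euclidean plane $\mathbb{R}^2$. Then there is no proper harmonic map from $\Sigma$ into $M$.
   Context: Riemann surfaces are connected. Hyperbolic type is meant in the potential-theoretic sense: a Riemann surface is of hyperbolic type if it is not parabolic and not compact, i.e. if it carries a nonconstant negative subharmonic function (equivalently, a Green's function). A complete flat surface is a connected, complete two-dimensional Riemannian manifold without boundary, of identically zero Gauss curvature, not necessarily orientable. A map from a Riemann surface into a flat surface $M$ is harmonic if, in local coordinates of $M$ given by local isometries onto open sets of $\mathbb{R}^2$, its two coordinate functions are harmonic. A map is proper if the preimage of every compact set is compact. *)

(* Defs.v *)
(* MathComp-Analysis *)
From HB Require Import structures.
From mathcomp Require Import all_boot all_order all_algebra.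
From mathcomp Require Import all_classical all_reals all_analysis.
From mathcomp Require Import complex.

Set Implicit Arguments.
Unset Strict Implicit.
Unset Printing Implicit Defensive.

Import Order.TTheory GRing.Theory Num.Theory.
Import numFieldNormedType.Exports.

Local Open Scope classical_set_scope.
Local Open Scope ring_scope.
Local Open Scope complex_scope.

(* R[i] receives its topology through its regular-module alias. *)
Notation cplx R := (GRing.regular (complex R)).

Definition upper_semicontinuous (X : topologicalType) (R : realType)
  (u : X -> \bar R) : Prop := lower_semicontinuous (fun x => - u x)%E.

Definition proper_map (X Y : topologicalType) (f : X -> Y) : Prop :=
  forall K : set Y, compact K -> compact (f @^-1` K).

(* chart_inv is a total function; it is only meaningful on chart_img. *)
Record chart (X E : topologicalType) := Chart {
  chart_dom : set X;
  chart_map : X -> E;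
  chart_inv : E -> X;
  chart_dom_open : open chart_dom;
  chart_img_open : open (chart_map @` chart_dom);
  chart_mapK : {in chart_dom, cancel chart_map chart_inv};
  chart_map_continuous : {in chart_dom, continuous chart_map};
  chart_inv_continuous : {in chart_map @` chart_dom, continuous chart_inv} }.

Section Charts.
Context (X E : topologicalType).
Implicit Types c d : chart X E.

Definition chart_img c : set E := chart_map c @` chart_dom c.

Definition overlap c d : set E := chart_map c @` (chart_dom c `&` chart_dom d).

Definition transition c d : E -> E := chart_map d \o chart_inv c.

End Charts.

Section PlaneCalculus.
Context (R : realType).
Implicit Types U : set 'rV[R]_2.

Fixpoint Ck (V : normedModType R) (k : nat) U (f : 'rV[R]_2 -> V) : Prop :=
  {in U, continuous f} /\
  match k with
  | 0%N => True
  | k'.+1 => forall i : 'I_2,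
      {in U, forall x, derivable f x 'e_i} /\ Ck k' U ('D_'e_i f)
  end.

Definition smooth (V : normedModType R) U (f : 'rV[R]_2 -> V) : Prop :=
  forall k, Ck k U f.

Definition laplacian (h : 'rV[R]_2 -> R) (x : 'rV[R]_2) : R :=
  \sum_(i < 2) 'D_'e_i ('D_'e_i h) x.

Definition harmonic_plane U (h : 'rV[R]_2 -> R) : Prop :=
  Ck 2 U h /\ {in U, forall x, laplacian h x = 0}.

Definition complex_of_plane (p : 'rV[R]_2) : cplx R := p 0 0 +i* p 0 1.

Definition circle_point (z : cplx R) (r t : R) : cplx R :=
  z + (r * cos t +i* (r * sin t)).

End PlaneCalculus.

Definition holomorphic (R : realType) (U : set (cplx R))
  (f : cplx R -> cplx R) : Prop := {in U, forall z, derivable f z 1}.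

(* Second countability is automatic here (Rado). *)
Record riemann_surface (R : realType) := RiemannSurface {
  rs_space :> topologicalType;
  rs_hausdorff : hausdorff_space rs_space;
  rs_connected : connected [set: rs_space];
  rs_atlas : set (chart rs_space (cplx R));
  rs_cover : forall p, exists2 c, rs_atlas c & chart_dom c p;
  rs_compat : forall c d, rs_atlas c -> rs_atlas d ->
    holomorphic (overlap c d) (transition c d) }.

Section RiemannSurface.
Context (R : realType) (S : riemann_surface R).

(* W is meant to be open. *)
Definition harmonic_on (W : set S) (h : S -> R) : Prop :=
  forall c, rs_atlas c ->
    harmonic_plane
      (@complex_of_plane R @^-1` (chart_map c @` (W `&` chart_dom c)))
      (h \o chart_inv c \o @complex_of_plane R).

(* The value -oo is allowed, +oo is not; the last clause is the sub-mean value
   inequality over every closed coordinate disc. *)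
Definition subharmonic (u : S -> \bar R) : Prop :=
  [/\ upper_semicontinuous u,
      forall p, (u p < +oo)%E &
      forall c (z : cplx R) (r : R), rs_atlas c -> 0 < r ->
        [set w : cplx R | `|w - z| <= r%:C] `<=` chart_img c ->
        (u (chart_inv c z) <= ((2 * pi)^-1)%:E *
           \int[lebesgue_measure]_(t in `[0%R, (2 * pi)%R])
             u (chart_inv c (circle_point z r t)))%E].

Definition hyperbolic_type : Prop :=
  exists u : S -> \bar R,
    [/\ subharmonic u, forall p, (u p < 0)%E & exists p q, u p <> u q].

End RiemannSurface.

(* Vectors are rows and 'J acts on the right, so a bilinear form g is pulled
   back to J g J^T. *)
Definition pullback_metric (R : realType) (tau : 'rV[R]_2 -> 'rV[R]_2)
  (g : 'rV[R]_2 -> 'M[R]_2) (x : 'rV[R]_2) : 'M[R]_2 :=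
  'J tau x *m g (tau x) *m ('J tau x)^T.

(* rm_metric c x is the Gram matrix of the metric at chart_inv c x in the
   coordinates of c; it is constrained only for c in the atlas and x in the
   image of c. Second countability is automatic here, as a connected Riemannian
   manifold is metrizable and locally compact. *)
Record riemannian_surface (R : realType) := RiemannianSurface {
  rm_space :> topologicalType;
  rm_hausdorff : hausdorff_space rm_space;
  rm_connected : connected [set: rm_space];
  rm_atlas : set (chart rm_space 'rV[R]_2);
  rm_cover : forall p, exists2 c, rm_atlas c & chart_dom c p;
  rm_compat : forall c d, rm_atlas c -> rm_atlas d ->
    smooth (overlap c d) (transition c d);
  rm_metric : chart rm_space 'rV[R]_2 -> 'rV[R]_2 -> 'M[R]_2;
  rm_metric_smooth : forall c, rm_atlas c ->
    smooth (chart_img c) (rm_metric c);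
  rm_metric_sym : forall c x, rm_atlas c -> chart_img c x ->
    (rm_metric c x)^T = rm_metric c x;
  rm_metric_pos : forall c x (v : 'rV[R]_2), rm_atlas c -> chart_img c x ->
    v != 0 -> 0 < (v *m rm_metric c x *m v^T) 0 0;
  rm_metric_compat : forall c d x, rm_atlas c -> rm_atlas d ->
    overlap c d x ->
    rm_metric c x = pullback_metric (transition c d) (rm_metric d) x }.

Section Curvature.
Context (R : realType) (g : 'rV[R]_2 -> 'M[R]_2).

(* Gamma^k_{ij} *)
Definition christoffel (k i j : 'I_2) (x : 'rV[R]_2) : R :=
  2^-1 * \sum_(l < 2) invmx (g x) k l *
    ('D_'e_i (fun y => g y j l) x + 'D_'e_j (fun y => g y i l) x
     - 'D_'e_l (fun y => g y i j) x).

(* the coefficient of d_l in R(d_i, d_j) d_k *)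
Definition riemann_tensor (l i j k : 'I_2) (x : 'rV[R]_2) : R :=
  'D_'e_i (christoffel l j k) x - 'D_'e_j (christoffel l i k) x
  + \sum_(m < 2) (christoffel l i m x * christoffel m j k x
                  - christoffel l j m x * christoffel m i k x).

(* g(R(d_0, d_1) d_1, d_0) / det g *)
Definition gauss_curvature (x : 'rV[R]_2) : R :=
  (\sum_(l < 2) riemann_tensor l 0 1 1 x * g x l 0) / \det (g x).

End Curvature.

Section RiemannianSurface.
Context (R : realType) (M : riemannian_surface R).

Definition flat : Prop := forall (c : chart M 'rV[R]_2) x, rm_atlas c -> chart_img c x ->
  gauss_curvature (rm_metric c) x = 0.

Definition C1_curve (s : R -> 'rV[R]_2) : Prop :=
  (forall t, derivable s t 1) /\ continuous (derive1 s).

Definition curve_length (c : chart M 'rV[R]_2) (s : R -> 'rV[R]_2) : R :=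
  \int[lebesgue_measure]_(t in `[0, 1])
    Num.sqrt ((derive1 s t *m rm_metric c (s t) *m (derive1 s t)^T) 0 0).

(* piecewise_C1_path p q L: there is a piecewise C^1 path from p to q of length
   L, presented as a concatenation of C^1 pieces each lying in one chart. *)
Inductive piecewise_C1_path : M -> M -> R -> Prop :=
| path_nil p : piecewise_C1_path p p 0
| path_cons c s q L : rm_atlas c -> C1_curve s ->
    (forall t, 0 <= t <= 1 -> chart_img c (s t)) ->
    piecewise_C1_path (chart_inv c (s 1)) q L ->
    piecewise_C1_path (chart_inv c (s 0)) q (curve_length c s + L).

Definition rm_dist (p q : M) : R := inf [set L | piecewise_C1_path p q L].

Definition complete_metric : Prop := forall p : nat -> M,
  (forall e : R, 0 < e -> exists N, forall m n, (N <= m)%N -> (N <= n)%N ->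
     rm_dist (p m) (p n) < e) ->
  exists q, forall e : R, 0 < e -> exists N, forall n, (N <= n)%N ->
     rm_dist (p n) q < e.

(* a diffeomorphism from an open subset of M onto an open subset of the plane
   that pulls the Euclidean metric back to the metric of M *)
Definition isometric_chart (phi : chart M 'rV[R]_2) : Prop :=
  forall c, rm_atlas c ->
    [/\ smooth (overlap c phi) (transition c phi),
        smooth (overlap phi c) (transition phi c) &
        forall x, overlap c phi x ->
          rm_metric c x = pullback_metric (transition c phi) (cst 1%:M) x].

Definition isometric_to_plane : Prop :=
  exists phi, [/\ isometric_chart phi, chart_dom phi = setT &
                  chart_img phi = setT].

(* Intended for flat M, whose isometric charts cover it. *)
Definition harmonic_map (S : riemann_surface R) (f : S -> M) : Prop :=
  continuous f /\
  forall phi, isometric_chart phi -> forall i : 'I_2,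
    harmonic_on (f @^-1` chart_dom phi) (fun p => chart_map phi (f p) 0 i).

End RiemannianSurface.

(* Main.v *)
(* A flat metric has a closed connection form, so an orthonormal coframe can be rotated into a closed one,
   which integrates to an isometric chart.  Isometric charts differ by affine isometries of the plane, and
   by completeness the inverse of one of them extends to a surjective local isometry E from the whole plane
   to M: the radii of the discs to which it extends have no finite supremum.  If E a = E b, then E o g = E
   for an affine isometry g with g a = b.
   If E is injective, then M is the plane.  Otherwise E has a nonzero period t, the square of a nontrivial
   deck transformation.  If there are two independent periods, M is compact and we put b = 0.  If not, the
   coordinate h orthogonal to t is preserved by the deck group up to sign and one common constant, and
   b (E x) = |h x - c0| is a well-defined exhaustion of M, affine in isometric charts where it is positive.
   For a proper harmonic map f, the function b o f is then a proper nonnegative function on the Riemann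
   surface, harmonic where it is positive.  Comparing a negative subharmonic function u with small multiples
   of b o f outside a compact set shows that u attains its maximum, hence is constant. *)
Require Import Defs.
From HB Require Import structures.
From mathcomp Require Import all_boot all_order all_algebra.
From mathcomp Require Import all_classical all_reals all_analysis.
From mathcomp Require Import measurable_realfun complex ring lra.

Set Implicit Arguments.
Unset Strict Implicit.
Unset Printing Implicit Defensive.

Import Order.TTheory GRing.Theory Num.Theory.
Import numFieldNormedType.Exports.

Local Open Scope classical_set_scope.
Local Open Scope ring_scope.

(** * Calculus in the plane *)

Section PlaneBasics.
Context {R : realType}.
Local Notation pt := 'rV[R]_2.
Implicit Types (x y v : pt) (U : set pt).

(** Since [subharmonic] speaks only of circle averages, harmonicity of b o f is carried along as a
    mean value property ([has_mean_on]), which is stable under linear combinations. The absolute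
    value in b is forced by deck transformations reversing h, as on a Möbius band; its kink lies
    where b = 0, and the comparison with u takes place only where b o f is large. A nontrivial deck
    transformation may be a glide reflection, not a translation. Having no fixed point, its linear
    part has the eigenvalue 1, hence is an involution; this is why its square is a translation.
    Completeness is stated for [rm_dist], whereas charts only know the topology of M. Two estimates
    bridge the gap: straight segments have the expected length, and a short path ending at the
    centre of a coordinate disc also starts inside it. The norm of ['rV[R]_2] is the sup norm, so
    [ball] is a square; Euclidean geometry goes through [dot], and factors 2 come from comparing the
    two. *)

Lemma sum2 (V : nmodType) (F : 'I_2 -> V) : \sum_(i < 2) F i = F 0 + F 1.
Proof.
rewrite !big_ord_recl big_ord0 addr0; congr (F _ + F _); exact: val_inj.
Qed.

Lemma ord2E (i : 'I_2) : i = 0 \/ i = 1.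
Proof. by case: i => [[|[|//]] lti]; [left|right]; exact: val_inj. Qed.

Lemma ord2P (P : 'I_2 -> Prop) : P 0 -> P 1 -> forall i, P i.
Proof.
move=> P0 P1 [[|[|//]] lti]; [move: P0|move: P1]; congr P; exact: val_inj.
Qed.

Lemma rowP2 x y : x 0 0 = y 0 0 -> x 0 1 = y 0 1 -> x = y.
Proof. by move=> h0 h1; apply/rowP; apply: ord2P. Qed.

Lemma row2E x : x = x 0 0 *: 'e_0 + x 0 1 *: 'e_1.
Proof. by apply: rowP2; rewrite !mxE /= !(mulr0, mulr1, addr0, add0r). Qed.

Lemma coord_le x i : `|x 0 i| <= `|x|.
Proof. by rewrite [leRHS]mx_normrE; apply: (le_bigmax _ (fun i : 'I_1 * 'I_2 => `|x i.1 i.2|) (0, i)). Qed.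

Lemma norm_row_le x (e : R) : 0 <= e -> (`|x| <= e) = ((`|x 0 0| <= e) && (`|x 0 1| <= e)).
Proof.
move=> e0; apply/idP/andP => [xe|[h0 h1]].
  by split; apply: le_trans xe; exact: coord_le.
rewrite [leLHS]mx_normrE; apply/bigmax_le => // -[i j] _ /=.
by rewrite ord1; move: j; apply: ord2P.
Qed.

Lemma norm_row_lt x (e : R) : 0 < e -> (`|x| < e) = ((`|x 0 0| < e) && (`|x 0 1| < e)).
Proof.
move=> e0; apply/idP/andP => [xe|[h0 h1]].
  by split; apply: le_lt_trans xe; exact: coord_le.
rewrite [ltLHS]mx_normrE; apply/bigmax_lt => // -[i j] _ /=.
by rewrite ord1; move: j; apply: ord2P.
Qed.

Lemma norm_delta_row (i : 'I_2) : `|'e_i : pt| = 1.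
Proof.
apply/eqP; rewrite eq_le norm_row_le// !mxE; apply/andP; split.
  by apply/andP; split; rewrite ger0_norm ?ler0n // lern1 leq_b1.
by apply: le_trans (coord_le _ i); rewrite mxE !eqxx normr1.
Qed.

Lemma open_ball_sub U x : open U -> U x -> exists2 r, 0 < r & ball x r `<=` U.
Proof.
move=> oU Ux; have /nbhs_ballP[r r0 h] : nbhs x U by apply: open_nbhs_nbhs.
by exists r.
Qed.

End PlaneBasics.

(** * Directional derivatives and differentiability *)

Section Derivatives.
Context {R : realType}.
Implicit Types V W : normedModType R.

(** The hypothesis has an explicit e, the form in which mean value estimates arrive; the conclusion
    also identifies the differential. *)
Lemma differentiable_linear_approx V W (f : V -> W) (df : {linear V -> W}) x :
  continuous df ->
  (forall e : R, 0 < e -> \forall h \near (0 : V), `|f (h + x) - f x - df h| <= e * `|h|) ->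
  is_diff x f df.
Proof.
move=> dfc H.
have E : f \o shift x = cst (f x) + df +o_ 0 id.
  apply/eqaddoP => e e0; near=> h.
  have -> : (f \o shift x - (cst (f x) + df)) h = f (h + x) - f x - df h.
    by rewrite opprD addrA.
  near: h; exact: H.
have D := diff_unique dfc E.
apply: DiffDef => //.
apply/diff_locallyP; split; first by rewrite D.
by rewrite D.
Unshelve. all: by end_near. Qed.

(** Moves questions about directional derivatives to functions of one real variable, where the mean
    value theorem and the one-variable chain rule apply. *)
Lemma is_derive_lineE V W (f : V -> W) (y v : V) (s : R) df :
  is_derive s 1 (fun s => f (y + s *: v)) df <-> is_derive (y + s *: v) v f df.
Proof.
have E : (fun h : R => h^-1 *: (((fun s => f (y + s *: v)) \o shift s) (h *: 1) - f (y + s *: v)))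
   = (fun h => h^-1 *: ((f \o shift (y + s *: v)) (h *: v) - f (y + s *: v))).
  apply/funext => h /=; congr (_ *: (f _ - _)).
  by rewrite [h *: 1]mulr1 scalerDl addrCA.
by split=> -[dx dv]; apply: DeriveDef; move: dx dv; rewrite /derivable /derive E.
Qed.

Lemma is_derive_line V W (f : V -> W) (y v : V) (s : R) df :
  is_derive (y + s *: v) v f df -> is_derive s 1 (fun s => f (y + s *: v)) df.
Proof. by move/is_derive_lineE. Qed.

Lemma is_derive_line0 V W (f : V -> W) (y v : V) df :
  is_derive (0 : R) 1 (fun s => f (y + s *: v)) df <-> is_derive y v f df.
Proof. by rewrite is_derive_lineE scale0r addr0. Qed.

(** The symmetric range of s spares the callers a distinction by the sign of h. *)
Lemma MVT0 (g dg : R -> R) (h : R) :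
  (forall s : R, `|s| <= `|h| -> is_derive s (1 : R) g (dg s)) ->
  exists2 s : R, `|s| <= `|h| & g h - g 0 = h * dg s.
Proof.
move=> H.
have C a b : `|a| <= `|h| -> `|b| <= `|h| -> {within `[a, b], continuous g}.
  move=> ah bh; apply: derivable_within_continuous => s; rewrite in_itv /= => /andP[as_ sb].
  have /H[] // : `|s| <= `|h|.
  by rewrite ler_norml; move: ah bh; rewrite !ler_norml; lra.
have D a b : `|a| <= `|h| -> `|b| <= `|h| -> forall s : R, s \in `]a, b[ -> is_derive s (1 : R) g (dg s).
  move=> ah bh s; rewrite in_itv /= => /andP[as_ sb]; apply: H.
  by rewrite ler_norml; move: ah bh; rewrite !ler_norml; lra.
have n0 : `|0 : R| <= `|h| by rewrite normr0.
have [h0|h0] := leP 0 h.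
  have [s + ->] := MVT_segment h0 (D _ _ n0 (lexx _)) (C _ _ n0 (lexx _)).
  by rewrite in_itv /= => /andP[s0 sh]; exists s; [rewrite !ger0_norm|rewrite subr0 mulrC].
have [s + E] := MVT_segment (ltW h0) (D _ _ (lexx _) n0) (C _ _ (lexx _) n0).
rewrite in_itv /= => /andP[s0 sh]; exists s; first by rewrite !ler0_norm// ?lerN2// ltW.
by rewrite -opprB E; ring.
Qed.

End Derivatives.

(** * Differentiability from continuous partial derivatives *)

Section PlaneDerivatives.
Context {R : realType}.
Local Notation pt := 'rV[R]_2.
Implicit Types (x y v : pt) (U : set pt) (f : pt -> R).

(** The differential of a real function with partial derivatives a and b. *)
Definition grad_form (a b : R) : pt -> R := fun v => v 0 0 * a + v 0 1 * b.

Lemma grad_form_linear a b : linear (grad_form a b).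
Proof. by move=> k u v; rewrite /grad_form !mxE /= /GRing.scale /=; ring. Qed.

HB.instance Definition _ a b := GRing.isLinear.Build R pt R _ (grad_form a b) (grad_form_linear a b).

Lemma grad_form_continuous a b : continuous (grad_form a b).
Proof.
move=> v; rewrite /grad_form.
apply: (@continuousD _ R^o _ (fun v : pt => v 0 0 * a) (fun v => v 0 1 * b)).
  apply: (@continuousM _ _ (fun v : pt => v 0 0) (cst a)); [exact: coord_continuous|exact: cst_continuous].
apply: (@continuousM _ _ (fun v : pt => v 0 1) (cst b)); [exact: coord_continuous|exact: cst_continuous].
Qed.

(** The increment is split into a step along e_0 and a step along e_1; the mean value theorem for
    each step and continuity of the partial derivatives bound the error. *)
Lemma C1_is_diff f x :
  (forall i, \forall y \near x, derivable f y 'e_i) ->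
  (forall i, {for x, continuous ('D_'e_i f)}) ->
  is_diff x f (grad_form ('D_'e_0 f x) ('D_'e_1 f x)).
Proof.
move=> fd fc.
have := @grad_form_continuous ('D_'e_0 f x) ('D_'e_1 f x).
move=> /differentiable_linear_approx; apply => e e0.
have e20 : 0 < e / 2 by rewrite divr_gt0.
have N i : \forall y \near x, derivable f y 'e_i /\ `|'D_'e_i f y - 'D_'e_i f x| <= e / 2.
  near=> y; split; first by near: y; exact: fd.
  rewrite distrC; near: y; move/cvgrPdist_le : (fc i); exact.
have /nbhs_ballP[r /= r0 Br] : \forall y \near x, forall i, derivable f y 'e_i /\ `|'D_'e_i f y - 'D_'e_i f x| <= e / 2.
  by apply: filterS2 (N 0) (N 1) => y h0 h1 i; case: (ord2E i) => ->.
near=> h.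
have hr : `|h| < r by near: h; exact: (@nbhs0_lt _ pt).
have inB (s t : R) : `|s| <= `|h| -> `|t| <= `|h| -> ball x r (x + s *: 'e_0 + t *: 'e_1).
  move=> sh th; rewrite -ball_normE /= opprD addrA opprD addrA subrr sub0r -opprD normrN.
  apply: le_lt_trans hr; rewrite norm_row_le// !mxE /= !(mulr0, mulr1, addr0, add0r).
  by rewrite sh th.
have D0 (s : R) : `|s| <= `|h 0 0| ->
    is_derive s (1 : R) (fun s => f (x + s *: 'e_0)) ('D_'e_0 f (x + s *: 'e_0)).
  move=> sh; apply/is_derive_line/derivableP.
  have n0 : `|0 : R| <= `|h| by rewrite normr0.
  by have /Br/(_ 0)[] := inB s 0 (le_trans sh (coord_le _ _)) n0; rewrite scale0r addr0.
have D1 (s : R) : `|s| <= `|h 0 1| ->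
    is_derive s (1 : R) (fun s => f (x + h 0 0 *: 'e_0 + s *: 'e_1)) ('D_'e_1 f (x + h 0 0 *: 'e_0 + s *: 'e_1)).
  move=> sh; apply/is_derive_line/derivableP.
  by have /Br/(_ 1)[] := inB (h 0 0) s (coord_le _ _) (le_trans sh (coord_le _ _)).
have [s0 sh0 E0] := MVT0 D0; have [s1 sh1 E1] := MVT0 D1.
move: E0 E1; rewrite scale0r addr0 scale0r addr0 -addrA -row2E [x + h]addrC => E0 E1.
have -> : f (h + x) - f x - grad_form ('D_'e_0 f x) ('D_'e_1 f x) h =
  h 0 0 * ('D_'e_0 f (x + s0 *: 'e_0) - 'D_'e_0 f x) +
  h 0 1 * ('D_'e_1 f (x + h 0 0 *: 'e_0 + s1 *: 'e_1) - 'D_'e_1 f x).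
  by rewrite /grad_form !mulrBr -E0 -E1; ring.
rewrite (le_trans (ler_normD _ _))// [e * _](_ : _ = `|h| * (e / 2) + `|h| * (e / 2)); last by field.
apply: lerD; rewrite normrM; apply: ler_pM => //; try exact: coord_le.
  have n0 : `|0 : R| <= `|h| by rewrite normr0.
  by have /Br/(_ 0)[] := inB s0 0 (le_trans sh0 (coord_le _ _)) n0; rewrite scale0r addr0.
by have /Br/(_ 1)[] := inB (h 0 0) s1 (coord_le _ _) (le_trans sh1 (coord_le _ _)).
Unshelve. all: by end_near. Qed.

End PlaneDerivatives.

(** * Chain rules *)

Section ChainRule.
Context {R : realType}.
Local Notation pt := 'rV[R]_2.

Lemma is_derive_row (V : normedModType R) (g : V -> pt) (x v : V) (d : pt) :
  (forall j, is_derive x v (fun y => g y 0 j) (d 0 j)) <-> is_derive x v g d.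
Proof.
split=> [H|[dx dv]].
  have D : derivable g x v by apply/derivable_mxP => i j; rewrite ord1; case: (H j).
  apply: DeriveDef => //; apply/rowP => j; rewrite derive_mx// mxE.
  by case: (H j).
move=> j; apply: DeriveDef; first by move/derivable_mxP : dx; exact.
by rewrite -dv derive_mx// mxE.
Qed.

(** The map g needs a derivative in the direction v only: restricted to the line through x it is a
    function of one variable, for which derivable means differentiable. *)
Lemma is_derive_chain (V : normedModType R) (f : pt -> R) (g : V -> pt) (x v : V) (a b : R) d :
  is_diff (g x) f (grad_form a b) -> is_derive x v g d ->
  is_derive x v (f \o g) (grad_form a b d).
Proof.
move=> df /is_derive_line0 dg; apply/is_derive_line0.
set h := fun s => g (x + s *: v) in dg *.
have dh : differentiable h 0 by apply/derivable1_diffP; case: dg.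
have h0 : h 0 = g x by rewrite /h scale0r addr0.
have dfh : is_diff (h 0) f (grad_form a b) by rewrite h0.
have D : differentiable (f \o h) 0 by apply: differentiable_comp => //; case: dfh.
apply: DeriveDef; first exact/derivable1_diffP.
have -> : (fun s => (f \o g) (x + s *: v)) = f \o h by [].
rewrite deriveE// diff_comp//.
have -> : d = 'd h 0 1 by rewrite -deriveE//; case: dg => _ ->.
by rewrite /=; case: dfh => _ ->.
Qed.

Lemma is_derive_comp1 (V : normedModType R) (f : V -> R) (p : R -> R) (x v : V) (df dp : R) :
  is_derive x v f df -> is_derive (f x) 1 p dp -> is_derive x v (p \o f) (dp * df).
Proof.
move=> /is_derive_line0 D P; apply/is_derive_line0.
have fx : f (x + 0 *: v) = f x by rewrite scale0r addr0.
rewrite -fx in P.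
by have := is_derive1_comp P D; rewrite mulrC.
Qed.

End ChainRule.

(** * Closure properties of the classes C^k *)

Section CkTheory.
Context {R : realType}.
Local Notation pt := 'rV[R]_2.
Implicit Types (V W : normedModType R) (U : set pt) (k : nat).

Lemma Ck_cont V k U (f : pt -> V) x : Ck k U f -> U x -> {for x, continuous f}.
Proof. by case: k => [|k] [H _] Ux; apply: H; exact/mem_set. Qed.

Lemma Ck_S_elim V k U (f : pt -> V) : Ck k.+1 U f ->
  (forall i x, U x -> is_derive x 'e_i f ('D_'e_i f x)) /\ forall i, Ck k U ('D_'e_i f).
Proof.
by move=> [_ H]; split=> [i x Ux|i]; [apply/derivableP; case: (H i) => + _; apply; exact/mem_set|case: (H i)].
Qed.

Lemma Ck_sub V k U U' (f : pt -> V) : U' `<=` U -> Ck k U f -> Ck k U' f.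
Proof.
move=> sub; elim: k f => [|k IH] f [cf H]; split=> //.
- by move=> x /set_mem/sub/mem_set; exact: cf.
- by move=> x /set_mem/sub/mem_set; exact: cf.
- move=> i; have [d c] := H i; split; last exact: IH.
  by move=> x /set_mem/sub/mem_set; exact: d.
Qed.

(** [Ck] is defined by limits in the whole plane, hence is a condition on each point of U
    separately. *)
Lemma Ck_local V k U (f : pt -> V) :
  (forall x, U x -> exists2 W, W x & Ck k W f) -> Ck k U f.
Proof.
elim: k f => [|k IH] f H.
  by split=> // x /set_mem/H[W Wx fW]; exact: Ck_cont fW Wx.
split; first by move=> x /set_mem/H[W Wx fW]; exact: Ck_cont fW Wx.
move=> i; split.
  by move=> x /set_mem/H[W Wx /Ck_S_elim[fW _]]; have [] := fW i x Wx.
by apply: IH => x /H[W Wx /Ck_S_elim[_ fW]]; exists W.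
Qed.

Lemma near_continuous (T T' : topologicalType) (f g : T -> T') x :
  {near x, f =1 g} -> {for x, continuous f} -> {for x, continuous g}.
Proof.
move=> N cf; rewrite /prop_for /continuous_at -(nbhs_singleton N).
by apply: cvg_trans cf; exact: (near_eq_cvg N).
Qed.

Lemma Ck_eq V k U (f g : pt -> V) : open U -> (forall x, U x -> f x = g x) ->
  Ck k U f -> Ck k U g.
Proof.
move=> oU.
have N (h h' : pt -> V) x : (forall x, U x -> h x = h' x) -> U x -> {near x, h =1 h'}.
  by move=> E Ux; near=> y; apply: E; near: y; exact: open_nbhs_nbhs.
elim: k f g => [|k IH] f g E [cf H].
  by split=> // x /set_mem Ux; apply: near_continuous (N _ _ x E Ux) _; apply: cf; exact: mem_set.
split; first by move=> x /set_mem Ux; apply: near_continuous (N _ _ x E Ux) _; apply: cf; exact: mem_set.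
move=> i; have {H}[d c] := H i; split.
  by move=> x xU; apply: near_eq_derivable (N _ _ x E (set_mem xU)) (d x xU).
apply: IH c => x Ux; apply: near_eq_derive; exact: N.
Unshelve. all: by end_near. Qed.

(** The rule behind the inductions on k below: exhibit the expected partial derivatives and show
    that they are of class C^k. *)
Lemma Ck_S_intro V k U (f : pt -> V) (df : 'I_2 -> pt -> V) : open U ->
  (forall x, U x -> {for x, continuous f}) ->
  (forall i x, U x -> is_derive x 'e_i f (df i x)) ->
  (forall i, Ck k U (df i)) -> Ck k.+1 U f.
Proof.
move=> oU cf H H0; split; first by move=> x /set_mem; exact: cf.
move=> i; split; first by move=> x /set_mem Ux; have [] := H i x Ux.
by apply: Ck_eq (H0 i) => // x Ux; have [] := H i x Ux.
Qed.

Lemma Ck_pred V k U (f : pt -> V) : Ck k.+1 U f -> Ck k U f.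
Proof.
elim: k f => [|k IH] f [cf H]; first by split.
by split=> // i; have [d c] := H i; split=> //; exact: IH.
Qed.

Lemma Ck_le V k l U (f : pt -> V) : (k <= l)%N -> Ck l U f -> Ck k U f.
Proof.
by move=> /subnK <-; elim: (l - k)%N => // n IH; rewrite addSn => /Ck_pred.
Qed.

Lemma Ck_cst V k U (a : V) : open U -> Ck k U (cst a).
Proof.
move=> oU; elim: k a => [|k IH] a; first by split=> // x _; exact: cst_continuous.
by apply: (@Ck_S_intro _ _ _ _ (fun _ => cst 0)) => // x _; exact: cst_continuous.
Qed.

Lemma Ck_add V k U (f g : pt -> V) : open U -> Ck k U f -> Ck k U g -> Ck k U (fun x => f x + g x).
Proof.
move=> oU; elim: k f g => [|k IH] f g fk gk.
  split=> // x /set_mem Ux; apply: continuousD; [exact: Ck_cont fk Ux|exact: Ck_cont gk Ux].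
have [d c] := Ck_S_elim fk; have [d' c'] := Ck_S_elim gk.
apply: (@Ck_S_intro _ _ _ _ (fun i x => 'D_'e_i f x + 'D_'e_i g x)) => // [x Ux|i x Ux|i]; last exact: IH.
- by apply: continuousD; [exact: Ck_cont fk Ux|exact: Ck_cont gk Ux].
- by apply: is_deriveD; [exact: d|exact: d'].
Qed.

Lemma Ck_mul k U (f g : pt -> R) : open U -> Ck k U f -> Ck k U g -> Ck k U (fun x => f x * g x).
Proof.
move=> oU; elim: k f g => [|k IH] f g fk gk.
  split=> // x /set_mem Ux; apply: continuousM; [exact: Ck_cont fk Ux|exact: Ck_cont gk Ux].
have [d c] := Ck_S_elim fk; have [d' c'] := Ck_S_elim gk.
apply: (@Ck_S_intro _ _ _ _ (fun i x => f x * 'D_'e_i g x + g x * 'D_'e_i f x)) => // [x Ux|i x Ux|i].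
- by apply: continuousM; [exact: Ck_cont fk Ux|exact: Ck_cont gk Ux].
- by apply: is_deriveM; [exact: d|exact: d'].
- by apply: Ck_add => //; apply: IH => //; exact: Ck_pred.
Qed.

Lemma Ck_opp k U (f : pt -> R) : open U -> Ck k U f -> Ck k U (fun x => - f x).
Proof.
move=> oU fk; apply: (@Ck_eq _ _ _ (fun x => (-1) * f x)) => // [x _|]; first by rewrite mulN1r.
by apply: Ck_mul => //; exact: Ck_cst.
Qed.

Lemma Ck_sub2 k U (f g : pt -> R) : open U -> Ck k U f -> Ck k U g -> Ck k U (fun x => f x - g x).
Proof. by move=> oU fk gk; apply: Ck_add => //; exact: Ck_opp. Qed.

Lemma Ck_inv k U (f : pt -> R) : open U -> (forall x, U x -> f x != 0) ->
  Ck k U f -> Ck k U (fun x => (f x)^-1).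
Proof.
move=> oU f0; elim: k => [|k IH] fk.
  by split=> // x /set_mem Ux; apply: (@continuousV _ _ f); [exact: f0|exact: Ck_cont fk Ux].
have [d c] := Ck_S_elim fk; have fk' := IH (Ck_pred fk).
apply: (@Ck_S_intro _ _ _ _ (fun i x => - ((f x)^-1 * (f x)^-1) * 'D_'e_i f x)) => // [x Ux|i x Ux|i].
- by apply: (@continuousV _ _ f); [exact: f0|exact: Ck_cont fk Ux].
- have [dx dv] := d i x Ux; apply: DeriveDef; first by apply: derivableV => //; exact: f0.
  by rewrite deriveV//; [rewrite -exprVn expr2|exact: f0].
- by apply: Ck_mul => //; apply: Ck_opp => //; apply: Ck_mul.
Qed.

Lemma Ck_sqrt k U (f : pt -> R) : open U -> (forall x, U x -> 0 < f x) ->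
  Ck k U f -> Ck k U (fun x => Num.sqrt (f x)).
Proof.
move=> oU f0.
have s0 x : U x -> Num.sqrt (f x) != 0 by move=> /f0; rewrite -sqrtr_gt0 => /gt_eqF ->.
elim: k => [|k IH] fk.
  by split=> // x /set_mem Ux; apply: continuous_comp; [exact: Ck_cont fk Ux|exact: sqrt_continuous].
have [d c] := Ck_S_elim fk; have fk' := IH (Ck_pred fk).
apply: (@Ck_S_intro _ _ _ _ (fun i x => (2^-1 * (Num.sqrt (f x))^-1) * 'D_'e_i f x)) => // [x Ux|i x Ux|i].
- by apply: continuous_comp; [exact: Ck_cont fk Ux|exact: sqrt_continuous].
- rewrite -invfM; apply: is_derive_comp1; first exact: d.
  by apply: is_derive1_sqrt; exact: f0.
- apply: Ck_mul => //; apply: Ck_mul => //; first exact: Ck_cst.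
  by apply: Ck_inv.
Qed.

Lemma Ck_cos_sin k U (f : pt -> R) : open U -> Ck k U f ->
  Ck k U (fun x => cos (f x)) /\ Ck k U (fun x => sin (f x)).
Proof.
move=> oU.
have cc l x : Ck l U f -> U x -> {for x, continuous (fun x => cos (f x))}.
  by move=> fk Ux; apply: continuous_comp; [exact: Ck_cont fk Ux|exact: continuous_cos].
have cs l x : Ck l U f -> U x -> {for x, continuous (fun x => sin (f x))}.
  by move=> fk Ux; apply: continuous_comp; [exact: Ck_cont fk Ux|exact: continuous_sin].
elim: k => [|k IH] fk.
  by split; split=> // x /set_mem Ux; [exact: cc fk Ux|exact: cs fk Ux].
have [d c] := Ck_S_elim fk; have [fc fs] := IH (Ck_pred fk).
split.
- apply: (@Ck_S_intro _ _ _ _ (fun i x => (- sin (f x)) * 'D_'e_i f x)) => // [x Ux|i x Ux|i].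
  + exact: cc fk Ux.
  + by have := is_derive_comp1 (d i x Ux) (is_derive_cos (f x)).
  + by apply: Ck_mul => //; exact: Ck_opp.
- apply: (@Ck_S_intro _ _ _ _ (fun i x => cos (f x) * 'D_'e_i f x)) => // [x Ux|i x Ux|i].
  + exact: cs fk Ux.
  + by have := is_derive_comp1 (d i x Ux) (is_derive_sin (f x)).
  + exact: Ck_mul.
Qed.

Lemma Ck_mxcoord m n k U (f : pt -> 'M[R]_(m.+1, n.+1)) i j : open U -> Ck k U f -> Ck k U (fun x => f x i j).
Proof.
move=> oU; elim: k f => [|k IH] f fk.
  by split=> // x /set_mem Ux; apply: (@continuous_comp _ _ _ f (fun M : 'M[R]_(m.+1, n.+1) => M i j) x); [exact: Ck_cont fk Ux|exact: coord_continuous].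
have [d c] := Ck_S_elim fk.
apply: (@Ck_S_intro _ _ _ _ (fun l x => 'D_'e_l f x i j)) => // [x Ux|l x Ux|l]; last exact: IH.
- by apply: (@continuous_comp _ _ _ f (fun M : 'M[R]_(m.+1, n.+1) => M i j) x); [exact: Ck_cont fk Ux|exact: coord_continuous].
- have [dx dv] := d l x Ux; apply: DeriveDef; first by move/derivable_mxP : dx.
  by rewrite derive_mx// mxE.
Qed.

Lemma row_continuous (V : topologicalType) (f : V -> pt) x :
  (forall j, {for x, continuous (fun y => f y 0 j)}) -> {for x, continuous f}.
Proof.
move=> H; apply/cvgrPdist_lt => e e0; near=> y.
rewrite norm_row_lt// !mxE; apply/andP; split; near: y.
  by move: (H 0) => /cvgrPdist_lt; exact.
by move: (H 1) => /cvgrPdist_lt; exact.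
Unshelve. all: by end_near. Qed.

Lemma Ck_row k U (f : pt -> pt) : open U ->
  Ck k U f <-> forall j, Ck k U (fun x => f x 0 j).
Proof.
move=> oU; split=> [fk j|]; first exact: Ck_mxcoord.
elim: k f => [|k IH] f fk.
  by split=> // x /set_mem Ux; apply: row_continuous => j; exact: Ck_cont (fk j) Ux.
apply: (@Ck_S_intro _ _ _ _ (fun l x => \row_j 'D_'e_l (fun x => f x 0 j) x)) => // [x Ux|l x Ux|l].
- by apply: row_continuous => j; exact: Ck_cont (fk j) Ux.
- by apply/is_derive_row => j; rewrite mxE; have [d _] := Ck_S_elim (fk j); exact: d.
- apply: IH => j; have [_ c] := Ck_S_elim (fk j).
  by apply: Ck_eq (c l) => // x _; rewrite mxE.
Qed.

Lemma Ck1_is_diff U (f : pt -> R) x : open U -> Ck 1 U f -> U x ->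
  is_diff x f (grad_form ('D_'e_0 f x) ('D_'e_1 f x)).
Proof.
move=> oU /Ck_S_elim[d c] Ux; apply: C1_is_diff => i; last exact: Ck_cont (c i) Ux.
by near=> y; have [] // := d i y _; near: y; exact: open_nbhs_nbhs.
Unshelve. all: by end_near. Qed.

Lemma Ck_comp k U U' (f : pt -> R) (g : pt -> pt) : open U -> open U' ->
  (forall x, U x -> U' (g x)) -> Ck k U' f -> Ck k U g -> Ck k U (f \o g).
Proof.
move=> oU oU' gU; elim: k f => [|k IH] f fk gk.
  by split=> // x /set_mem Ux; apply: continuous_comp; [exact: Ck_cont gk Ux|apply: Ck_cont fk _; exact: gU].
have [d c] := Ck_S_elim fk; have [d' c'] := Ck_S_elim gk.
have gj := (Ck_row k.+1 g oU).1 gk.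
apply: (@Ck_S_intro _ _ _ _ (fun i x => 'D_'e_i (fun x => g x 0 0) x * 'D_'e_0 f (g x)
   + 'D_'e_i (fun x => g x 0 1) x * 'D_'e_1 f (g x))) => // [x Ux|i x Ux|i].
- by apply: continuous_comp; [exact: Ck_cont gk Ux|apply: Ck_cont fk _; exact: gU].
- have := is_derive_chain (Ck1_is_diff oU' (Ck_le (ltn0Sn k) fk) (gU x Ux)) (d' i x Ux).
  by rewrite /grad_form; have [dx _] := d' i x Ux; rewrite derive_mx// !mxE.
- have H j : Ck k U ('D_'e_i (fun x => g x 0 j)) by have [_] := Ck_S_elim (gj j).
  have gk' := Ck_pred gk.
  by apply: Ck_add => //; apply: Ck_mul => //; [exact: (IH ('D_'e_0 f))|exact: (IH ('D_'e_1 f))].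
Qed.

Lemma Ck_comp_row k U U' (f g : pt -> pt) : open U -> open U' ->
  (forall x, U x -> U' (g x)) -> Ck k U' f -> Ck k U g -> Ck k U (f \o g).
Proof.
move=> oU oU' gU /(Ck_row k f oU') fk gk; apply/Ck_row => // j.
exact: (Ck_comp oU oU' gU (fk j) gk).
Qed.

End CkTheory.

(** * Integrals, closed forms and mean values *)

Section Integrals.
Context {R : realType}.
Implicit Types (a b : R) (f F : R -> R).
Local Notation leb := (@lebesgue_measure R).

Lemma within_itv_continuous a b f :
  (forall t, a <= t <= b -> {for t, continuous f}) -> {within `[a, b], continuous f}.
Proof. by move=> H; apply: continuous_in_subspaceT => t; rewrite inE /= in_itv /=; exact: H. Qed.

Lemma integrable_itv a b f : (forall t, a <= t <= b -> {for t, continuous f}) ->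
  leb.-integrable `[a, b] (EFin \o f).
Proof.
move=> H; apply: continuous_compact_integrable; first exact: segment_compact.
exact: within_itv_continuous.
Qed.

Lemma derive_continuous f (t d : R) : is_derive t (1 : R) f d -> {for t, continuous f}.
Proof. by move=> [/derivable1_diffP D _]; exact: differentiable_continuous. Qed.

Lemma Rint_FTC a b F f : a < b ->
  (forall t, a <= t <= b -> is_derive t (1 : R) F (f t)) ->
  (forall t, a <= t <= b -> {for t, continuous f}) ->
  \int[leb]_(t in `[a, b]) f t = F b - F a.
Proof.
move=> ab dF cf.
have cF t : a <= t <= b -> {for t, continuous F} by move=> /dF; exact: derive_continuous.
have := continuous_within_itvP F ab; case=> + _ => /(_ (within_itv_continuous cF))[_ La Lb].
rewrite /Rintegral (@continuous_FTC2 R f F a b ab (within_itv_continuous cf))//.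
- split=> // t; rewrite in_itv /= => /andP[at_ tb].
  by have [] // := dF t; rewrite !ltW.
- move=> t; rewrite in_itv /= => /andP[at_ tb].
  rewrite derive1E; have tab : a <= t <= b by rewrite !ltW.
  by have [_ ->] := dF t tab.
Qed.

(** A constant serves as dominating function; in the applications it comes from compactness of a
    box. *)
Lemma is_derive_param_int (G dG : R -> R -> R) (a b x0 d C : R) : 0 < d ->
  (forall x t, `|x - x0| < d -> a <= t <= b -> is_derive x (1 : R) (G^~ t) (dG x t)) ->
  (forall x t, `|x - x0| < d -> a <= t <= b -> {for t, continuous (G x)}) ->
  (forall x t, `|x - x0| < d -> a <= t <= b -> `|dG x t| <= C) ->
  is_derive x0 (1 : R) (fun x => \int[leb]_(t in `[a, b]) G x t)
     (\int[leb]_(t in `[a, b]) dG x0 t).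
Proof.
move=> d0 dGP cG bG.
have I x : `]x0 - d, x0 + d[%classic x <-> `|x - x0| < d.
  by rewrite /= in_itv /= ltr_distl.
have mB : measurable (`[a, b] : set R) by [].
have Ia : `]x0 - d, x0 + d[%classic x0 by apply/I; rewrite subrr normr0.
have intG x : `]x0 - d, x0 + d[%classic x -> leb.-integrable `[a, b] (EFin \o G x).
  by move=> /I xd; apply: integrable_itv => t tab; exact: cG.
have drv x t : `]x0 - d, x0 + d[%classic x -> `[a, b]%classic t -> derivable (G^~ t) x 1.
  by move=> /I xd; rewrite /= in_itv /= => tab; have [] := dGP x t xd tab.
have C0 (t : R) : 0 <= `|C| by [].
have intC : leb.-integrable `[a, b] (EFin \o cst `|C|).
  by apply: integrable_itv => t _; exact: cst_continuous.
have bnd x t : `]x0 - d, x0 + d[%classic x -> `[a, b]%classic t -> `|partial1of2 G x t| <= `|C|.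
  move=> /I xd; rewrite /= in_itv /= => tab; rewrite partial1of2E.
  have [_ ->] := dGP x t xd tab; apply: le_trans (bG x t xd tab) _; exact: ler_norm.
apply: DeriveDef; first exact: (@derivable_under_integral R _ _ leb G _ mB x0 _ _ Ia intG drv _ C0 intC bnd).
rewrite -derive1E (@differentiation_under_integral R _ _ leb G _ mB x0 _ _ Ia intG drv _ C0 intC bnd).
apply: eq_Rintegral => t; rewrite inE /= in_itv /= => tab.
have x0d : `|x0 - x0| < d by rewrite subrr normr0.
by rewrite partial1of2E; have [_ ->] := dGP x0 t x0d tab.
Qed.

End Integrals.

Section Boxes.
Context {R : realType}.
Local Notation pt := 'rV[R]_2.

(** For the sup norm a closed ball is a product of two segments. *)
Lemma box_compact (x : pt) (r : R) : compact [set y | `|y - x| <= r].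
Proof.
have [r0|r0] := ltP r 0.
  rewrite (_ : [set y | _] = set0); first exact: compact0.
  by apply/seteqP; split=> // y /= h; have := le_trans (normr_ge0 _) h; rewrite leNgt r0.
have -> : [set y | `|y - x| <= r] = [set v : pt | forall i, `[x 0 i - r, x 0 i + r]%classic (v ord0 i)].
  apply/seteqP; split=> y /=.
    rewrite norm_row_le// !mxE !ler_distl => /andP[h0 h1] i.
    by case: (ord2E i) => ->; rewrite in_itv.
  move=> h; rewrite norm_row_le// !mxE.
  by have := h 0; have := h 1; rewrite !in_itv /= -!ler_distl => -> ->.
apply: (@rV_compact R 2 (fun i => `[x 0 i - r, x 0 i + r]%classic)) => i.
exact: segment_compact.
Qed.

Lemma bounded_on_compact (T : topologicalType) (K : set T) (f : T -> R) : compact K ->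
  (forall y, K y -> {for y, continuous f}) -> exists C, forall y, K y -> `|f y| <= C.
Proof.
move=> cK cf; have [[y0 Ky0]|K0] := pselect (K !=set0); last first.
  by exists 0 => y Ky; case: K0; exists y.
have [||c _ H] := @compact_EVT_max T R (fun y => `|f y|) K _ cK.
- by exists y0.
- apply: continuous_in_subspaceT => y /set_mem Ky.
  apply: (@continuous_comp _ _ _ f (fun z : R => `|z|)); first exact: cf.
  exact: norm_continuous.
by exists `|f c| => y Ky; apply: H; exact/mem_set.
Qed.

Lemma grad_form_delta (a b t : R) j : grad_form a b (t *: 'e_j) = t * (if j == 0 then a else b).
Proof. by rewrite /grad_form !mxE; case: (ord2E j) => -> /=; ring. Qed.

Lemma grad_form_D (f : pt -> R) x (t : R) j :
  grad_form ('D_'e_0 f x) ('D_'e_1 f x) (t *: 'e_j) = t * 'D_'e_j f x.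
Proof. by rewrite grad_form_delta; case: (ord2E j) => ->. Qed.

Lemma is_derive_segment (P : pt -> R) U (p w : pt) (s : R) : open U -> Ck 1 U P ->
  U (p + s *: w) ->
  is_derive s 1 (fun s => P (p + s *: w))
    (grad_form ('D_'e_0 P (p + s *: w)) ('D_'e_1 P (p + s *: w)) w).
Proof.
move=> oU cP Us; have D := Ck1_is_diff oU cP Us.
have L : is_derive s (1 : R) (fun s => p + s *: w) w.
  by apply/(@is_derive_lineE _ _ _ id); rewrite -[X in is_derive _ _ _ X]/w; exact: is_derive_id.
exact: (@is_derive_chain R R P (fun s => p + s *: w) s 1 _ _ w D L).
Qed.

End Boxes.

(** * The Poincaré lemma on a ball *)

Section Poincare.
Context {R : realType}.
Local Notation pt := 'rV[R]_2.
Variables (x0 : pt) (r : R) (P : 'I_2 -> pt -> R).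
Let B : set pt := ball x0 r.
Hypothesis CP : forall i, Ck 1 B (P i).
Hypothesis closedP : forall x, B x -> 'D_'e_0 (P 1) x = 'D_'e_1 (P 0) x.

Let g (x : pt) (t : R) : R :=
  (x - x0) 0 0 * P 0 (x0 + t *: (x - x0)) + (x - x0) 0 1 * P 1 (x0 + t *: (x - x0)).

(** The integral of the form P_0 dx + P_1 dy along the segment from x0 to x. *)
Definition primitive (x : pt) : R := \int[@lebesgue_measure R]_(t in `[0, 1]) g x t.

Let oB : open B. Proof. exact: ball_open. Qed.

Let BE (x : pt) : B x = (`|x - x0| < r) :> Prop.
Proof. by rewrite /B -ball_normE /= distrC. Qed.

Let seg (x : pt) (t : R) : B x -> 0 <= t <= 1 -> B (x0 + t *: (x - x0)).
Proof.
rewrite !BE => xr /andP[t0 t1]; rewrite addrC addKr normrZ ger0_norm//.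
by apply: le_lt_trans xr; rewrite ler_piMl.
Qed.

Let dg j (x : pt) (t : R) : R := P j (x0 + t *: (x - x0)) +
  ((x - x0) 0 0 * (t * 'D_'e_j (P 0) (x0 + t *: (x - x0))) +
   (x - x0) 0 1 * (t * 'D_'e_j (P 1) (x0 + t *: (x - x0)))).

Let line_cont (f : pt -> R) (x : pt) (t : R) : B x -> 0 <= t <= 1 ->
  (forall y, B y -> {for y, continuous f}) ->
  {for t, continuous (fun t : R => f (x0 + t *: (x - x0)))}.
Proof.
move=> Bx t01 cf; apply: (@continuous_comp _ _ _ (fun t : R => x0 + t *: (x - x0)) f).
  apply: continuousD; first exact: cst_continuous.
  exact: scalel_continuous.
by apply: cf; exact: seg.
Qed.

(** Differentiate under the integral sign. By closedness the resulting integrand is the t-derivative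
    of t P_i(x0 + t (x - x0)), whose increment over [0, 1] is P_i(x). *)
Lemma primitiveP i x : B x -> is_derive x 'e_i primitive (P i x).
Proof.
move=> Bx; apply/is_derive_line0.
(* Half of the distance left to the boundary: the points x + s e_i with |s| < d then stay in a
   compact box inside B, where the integrands are bounded. *)
set d := (r - `|x - x0|) / 2.
have d0 : 0 < d by rewrite divr_gt0// subr_gt0 -BE.
set rho := `|x - x0| + d.
have rho0 : 0 <= rho by rewrite addr_ge0// ltW.
have rr : rho < r by have := Bx; rewrite BE /rho /d; lra.
have near_x (s : R) : `|s| < d -> `|x + s *: 'e_i - x0| <= rho.
  move=> sd; rewrite addrAC; apply: le_trans (ler_normD _ _) _.
  by rewrite lerD2l normrZ norm_delta_row mulr1 ltW.
have KB y : `|y - x0| <= rho -> B y by move=> yr; rewrite BE; exact: le_lt_trans yr rr.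
have cP j y : B y -> {for y, continuous (P j)} by exact: Ck_cont.
have cdP l j y : B y -> {for y, continuous ('D_'e_l (P j))}.
  by have [_ c] := Ck_S_elim (CP j); exact: Ck_cont (c l).
have dP j l y : B y -> is_derive y 'e_l (P j) ('D_'e_l (P j) y).
  by have [c _] := Ck_S_elim (CP j); exact: c.
have bnd (f : pt -> R) : (forall y, B y -> {for y, continuous f}) -> exists C, forall y, `|y - x0| <= rho -> `|f y| <= C.
  move=> cf; have [|C HC] := @bounded_on_compact R pt _ f (@box_compact R x0 rho).
    by move=> y /KB; exact: cf.
  by exists C.
have [C1 HC1] := bnd _ (cP i); have [C2 HC2] := bnd _ (cdP i 0); have [C3 HC3] := bnd _ (cdP i 1).
have segK (y : pt) (t : R) : `|y - x0| <= rho -> 0 <= t <= 1 -> `|x0 + t *: (y - x0) - x0| <= rho.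
  move=> yr /andP[t0 t1]; rewrite addrC addKr normrZ ger0_norm//.
  by apply: le_trans yr; rewrite ler_piMl.
have PE : P i x = \int[@lebesgue_measure R]_(t in `[0, 1]) dg i (x + 0 *: 'e_i) t.
  rewrite scale0r addr0.
  have cdg (t : R) : 0 <= t <= 1 -> {for t, continuous (dg i x)}.
    move=> t01; apply: (@continuousD _ R^o); first by apply: line_cont => //; exact: cP.
    have M k : {for t, continuous (fun t : R => (x - x0) 0 k * (t * 'D_'e_i (P k) (x0 + t *: (x - x0))))}.
      apply: (@continuousM _ _ (cst ((x - x0) 0 k))); first exact: cst_continuous.
      apply: (@continuousM _ _ id); first exact: cvg_id.
      by apply: (@line_cont ('D_'e_i (P k))) => // y; exact: cdP.
    by apply: (@continuousD _ R^o); exact: M.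
  have dF (t : R) : 0 <= t <= 1 -> is_derive t (1 : R) (fun t => t * P i (x0 + t *: (x - x0))) (dg i x t).
    move=> t01; have D := is_derive_segment oB (CP i) (seg Bx t01).
    apply: (@is_derive_eq _ _ _ _ _ _ _ _ (is_deriveM (is_derive_id t (1 : R)) D)).
    have clo j k : 'D_'e_j (P k) (x0 + t *: (x - x0)) = 'D_'e_k (P j) (x0 + t *: (x - x0)).
      by case: (ord2E j) => ->; case: (ord2E k) => -> //; rewrite closedP//; exact: seg.
    by rewrite /grad_form /dg (clo 0 i) (clo 1 i) /GRing.scale /=; ring.
  by rewrite (Rint_FTC ltr01 dF cdg) mul0r subr0 mul1r scale1r addrC subrK.
rewrite PE; apply: (is_derive_param_int (d := d) (C := C1 + (rho * C2 + rho * C3)) (dG := fun s t => dg i (x + s *: 'e_i) t)) => //.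
- move=> s t; rewrite subr0 => sd t01.
  have Bs := KB _ (near_x s sd).
  have Bst := seg Bs t01.
  have E s' : x0 + t *: (x + s' *: 'e_i - x0) = (x0 + t *: (x - x0)) + s' *: (t *: 'e_i).
    by rewrite [x + _ - x0]addrAC scalerDr addrA scalerA [t * s']mulrC -scalerA.
  have DQ j : is_derive s (1 : R) (fun s => P j (x0 + t *: (x + s *: 'e_i - x0))) (t * 'D_'e_i (P j) (x0 + t *: (x + s *: 'e_i - x0))).
    rewrite E in Bst *.
    have := is_derive_segment oB (CP j) Bst.
    rewrite grad_form_D.
    by under eq_fun do rewrite -E.
  have DA j : is_derive s (1 : R) (fun s : R => (x + s *: 'e_i - x0) 0 j) (('e_i : pt) 0 j).
    have -> : (fun s : R => (x + s *: 'e_i - x0) 0 j) = (fun s : R => s * ('e_i : pt) 0 j + (x 0 j - x0 0 j)).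
      by apply/funext => u; rewrite !mxE; ring.
    apply: is_derive_eq (is_deriveD (is_deriveM (is_derive_id s (1 : R)) (is_derive_cst (('e_i : pt) 0 j) s (1 : R))) (is_derive_cst (x 0 j - x0 0 j) s (1 : R))) _.
    by rewrite scaler0 add0r addr0 /GRing.scale /= mulr1.
  apply: is_derive_eq (is_deriveD (is_deriveM (DA 0) (DQ 0)) (is_deriveM (DA 1) (DQ 1))) _.
  rewrite /dg /GRing.scale /= !mxE /=.
  by case: (ord2E i) => -> /=; ring.
- move=> s t; rewrite subr0 => sd t01; have Bs := KB _ (near_x s sd).
  have M k : {for t, continuous (fun t : R => (x + s *: 'e_i - x0) 0 k * P k (x0 + t *: (x + s *: 'e_i - x0)))}.
    apply: (@continuousM _ _ (cst ((x + s *: 'e_i - x0) 0 k))); first exact: cst_continuous.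
    by apply: (@line_cont (P k)) => // y; exact: cP.
  by apply: (@continuousD _ R^o); exact: M.
- move=> s t; rewrite subr0 => sd t01; have ns := near_x s sd; have nst := segK _ _ ns t01.
  have /andP[t0 t1] := t01.
  have T (a b c : R) : `|a| <= rho -> `|b| <= c -> `|a * (t * b)| <= rho * c.
    move=> ar bc; rewrite normrM ler_pM// normrM ger0_norm//.
    by apply: le_trans bc; rewrite ler_piMl.
  apply: le_trans (ler_normD _ _) _; apply: lerD; first exact: HC1.
  apply: le_trans (ler_normD _ _) _; apply: lerD; apply: T.
  + exact: le_trans (coord_le _ _) ns.
  + exact: HC2.
  + exact: le_trans (coord_le _ _) ns.
  + exact: HC3.
Qed.

Lemma primitive_Ck k : (forall i, Ck k B (P i)) -> Ck k.+1 B primitive.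
Proof.
move=> H; apply: (@Ck_S_intro _ _ _ _ _ P) => // [x Bx|i x Bx]; last exact: primitiveP.
have N : {near x, forall y, B y} by exact: open_nbhs_nbhs.
(* Existence of partial derivatives does not give continuity of the primitive; their continuity
   gives differentiability and thus continuity. *)
have D : is_diff x primitive (grad_form ('D_'e_0 primitive x) ('D_'e_1 primitive x)).
  apply: C1_is_diff => i.
    near=> y; have By : B y by near: y.
    by have [] := primitiveP i By.
  apply: (@near_continuous _ _ (P i)); last exact: Ck_cont (CP i) Bx.
  near=> y; have By : B y by near: y.
  by have [_ ->] := primitiveP i By.
by case: D => D _; exact: differentiable_continuous.
Unshelve. all: by end_near. Qed.

End Poincare.

(** * Symmetry of mixed second derivatives *)

Section Schwarz.
Context {R : realType}.
Local Notation pt := 'rV[R]_2.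

(** Two applications of the mean value theorem: one to the difference of H along two parallel lines,
    one to the derivative it produces. *)
Lemma second_difference (U : set pt) (H : pt -> R) x (h : R) i j : open U -> Ck 2 U H ->
  (forall s t : R, `|s| <= `|h| -> `|t| <= `|h| -> U (x + s *: 'e_i + t *: 'e_j)) ->
  exists s t : R, [/\ `|s| <= `|h|, `|t| <= `|h| &
    (H (x + h *: 'e_i + h *: 'e_j) - H (x + h *: 'e_i)) - (H (x + h *: 'e_j) - H x)
     = h * (h * 'D_'e_j ('D_'e_i H) (x + s *: 'e_i + t *: 'e_j))].
Proof.
move=> oU CH HU; have [dH cH] := Ck_S_elim CH; have [dHi _] := Ck_S_elim (cH i).
have n0 : `|0 : R| <= `|h| by rewrite normr0.
have D1 (s : R) : `|s| <= `|h| -> is_derive s (1 : R)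
    (fun s => H (x + h *: 'e_j + s *: 'e_i) - H (x + s *: 'e_i))
    ('D_'e_i H (x + h *: 'e_j + s *: 'e_i) - 'D_'e_i H (x + s *: 'e_i)).
  move=> sh; apply: is_deriveB; apply: is_derive_line; apply: dH.
    by rewrite addrAC; apply: HU.
  by have := HU s 0 sh n0; rewrite scale0r addr0.
have [s sh E] := MVT0 D1.
have D2 (t : R) : `|t| <= `|h| -> is_derive t (1 : R)
    (fun t => 'D_'e_i H (x + s *: 'e_i + t *: 'e_j)) ('D_'e_j ('D_'e_i H) (x + s *: 'e_i + t *: 'e_j)).
  by move=> th; exact: (is_derive_line (dHi j _ (HU _ _ sh th))).
have [t th E2] := MVT0 D2.
exists s, t; split => //; rewrite -E2 scale0r addr0 [x + s *: _ + _]addrAC -E.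
by rewrite scale0r !addr0 [x + h *: 'e_j + _]addrAC.
Qed.

Lemma dist_le_halves (u v c e : R) : `|u - c| <= e / 2 -> `|v - c| <= e / 2 -> `|u - v| <= e.
Proof. by rewrite !ler_norml; lra. Qed.

Lemma Schwarz (U : set pt) (H : pt -> R) x : open U -> Ck 2 U H -> U x ->
  'D_'e_0 ('D_'e_1 H) x = 'D_'e_1 ('D_'e_0 H) x.
Proof.
move=> oU CH Ux; have [dH cH] := Ck_S_elim CH.
have [_ cH0] := Ck_S_elim (cH 0); have [_ cH1] := Ck_S_elim (cH 1).
apply/eqP; rewrite -subr_eq0 -normr_le0; apply/ler_addgt0Pr => e e0; rewrite add0r.
have e20 : 0 < e / 2 by rewrite divr_gt0.
have /nbhs_ballP[r /= r0 Br] : \forall y \near x, [/\ U y,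
    `|'D_'e_0 ('D_'e_1 H) x - 'D_'e_0 ('D_'e_1 H) y| <= e / 2 &
    `|'D_'e_1 ('D_'e_0 H) x - 'D_'e_1 ('D_'e_0 H) y| <= e / 2].
  have N1 : \forall y \near x, U y by exact: open_nbhs_nbhs.
  have := Ck_cont (cH1 0) Ux; move=> /cvgrPdist_le/(_ _ e20) N2.
  have := Ck_cont (cH0 1) Ux; move=> /cvgrPdist_le/(_ _ e20) N3.
  exact: filterS3 (fun y h1 h2 h3 => And3 h1 h2 h3) N1 N2 N3.
set h := r / 2; have h0 : 0 < h by rewrite divr_gt0.
have inB i j (s t : R) : i != j -> `|s| <= `|h| -> `|t| <= `|h| -> ball x r (x + s *: 'e_i + t *: 'e_j).
  move=> ij; rewrite (gtr0_norm h0) => sh th; rewrite -ball_normE /= opprD addrA opprD addrA subrr sub0r -opprD normrN.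
  apply: (@le_lt_trans _ _ h); last by rewrite /h ltr_pdivrMr// ltr_pMr// ltr1n.
  rewrite (norm_row_le _ (ltW h0)) !mxE /=.
  case: (ord2E i) (ord2E j) ij => -> [] -> //= _;
    by rewrite !(mulr0, mulr1, addr0, add0r) sh th.
have n01 : (0 : 'I_2) != 1 by []. have n10 : (1 : 'I_2) != 0 by [].
have [s [t [sh th E]]] := second_difference oU CH (fun s t sh th => let: And3 u _ _ := Br _ (inB 0 1 s t n01 sh th) in u).
have [s' [t' [sh' th' E']]] := second_difference oU CH (fun s t sh th => let: And3 u _ _ := Br _ (inB 1 0 s t n10 sh th) in u).
have [_ _ B1] := Br _ (inB 0 1 s t n01 sh th); have [_ B2 _] := Br _ (inB 1 0 s' t' n10 sh' th').
(* Both second differences involve the same four values of H, so the two mixed derivatives agree at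
   two points near x; continuity does the rest. *)
have swap (a b c d u v : R) : a - b - (c - d) = u -> a - c - (b - d) = v -> u = v.
  by move=> <- <-; ring.
have E3 : x + h *: 'e_1 + h *: 'e_0 = x + h *: 'e_0 + h *: 'e_1 by rewrite addrAC.
rewrite E3 in E'; have := swap _ _ _ _ _ _ E E'.
move=> /(mulfI (lt0r_neq0 h0))/(mulfI (lt0r_neq0 h0)) EE.
by rewrite EE in B1; exact: dist_le_halves B2 B1.
Qed.

End Schwarz.

(** * The mean value property of harmonic functions *)

Section HarmonicMean.
Context {R : realType}.
Local Notation pt := 'rV[R]_2.

Definition dir (t : R) : pt := \row_j (if j == 0 then cos t else sin t).

Lemma is_derive_dir (t : R) : is_derive t (1 : R) dir (\row_j (if j == 0 then - sin t else cos t)).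
Proof.
apply/is_derive_row => j; rewrite mxE.
have -> : (fun y => dir y 0 j) = if j == 0 then cos else sin.
  by apply/funext => y; rewrite mxE; case: ifP.
by case: ifP => _; [exact: is_derive_cos|exact: is_derive_sin].
Qed.

Lemma norm_dir (t : R) : `|dir t| <= 1.
Proof. by rewrite norm_row_le// !mxE /= !ler_norml cos_geN1 cos_le1 sin_geN1 sin_le1. Qed.

(** By the Cauchy-Riemann equations, s times the radial derivative of H on the circle of radius s is
    the angular derivative of the harmonic conjugate [Ht]. Its integral over a period vanishes, so
    the circle average does not depend on the radius, and at radius 0 it is the value at the
    centre. *)
Lemma harmonic_mean (x0 : pt) (r : R) (H : pt -> R) : 0 < r -> Ck 2 (ball x0 r) H ->
  (forall x, ball x0 r x -> laplacian H x = 0) -> forall rho, 0 <= rho < r ->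
  \int[@lebesgue_measure R]_(t in `[0, 2 * pi]) H (x0 + rho *: dir t) = 2 * pi * H x0.
Proof.
move=> r0 CH lapH rho /andP[rho0 rhor].
set B : set pt := ball x0 r; have oB : open B by exact: ball_open.
have pi2 : 0 < 2 * pi :> R by rewrite mulr_gt0// pi_gt0.
have [dH cH] := Ck_S_elim CH.
have BE (x : pt) : B x = (`|x - x0| < r) :> Prop by rewrite /B -ball_normE /= distrC.
have inB (s t : R) : `|s| < r -> B (x0 + s *: dir t).
  move=> sr; rewrite BE addrC addKr normrZ; apply: le_lt_trans sr.
  by rewrite ler_piMr// norm_dir.
have dcirc (s t : R) : is_derive t (1 : R) (fun t => x0 + s *: dir t) (s *: \row_j (if j == 0 then - sin t else cos t)).
  have D := is_deriveD (is_derive_cst x0 t (1 : R)) (is_deriveZ s (is_derive_dir t)).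
  by rewrite add0r in D; exact: D.
have ccirc (s t : R) : {for t, continuous (fun t => x0 + s *: dir t)}.
  by have [/derivable1_diffP D _] := dcirc s t; exact: differentiable_continuous.
(* The form - H_y dx + H_x dy, closed because H is harmonic; its primitive is the harmonic
   conjugate. *)
pose P (i : 'I_2) : pt -> R := if i == 0 then (fun x => - 'D_'e_1 H x) else 'D_'e_0 H.
have CP i : Ck 1 B (P i) by rewrite /P; case: ifP => _ //; exact: Ck_opp.
have cloP x : B x -> 'D_'e_0 (P 1) x = 'D_'e_1 (P 0) x.
  move=> Bx; have := lapH x Bx; rewrite /laplacian sum2 /P /= => /eqP; rewrite addr_eq0 => /eqP ->.
  by rewrite deriveN//; have [c _] := Ck_S_elim (cH 1); have [] := c 1 x Bx.
pose Ht := primitive x0 P.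
have CHt : Ck 2 B Ht by exact: primitive_Ck.
have dHt i x : B x -> 'D_'e_i Ht x = P i x by move=> Bx; have [_ ->] := primitiveP CP cloP i Bx.
pose dG (s t : R) := grad_form ('D_'e_0 H (x0 + s *: dir t)) ('D_'e_1 H (x0 + s *: dir t)) (dir t).
have cdir (t : R) j : {for t, continuous (fun t => dir t 0 j)}.
  by have /is_derive_row/(_ j) := is_derive_dir t; exact: derive_continuous.
have cdG (s t : R) : `|s| < r -> {for t, continuous (dG s)}.
  move=> sr; have M j k : {for t, continuous (fun t => dir t 0 j * 'D_'e_k H (x0 + s *: dir t))}.
    apply: (@continuousM _ _ (fun t => dir t 0 j)); first exact: cdir.
    apply: (@continuous_comp _ _ _ (fun t : R => x0 + s *: dir t) ('D_'e_k H) t); first exact: ccirc.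
    by apply: Ck_cont (cH k) _; exact: inB.
  by apply: (@continuousD _ R^o); exact: M.
have intdG (s : R) : `|s| < r -> s * \int[@lebesgue_measure R]_(t in `[0, 2 * pi]) dG s t = 0.
  move=> sr; rewrite -RintegralZl//; last by apply: integrable_itv => t _; exact: cdG.
  have dF (t : R) : 0 <= t <= 2 * pi -> is_derive t (1 : R) (fun t => Ht (x0 + s *: dir t)) (s * dG s t).
    move=> _; have D := Ck1_is_diff oB (Ck_pred CHt) (inB s t sr).
    apply: is_derive_eq (@is_derive_chain R R Ht (fun t => x0 + s *: dir t) t 1 _ _ _ D (dcirc s t)) _.
    rewrite !dHt; try exact: inB.
    by rewrite /dG /grad_form /P !mxE /=; ring.
  have cF (t : R) : 0 <= t <= 2 * pi -> {for t, continuous (fun t => s * dG s t)}.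
    by move=> _; apply: (@continuousM _ _ (cst s)); [exact: cst_continuous|exact: cdG].
  rewrite (Rint_FTC pi2 dF cF).
  have -> : dir (2 * pi) = dir 0; last by rewrite subrr.
  apply/rowP => j; rewrite !mxE mulrDl mul1r -[pi + pi]add0r addrA !cosDpi !sinDpi.
  by rewrite !opprK.
pose A (s : R) := \int[@lebesgue_measure R]_(t in `[0, 2 * pi]) H (x0 + s *: dir t).
have dA (s : R) : `|s| < r -> is_derive s (1 : R) A (\int[@lebesgue_measure R]_(t in `[0, 2 * pi]) dG s t).
  move=> sr; set d := (r - `|s|) / 2; have d0 : 0 < d by rewrite divr_gt0// subr_gt0.
  set R0 := `|s| + d; have R0r : R0 < r by move: sr; rewrite /R0 /d; lra.
  have near_s s' : `|s' - s| < d -> `|s'| <= R0.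
    by move=> h; rewrite -[s'](subrK s) addrC (le_trans (ler_normD _ _))// lerD2l ltW.
  have bnd i : exists C, forall y, `|y - x0| <= R0 -> `|'D_'e_i H y| <= C.
    have [|C HC] := bounded_on_compact (@box_compact R x0 R0) (f := 'D_'e_i H).
      by move=> y /= yR; have By : B y by [rewrite BE; exact: le_lt_trans yR R0r]; exact: Ck_cont (cH i) By.
    by exists C.
  have [C0 HC0] := bnd 0; have [C1 HC1] := bnd 1.
  apply: (is_derive_param_int (d := d) (C := C0 + C1)) => // s' t /near_s s'R _.
  - have s'r : `|s'| < r by exact: le_lt_trans s'R R0r.
    exact: is_derive_segment oB (Ck_pred CH) (inB s' t s'r).
  - have s'r : `|s'| < r by exact: le_lt_trans s'R R0r.
    apply: (@continuous_comp _ _ _ (fun t : R => x0 + s' *: dir t) H t); first exact: ccirc.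
    by apply: Ck_cont CH _; exact: inB.
  - have inK : `|x0 + s' *: dir t - x0| <= R0.
      by rewrite addrC addKr normrZ; apply: le_trans s'R; rewrite ler_piMr// norm_dir.
    have T (a b c : R) : `|a| <= 1 -> `|b| <= c -> `|a * b| <= c.
      by move=> a1 bc; rewrite normrM; apply: le_trans bc; rewrite ler_piMl.
    have ds j : `|dir t 0 j| <= 1 := le_trans (coord_le _ _) (norm_dir t).
    apply: le_trans (ler_normD _ _) _; apply: lerD; first exact: (T _ _ _ (ds 0) (HC0 _ inK)).
    exact: (T _ _ _ (ds 1) (HC1 _ inK)).
have cA s : `|s| < r -> {for s, continuous A} by move=> /dA; exact: derive_continuous.
have A0 : A 0 = 2 * pi * H x0.
  rewrite /A; under eq_Rintegral do rewrite scale0r addr0.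
  have lm : fine (@lebesgue_measure R `[0, 2 * pi]) = 2 * pi.
    by rewrite lebesgue_measure_itv /= lte_fin pi2 -EFinB subr0.
  by rewrite Rintegral_cst// lm mulrC.
(* [intdG] carries a factor s, so it yields a zero derivative only for s > 0; the mean value theorem
   needs interior points only. *)
have [||c _ E] := @MVT_segment R A (fun=> 0) 0 rho rho0.
- move=> s; rewrite in_itv /= => /andP[s0 srho].
  have sr : `|s| < r by rewrite gtr0_norm// (lt_trans srho).
  apply: is_derive_eq (dA s sr) _; have /eqP := intdG s sr.
  by rewrite mulf_eq0 (gt_eqF s0) => /eqP.
- apply: within_itv_continuous => s /andP[s0 srho]; apply: cA.
  by rewrite ger0_norm// (le_lt_trans srho).
- by rewrite -A0; move/eqP: E; rewrite mul0r subr_eq0 => /eqP.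
Qed.

End HarmonicMean.

(** * The maximum principle on Riemann surfaces *)

Section TopologyExtras.

Lemma chart_image_open (X E : topologicalType) (c : chart X E) (A : set X) :
  open A -> open (chart_map c @` (A `&` chart_dom c)).
Proof.
move=> oA; rewrite openE => _ [p [Ap dp] <-].
have ip : (chart_map c @` chart_dom c) (chart_map c p) by exists p.
have iK : chart_inv c (chart_map c p) = p by apply: chart_mapK; exact/mem_set.
have N1 : \forall w \near chart_map c p, (chart_map c @` chart_dom c) w.
  by apply: open_nbhs_nbhs; split => //; exact: chart_img_open.
have N2 : \forall w \near chart_map c p, A (chart_inv c w).
  have /= := @chart_inv_continuous _ _ c (chart_map c p) (mem_set ip); apply.
  by rewrite iK; exact: open_nbhs_nbhs.
apply: filterS2 N1 N2 => _ [q dq <-]; rewrite chart_mapK; last exact/mem_set.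
by move=> Aq; exists q.
Qed.

Lemma connected_clopen (T : topologicalType) (A : set T) : connected [set: T] ->
  open A -> closed A -> A !=set0 -> A = setT.
Proof.
move=> /(_ A) cT oA cA A0; apply: cT => //; first by exists A => //; rewrite setTI.
by exists A => //; rewrite setTI.
Qed.

(** If the supremum s over K were not attained, the open sets where u < b, for real b < s, would
    cover K; by compactness one of them would, giving a smaller upper bound. *)
Lemma usc_attains_max (R : realType) (T : topologicalType) (K : set T) (u : T -> \bar R) :
  compact K -> K !=set0 -> upper_semicontinuous u ->
  exists2 p, K p & forall q, K q -> (u q <= u p)%E.
Proof.
move=> cK [p0 Kp0] usc; set s := ereal_sup (u @` K).
have us q : K q -> (u q <= s)%E by move=> Kq; apply: ereal_sup_ubound; exists q.
apply: contrapT => H.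
have lts p : K p -> (u p < s)%E.
  move=> Kp; rewrite lt_neqAle us// andbT; apply/eqP => E; apply: H; exists p => // q Kq.
  by rewrite E; exact: us.
(* The filter of real numbers approaching s from below, which is the parameter filter for
   near-covering compactness; s may be infinite. *)
pose F := filter_from [set a : R | (a%:E < s)%E] (fun a => [set b : R | a < b /\ (b%:E < s)%E]).
have s0 : exists a : R, (a%:E < s)%E.
  have := lts _ Kp0; case: (s) => [r| |] h; first by exists (r - 1); rewrite lte_fin ltrBlDr ltrDl.
    by exists 0; rewrite ltry.
  by rewrite ltNge leNye in h.
have FF : Filter F.
  apply: filter_from_filter; first by case: s0 => a; exists a.
  move=> a b /= ha hb; exists (Num.max a b); first by rewrite /= maxEle; case: ifP.
  by move=> c /= [+ hc]; rewrite gt_max => /andP[].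
have dense (x : \bar R) : (x < s)%E -> exists2 a : R, (x < a%:E)%E & (a%:E < s)%E.
  case: x => [x| |]; case: (s) => [t| |] //.
  - by rewrite lte_fin => xt; exists ((x + t) / 2); rewrite lte_fin; rewrite ?midf_lt.
  - by exists (x + 1); rewrite ?ltry// lte_fin ltrDl.
  - by exists (t - 1); rewrite ?ltNyr// lte_fin ltrBlDr ltrDl.
  - by exists 0; rewrite ?ltNyr// ltry.
have := cK => /compact_near_coveringP /(_ R F (fun b p => (u p < b%:E)%E) FF).
case=> [p Kp|a /= as_ Ha].
  have [a pa as_] := dense _ (lts _ Kp).
  have : ((- a)%:E < - u p)%E by rewrite EFinN lteN2.
  move=> /usc [V Vp HV].
  exists (V, [set b : R | a < b /\ (b%:E < s)%E]); first by split => //; exists a.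
  move=> [q b] /= [Vq [ab _]]; have := HV q Vq; rewrite EFinN lteN2 => /lt_trans; apply.
  by rewrite lte_fin.
have [b ab bs] := dense _ as_.
have /Ha : [set b : R | a < b /\ (b%:E < s)%E] b by split; rewrite // -lte_fin.
move=> Hb; have : (s <= b%:E)%E by apply: ub_ereal_sup => _ [q Kq <-]; exact/ltW/Hb.
by rewrite leNgt bs.
Qed.

End TopologyExtras.

(** * Integrals of upper semicontinuous functions *)

Section UscIntegral.
Context {R : realType}.
Local Notation leb := (@lebesgue_measure R).
Local Open Scope ereal_scope.

(** Positive and negative parts are compared separately, so that no integrability is assumed: a
    subharmonic function may a priori have integral -oo over a circle. *)
Lemma measurable_le_integral d (T : measurableType d) (mu : {measure set T -> \bar R})
  (D : set T) (f g : T -> \bar R) : measurable D ->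
  measurable_fun D f -> measurable_fun D g -> (forall t, D t -> f t <= g t) ->
  \int[mu]_(t in D) f t <= \int[mu]_(t in D) g t.
Proof.
move=> mD mf mg fg; rewrite [leLHS]integralE [leRHS]integralE; apply: leeB.
- apply: ge0_le_integral => //; [exact: measurable_funepos|exact: measurable_funepos|].
  by move=> t Dt; rewrite !funeposE ge_max !le_max fg//= lexx orbT.
- apply: ge0_le_integral => //; [exact: measurable_funeneg|exact: measurable_funeneg|].
  by move=> t Dt; rewrite !funenegE ge_max !le_max leeN2 fg//= lexx orbT.
Qed.

(** A strict inequality at one point persists, with a uniform gap e, on an interval of positive
    length, and this lowers the integral by e times that length. *)
Lemma usc_integral_lt (U : R -> \bar R) (K : R -> R) (a b t0 : R) : (a < b)%R -> (a <= t0 <= b)%R ->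
  upper_semicontinuous U -> continuous K ->
  (forall t, U t <= (K t)%:E) -> U t0 < (K t0)%:E ->
  \int[leb]_(t in `[a, b]) U t < \int[leb]_(t in `[a, b]) (K t)%:E.
Proof.
move=> ab /andP[at0 t0b] usc cK UK UK0.
have [m Um mK] : exists2 m : R, U t0 < m%:E & (m < K t0)%R.
  move: UK0; case: (U t0) => [x| |] //; last by exists (K t0 - 1)%R; rewrite ?ltNyr// ltrBlDr ltrDl.
  by rewrite lte_fin => xt; exists ((x + K t0) / 2)%R; rewrite ?lte_fin midf_lt.
(* Half of the gap: where K differs from K t0 by less than e, one has m < K t - e. *)
set e := ((K t0 - m) / 2)%R; have e0 : (0 < e)%R by rewrite divr_gt0// subr_gt0.
have N1 : \forall t \near t0, U t < m%:E.
  have : (- m)%:E < - U t0 by rewrite EFinN lteN2.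
  by move=> /usc[V Vt HV]; apply: filterS Vt => t /HV; rewrite EFinN lteN2.
have N2 : \forall t \near t0, (`|K t0 - K t| < e)%R by move: (cK t0) => /cvgrPdist_lt; exact.
have [d /= d0 Hd] : \forall t \near t0, U t <= (K t - e)%:E.
  apply: filterS2 N1 N2 => t Utm KK; apply: le_trans (ltW Utm) _; rewrite lee_fin.
  by move: KK; rewrite ltr_norml /e; lra.
(* The interval around t0 is clipped to [a, b], since t0 may be an endpoint. *)
set c1 := Num.max a (t0 - d / 2)%R; set d1 := Num.min b (t0 + d / 2)%R.
have d20 : (0 < d / 2)%R by rewrite divr_gt0.
have c1d1 : (c1 < d1)%R.
  by rewrite gt_max !lt_min ab /=; apply/andP; split; [|apply/andP; split]; lra.
have sub : `[c1, d1]%classic `<=` `[a, b]%classic.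
  by apply: subset_itv; rewrite bnd_simp ?ge_min ?le_max lexx.
pose J : set (measurableTypeR R) := `[c1, d1]%classic.
have mJ : measurable J by exact: measurable_itv.
have mD : measurable (`[a, b]%classic : set (measurableTypeR R)) by [].
pose V (t : R) : R := (e * \1_J t)%R.
have iK : leb.-integrable `[a, b] (EFin \o K) by apply: integrable_itv => t _; exact: cK.
have i1 : leb.-integrable `[a, b] (EFin \o (\1_J : R -> R)).
  by apply: (integrableS measurableT) => //; exact: integrable_indic_itv.
have iV : leb.-integrable `[a, b] (EFin \o V).
  apply: (eq_integrable mD _ _ _ (@integrableZl _ _ _ _ _ mD e _ i1)).
  by move=> t _; rewrite /V /= EFinM.
have IV : \int[leb]_(t in `[a, b]) (V t)%:E = (e * (d1 - c1))%:E.
  under eq_integral do rewrite /V EFinM.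
  have lm : @lebesgue_measure R (`[c1, d1]%classic : set R) = (d1 - c1)%:E.
    by rewrite lebesgue_measure_itv /= lte_fin c1d1.
  transitivity (e%:E * @lebesgue_measure R (`[c1, d1]%classic : set R)).
    by rewrite integralZl// integral_indic// setIidl.
  by rewrite lm -EFinM.
have mU : measurable_fun (`[a, b] : set (measurableTypeR R)) U.
  apply: measurable_funTS; have -> : U = (fun t => - (- U t)) by apply/funext => t; rewrite oppeK.
  by apply: measurableT_comp; [exact: oppe_measurable|exact: lower_semicontinuous_measurable].
apply: (@le_lt_trans _ _ (\int[leb]_(t in `[a, b]) ((K t)%:E - (V t)%:E))).
  apply: measurable_le_integral => //.
    by have /integrableP[] := integrableB mD iK iV.
  move=> t tab; rewrite /V indicE; case: (boolP (t \in J)) => tJ; last by rewrite mulr0 sube0.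
  rewrite mulr1 -EFinB; apply: Hd; rewrite /= distrC.
  move/set_mem: tJ; rewrite /J /= in_itv /= ge_max le_min => /andP[/andP[_ h1] /andP[_ h2]].
  by rewrite ltr_norml; lra.
rewrite integralB_EFin// IV -(fineK (integrable_fin_num mD iK)) -EFinB lte_fin.
by rewrite ltrBlDr ltrDl mulr_gt0// subr_gt0.
Qed.

End UscIntegral.

(** * Complex and real coordinates, polar coordinates *)

Section ComplexPlane.
Context {R : realType}.
Local Notation pt := 'rV[R]_2.
Local Open Scope complex_scope.

Definition plane_point (z : cplx R) : pt := \row_j (if j == 0 then complex.Re z else complex.Im z).

Lemma plane_pointK : cancel plane_point (@complex_of_plane R).
Proof. by move=> [a b]; rewrite /complex_of_plane !mxE. Qed.

Lemma circle_pointE (z : cplx R) (r t : R) :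
  circle_point z r t = complex_of_plane (plane_point z + r *: dir t).
Proof. by case: z => a b; rewrite /circle_point /complex_of_plane !mxE. Qed.

Lemma norm_complex_lt (a b e : R) : `|a| < e / 2 -> `|b| < e / 2 -> `|(a +i* b : cplx R)| < e%:C.
Proof.
move=> ae be; rewrite normc_def ltcR /=.
have e0 : 0 < e by have := le_lt_trans (normr_ge0 _) ae; rewrite pmulr_lgt0// invr_gt0.
rewrite -[e]gtr0_norm// -sqrtr_sqr ltr_sqrt ?exprn_gt0//.
rewrite -(real_normK (num_real a)) -(real_normK (num_real b)).
have : `|a| ^+ 2 <= (e / 2) ^+ 2 by apply: lerXn2r; rewrite ?nnegrE ?normr_ge0 ?divr_ge0 ?ltW.
have : `|b| ^+ 2 <= (e / 2) ^+ 2 by apply: lerXn2r; rewrite ?nnegrE ?normr_ge0 ?divr_ge0 ?ltW.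
have : 0 < e ^+ 2 by rewrite exprn_gt0.
move: (`|a| ^+ 2) (`|b| ^+ 2) => x y; have -> : (e / 2) ^+ 2 = e ^+ 2 / 4 by field.
by move: (e ^+ 2) => c; clear; lra.
Qed.

Lemma complex_of_plane_continuous : continuous (@complex_of_plane R).
Proof.
move=> x; apply/(@cvgrPdist_lt _ (cplx R) _ (nbhs (x : pt))) => -[e i]; rewrite ltcE /= => /andP[/eqP -> e0].
have e20 : 0 < e / 2 by rewrite divr_gt0.
have : \forall y \near x, `|x - y| < e / 2 by apply/nbhs_ballP; exists (e / 2) => // y; rewrite -ball_normE.
apply: filterS => y; rewrite norm_row_lt// !mxE => /andP[h0 h1].
exact: (@norm_complex_lt (x 0 0 - y 0 0) (x 0 1 - y 0 1)).
Qed.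

Lemma norm_plane_point (z w : cplx R) (r : R) : `|w - z| < r%:C ->
  `|plane_point w - plane_point z| < r.
Proof.
case: z w => [a b] [c d]; rewrite normc_def ltcR /= => h.
have r0 : 0 < r by apply: le_lt_trans h; exact: sqrtr_ge0.
have bound (x y : R) : `|x| <= Num.sqrt (x ^+ 2 + y ^+ 2).
  by rewrite -sqrtr_sqr ler_wsqrtr// lerDl sqr_ge0.
rewrite norm_row_lt// !mxE /= (le_lt_trans (bound (c - a) (d - b)) h) /=.
by apply: le_lt_trans (bound (d - b) (c - a)) _; rewrite addrC.
Qed.

Lemma polar_coordinates (x y : R) : x ^+ 2 + y ^+ 2 = 1 ->
  exists2 t, 0 <= t <= 2 * pi & x = cos t /\ y = sin t.
Proof.
move=> xy; have x1 : -1 <= x <= 1.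
  rewrite -ler_norml -(@ler_pXn2r _ 2)// ?nnegrE// expr1n (real_normK (num_real x)) -xy.
  by rewrite lerDl sqr_ge0.
have y2 : 1 - x ^+ 2 = y ^+ 2 by rewrite -xy addrC addKr.
have api := acos_lepi x1; have a0 := acos_ge0 x1; have p0 := @pi_ge0 R.
have [y0|y0] := leP 0 y.
  exists (acos x); first by rewrite a0 (le_trans api)// ler_peMl// ler1n.
  by rewrite acosK// sin_acos// y2 sqrtr_sqr ger0_norm.
exists (2 * pi - acos x).
  by rewrite subr_ge0 (le_trans api) ?ler_peMl ?ler1n//= gerBl.
have -> : 2 * pi - acos x = - acos x + pi + pi by ring.
by rewrite !cosDpi !sinDpi !opprK cosN sinN acosK// sin_acos// y2 sqrtr_sqr ltr0_norm// opprK.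
Qed.

Lemma circle_pointP (z w : cplx R) : exists t r : R,
  [/\ 0 <= t <= 2 * pi, r%:C = `|w - z| & w = circle_point z r t].
Proof.
case: z w => [a b] [c d]; set r := Num.sqrt ((c - a) ^+ 2 + (d - b) ^+ 2).
have nr : r%:C = `|(c +i* d : cplx R) - (a +i* b)| by rewrite normc_def.
have [r0|r0] := eqVneq r 0.
  exists 0, r; split=> //; first by rewrite lexx mulr_ge0// pi_ge0.
  have : `|(c +i* d : cplx R) - (a +i* b)| = 0 by rewrite -nr r0.
  move=> /normr0_eq0 /subr0_eq ->.
  by rewrite /circle_point r0 !mul0r addr0.
have r2 : r ^+ 2 = (c - a) ^+ 2 + (d - b) ^+ 2 by rewrite sqr_sqrtr// addr_ge0// sqr_ge0.
have [|t tI [ct st]] := @polar_coordinates ((c - a) / r) ((d - b) / r).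
  by rewrite !expr_div_n -mulrDl -r2 divff// expf_neq0.
exists t, r; split=> //; rewrite /circle_point -ct -st.
rewrite ![r * _]mulrC !divfK//; apply/eqP; rewrite eq_complex /=.
by rewrite ![_ + (_ - _)]addrC !subrK !eqxx.
Qed.

End ComplexPlane.

(** * The mean value property on a Riemann surface *)

Section MeanValue.
Context {R : realType} (S : riemann_surface R).
Local Open Scope complex_scope.
Implicit Types (W : set S) (k : S -> R).

(** All that the comparison with subharmonic functions needs of a harmonic function. The first
    clause keeps the small coordinate discs inside W, and continuity along circles makes the
    integrals finite. *)
Definition has_mean_on W k := forall c p, rs_atlas c -> W p -> chart_dom c p ->
  exists2 r0 : R, 0 < r0 &
  (forall w : cplx R, `|w - chart_map c p| < r0%:C -> (chart_map c @` (W `&` chart_dom c)) w) /\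
  forall r : R, 0 <= r < r0 ->
    continuous (fun t => k (chart_inv c (circle_point (chart_map c p) r t))) /\
    \int[@lebesgue_measure R]_(t in `[0, 2 * pi]) k (chart_inv c (circle_point (chart_map c p) r t)) = 2 * pi * k p.

Lemma circle_dist (z : cplx R) (r t : R) : 0 <= r -> `|circle_point z r t - z| = r%:C.
Proof.
move=> r0; rewrite /circle_point addrC addKr normc_def /= !exprMn -mulrDr cos2Dsin2 mulr1.
by rewrite sqrtr_sqr ger0_norm.
Qed.

Lemma harmonic_has_mean W k : open W -> harmonic_on W k -> has_mean_on W k.
Proof.
move=> oW hk c p cA Wp dp; set z := chart_map c p.
have [CH lapH] := hk c cA.
set U := _ @^-1` _ in CH lapH.
have oU : open U.
  apply: open_comp; last exact: chart_image_open.
  by move=> x _; exact: complex_of_plane_continuous.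
have Uz : U (plane_point z) by rewrite /U /= plane_pointK; exists p.
have [r0 r00 sub] := open_ball_sub oU Uz.
(* The sup norm is at most the Euclidean norm, so the complex disc of radius r0 lies in the box of
   the same radius. *)
have inU w : `|w - z| < r0%:C -> U (plane_point w).
  by move=> /norm_plane_point h; apply: sub; rewrite -ball_normE /= distrC.
exists r0 => //; split.
  by move=> w /inU; rewrite /U /= plane_pointK.
move=> r /andP[rge rr].
have inB t : ball (plane_point z) r0 (plane_point z + r *: dir t).
  rewrite -ball_normE /= opprD addrA subrr sub0r normrN normrZ ger0_norm//.
  by apply: le_lt_trans rr; rewrite ler_piMr// norm_dir.
split.
  move=> t; under eq_fun do rewrite circle_pointE.
  apply: (@continuous_comp _ _ _ (fun t : R => plane_point z + r *: dir t) (k \o chart_inv c \o @complex_of_plane R) t).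
    have [/derivable1_diffP D _] := is_derive_dir t.
    apply: continuousD; first exact: cst_continuous.
    apply: continuousZl_tmp; exact: differentiable_continuous.
  by apply: Ck_cont CH _; exact/sub/inB.
under eq_Rintegral do rewrite circle_pointE.
have := @harmonic_mean R (plane_point z) r0 (k \o chart_inv c \o @complex_of_plane R) r00.
move=> /(_ (Ck_sub sub CH) (fun x Bx => lapH x (mem_set (sub x Bx))) r).
rewrite rge rr => /(_ isT) ->.
by rewrite /= plane_pointK /z chart_mapK//; exact/mem_set.
Qed.

Lemma has_mean_combo W k1 k2 (a b e : R) : has_mean_on W k1 -> has_mean_on W k2 ->
  has_mean_on W (fun p => a * k1 p + b * k2 p + e).
Proof.
move=> h1 h2 c p cA Wp dp.
have [r1 r10 [s1 m1]] := h1 c p cA Wp dp; have [r2 r20 [s2 m2]] := h2 c p cA Wp dp.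
have m0 : 0 < Num.min r1 r2 by rewrite lt_min r10.
exists (Num.min r1 r2) => //; split.
  by move=> w h; apply: s1; apply: lt_le_trans h _; rewrite lecR ge_min lexx.
move=> r /andP[r0]; rewrite lt_min => /andP[rr1 rr2].
have [c1 I1] := m1 r (introT andP (conj r0 rr1)); have [c2 I2] := m2 r (introT andP (conj r0 rr2)).
set f1 := fun t => k1 _ in c1 I1 *; set f2 := fun t => k2 _ in c2 I2 *.
have cM (d : R) (f : R -> R) : continuous f -> continuous (fun t => d * f t).
  by move=> cf t; apply: (@continuousM _ _ (cst d)); [exact: cst_continuous|exact: cf].
have cS (f g : R -> R) : continuous f -> continuous g -> continuous (fun t => f t + g t).
  by move=> cf cg t; apply: (@continuousD _ R^o); [exact: cf|exact: cg].
have ce : continuous (fun _ : R => e) by move=> t; exact: cst_continuous.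
have iI (f : R -> R) : continuous f -> (@lebesgue_measure R).-integrable `[0, 2 * pi] (EFin \o f).
  by move=> cf; apply: integrable_itv => t _; exact: cf.
split; first by apply: (cS (fun t => a * f1 t + b * f2 t)) => //; apply: cS; exact: cM.
have mD : measurable (`[0, 2 * pi]%classic : set (measurableTypeR R)) by exact: measurable_itv.
have i1 : (@lebesgue_measure R).-integrable `[0, 2 * pi] (EFin \o (fun t => a * f1 t)) by apply: iI; exact: cM.
have i2 : (@lebesgue_measure R).-integrable `[0, 2 * pi] (EFin \o (fun t => b * f2 t)) by apply: iI; exact: cM.
have i12 : (@lebesgue_measure R).-integrable `[0, 2 * pi] (EFin \o (fun t => a * f1 t + b * f2 t)).
  by apply: iI; apply: cS; exact: cM.
apply: (etrans (RintegralD mD i12 (iI _ ce))); rewrite (RintegralD mD i1 i2).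
rewrite !RintegralZl//; try exact: iI.
have IE : \int[@lebesgue_measure R]_(t in `[0, 2 * pi]) e = e * (2 * pi).
  have lm : fine (@lebesgue_measure R `[0, 2 * pi]) = 2 * pi.
    by rewrite lebesgue_measure_itv /= lte_fin mulr_gt0 ?pi_gt0// -EFinB subr0.
  by rewrite Rintegral_cst// lm.
by rewrite I1 I2 IE; ring.
Qed.

End MeanValue.

(** * The strong maximum principle and comparison *)

Section MaximumPrinciple.
Context {R : realType} (S : riemann_surface R).
Local Open Scope complex_scope.
Implicit Types (W : set S) (k : S -> R) (u : S -> \bar R).

(** If u < k at one point of a small circle around p, the average of u over that circle is less than
    that of k, which is k p = u p; this contradicts the sub-mean value inequality. *)
Lemma subharmonic_touch u W k p : subharmonic u -> has_mean_on W k -> open W -> W p ->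
  (forall q, W q -> (u q <= (k q)%:E)%E) -> u p = (k p)%:E ->
  \forall q \near p, u q = (k q)%:E.
Proof.
move=> [usc _ smv] mk oW Wp uk up.
have [c cA dp] := rs_cover p; have [r0 r00 [sub mean]] := mk c p cA Wp dp.
set z := chart_map c p in sub mean *.
have iz : chart_inv c z = p by apply: chart_mapK; exact/mem_set.
have disc (w : cplx R) : `|w - z| < r0%:C -> u (chart_inv c w) = (k (chart_inv c w))%:E.
  have [t0 [r [t0I nr wE]]] := circle_pointP z w; rewrite -nr ltcR => rr; rewrite wE.
  have rge : 0 <= r by rewrite -lecR nr; exact: normr_ge0.
  have [r_eq0|rn0] := eqVneq r 0; first by rewrite r_eq0 /circle_point !mul0r addr0 iz.
  have rpos : 0 < r by rewrite lt_neqAle eq_sym rn0.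
  have [cK IK] := mean r (introT andP (conj rge rr)).
  have onW t : W (chart_inv c (circle_point z r t)) /\ chart_img c (circle_point z r t).
    have [|q [Wq dq] <-] := sub (circle_point z r t); first by rewrite circle_dist// ltcR.
    by rewrite chart_mapK; [split=> //; exists q|exact/mem_set].
  apply/eqP; apply/contraT => neq.
  pose U t := u (chart_inv c (circle_point z r t)).
  have cc : continuous (fun t => chart_inv c (circle_point z r t)).
    move=> t; under eq_fun do rewrite circle_pointE.
    apply: (@continuous_comp _ _ _ (fun t : R => plane_point z + r *: dir t) (chart_inv c \o @complex_of_plane R) t).
      have [/derivable1_diffP D _] := is_derive_dir t.
      apply: continuousD; first exact: cst_continuous.
      apply: continuousZl_tmp; exact: differentiable_continuous.
    apply: continuous_comp; first exact: complex_of_plane_continuous.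
    by rewrite -circle_pointE; apply: chart_inv_continuous; apply/mem_set; case: (onW t).
  have uscU : upper_semicontinuous U.
    move=> t a /usc[V Vt HV]; exists ((fun t => chart_inv c (circle_point z r t)) @^-1` V); last by move=> s; exact: HV.
    exact: cc.
  have pi2 : 0 < 2 * pi :> R by rewrite mulr_gt0// pi_gt0.
  have := @usc_integral_lt R U (fun t => k (chart_inv c (circle_point z r t))) 0 (2 * pi) t0 pi2 t0I uscU cK.
  have UK t : (U t <= (k (chart_inv c (circle_point z r t)))%:E)%E by apply: uk; case: (onW t).
  have Ut0 : (U t0 < (k (chart_inv c (circle_point z r t0)))%:E)%E by rewrite lt_neqAle UK andbT.
  move=> /(_ UK Ut0).
  have iK := @integrable_itv R 0 (2 * pi) (fun t => k (chart_inv c (circle_point z r t))) (fun t _ => cK t).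
  have mD : measurable (`[0, 2 * pi]%classic : set (measurableTypeR R)) by exact: measurable_itv.
  rewrite -(fineK (integrable_fin_num mD iK)) -/(Rintegral _ _ _) IK.
  have sub_img : [set w : cplx R | `|w - z| <= r%:C] `<=` chart_img c.
    move=> w' /= wr; have [|q [_ dq] <-] := sub w'; last by exists q.
    by apply: le_lt_trans wr _; rewrite ltcR.
  have := smv c z r cA rpos sub_img; rewrite iz up -/U => h1 h2.
  have : ((k p)%:E < (k p)%:E)%E; last by rewrite ltxx.
  apply: le_lt_trans h1 _; rewrite -lte_pdivlMl ?invr_gt0// -EFinM invrK.
  exact: h2.
have N1 : \forall q \near p, chart_dom c q by apply: open_nbhs_nbhs; split => //; exact: chart_dom_open.
have N2 : \forall q \near p, `|chart_map c q - z| < r0%:C.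
  have /= := @chart_map_continuous _ _ c p (mem_set dp).
  move=> /(@cvgr_dist_lt _ (cplx R) _ (nbhs p)) /(_ r0%:C); rewrite ltcR => /(_ r00).
  by apply: filterS => q; rewrite distrC.
by apply: filterS2 N1 N2 => q dq /disc; rewrite chart_mapK//; exact/mem_set.
Qed.

Lemma usc_addr u k : upper_semicontinuous u -> continuous k ->
  upper_semicontinuous (fun p => (u p + (k p)%:E)%E).
Proof.
move=> usc ck p a /= h.
have E q : (- (u q + (k q)%:E) = - u q - (k q)%:E)%E by rewrite fin_num_oppeD.
rewrite E lteBrDr// -EFinD in h.
have [m am mu] : exists2 m : R, a + k p < m & (m%:E < - u p)%E.
  move: h; case: (- u p)%E => [x| |] //.
    by rewrite lte_fin => xt; exists ((a + k p + x) / 2); rewrite ?lte_fin midf_lt.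
  by move=> _; exists (a + k p + 1); rewrite ?ltry// ltrDl.
have [V Vp HV] := usc p m mu.
have N : \forall q \near p, `|k p - k q| < m - (a + k p).
  by have := ck p; move=> /cvgrPdist_lt; apply; rewrite subr_gt0.
exists (V `&` [set q | `|k p - k q| < m - (a + k p)]); first exact: filterI.
move=> q [/HV h2 /= h3]; rewrite E lteBrDr// -EFinD; apply: lt_trans h2.
by rewrite lte_fin; move: h3; rewrite ltr_norml; lra.
Qed.

Lemma has_mean_cst W (a : R) : open W -> has_mean_on W (fun=> a).
Proof.
move=> oW; suff h : has_mean_on W (fun=> 0).
  have := has_mean_combo 0 0 a h h.
  by congr has_mean_on; apply/funext => p; rewrite !mul0r !add0r.
apply: harmonic_has_mean => // c cA.
have oU : open (@complex_of_plane R @^-1` (chart_map c @` (W `&` chart_dom c))).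
  apply: open_comp; last exact: chart_image_open.
  by move=> x _; exact: complex_of_plane_continuous.
split; first exact: (@Ck_cst R R^o 2 _ 0 oU).
have D0 (i : 'I_2) : 'D_'e_i (fun _ : 'rV[R]_2 => (0 : R)) = (fun=> 0) by apply/funext => y; exact: (derive_cst (0 : R)).
have -> : (((fun=> 0) \o chart_inv c) \o @complex_of_plane R) = (fun=> 0) by [].
have lap (i : 'I_2) x : 'D_'e_i ('D_'e_i (fun _ : 'rV[R]_2 => (0 : R))) x = 0 by rewrite D0; exact: (derive_cst (0 : R)).
by move=> x _; rewrite /laplacian sum2 !lap addr0.
Qed.

(** Let m be the maximum of u on the compact set b <= R0. The core is u <= m + e b on all of S for
    every e > 0; if it failed, v = u - e b would have a maximum over b >= R0, attained on a set that
    is open and closed. With e tending to 0, m is a global maximum, so the touching argument makes u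
    constant. *)
Theorem no_harmonic_exhaustion u (b : S -> R) : subharmonic u -> (forall p, u p < 0)%E ->
  (exists p q, u p <> u q) -> continuous b -> (forall C, compact [set p | b p <= C]) ->
  (forall p, 0 <= b p) ->
  (forall p, 0 < b p -> exists W k, [/\ open W, W p, has_mean_on W k & forall q, W q -> k q = b q]) ->
  False.
Proof.
move=> su uneg [p0 [q0 npq]] cb cptb b0 hb.
have [usc _ _] := su.
have cS := @rs_connected R S.
have fin q : u q != -oo%E -> u q = (fine (u q))%:E.
  by move=> h; rewrite fineK// fin_numE h /= lt_eqF// (lt_trans (uneg q)).
have [p1 up1] : exists p1, u p1 != -oo%E.
  apply: contrapT => H; apply: npq.
  have E p : u p = -oo%E by apply/eqP/contraT => h; case: H; exists p.
  by rewrite !E.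
(* This choice puts p1, where u is finite, strictly inside b < R0: the maximum m is finite, and
   below p1 is a point outside Z. Also b > 0 wherever b >= R0, so b is harmonic there. *)
set R0 := b p1 + 1.
have R0pos : 0 < R0 by rewrite ltr_wpDl.
have [|p2 /= bp2 maxp2] := usc_attains_max (cptb R0) _ usc.
  by exists p1; rewrite /= lerDl.
have um : u p2 != -oo%E.
  rewrite -ltNye; apply: lt_le_trans (maxp2 p1 _); last by rewrite /= lerDl.
  by rewrite ltNye.
set m := fine (u p2); have um' : u p2 = m%:E by exact: fin.
have m0 : m < 0 by have := uneg p2; rewrite um' lte_fin.
have closed_geb : closed [set p | R0 <= b p].
  by apply: (@closed_comp _ _ b [set x | R0 <= x]); [move=> p _; exact: cb|exact: closed_ge].
have claim e : 0 < e -> forall q, (u q <= (m + e * b q)%:E)%E.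
  move=> e0 q; have [bq|bq] := leP (b q) R0.
    by apply: le_trans (maxp2 q bq) _; rewrite um' lee_fin lerDl mulr_ge0// ltW.
  rewrite leNgt; apply/negP => uq.
  have uqfin : u q != -oo%E by rewrite -ltNye; apply: lt_trans uq; rewrite ltNyr.
  pose v p := (u p + (- e * b p)%:E)%E.
  have uscv : upper_semicontinuous v.
    by apply: usc_addr => // p; apply: (@continuousM _ _ (cst (- e))); [exact: cst_continuous|exact: cb].
  pose V0 := fine (u q) - e * b q.
  have mV0 : m < V0 by move: uq; rewrite (fin q uqfin) lte_fin /V0; lra.
  have vq : v q = V0%:E by rewrite /v (fin q uqfin) -EFinD mulNr.
  (* As u < 0, the inequality v p >= V0 forces e b p < - V0; thus v need only be maximised over a
     compact set. *)
  pose C := - V0 / e.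
  have small p : (V0%:E <= v p)%E -> b p <= C.
    move=> h; have up : u p != -oo%E.
      by apply/eqP => E; move: h; rewrite /v E addNye leNgt ltNyr.
    move: h; rewrite /v (fin p up) -EFinD lee_fin => h.
    have := uneg p; rewrite (fin p up) lte_fin => h2.
    by rewrite /C ler_pdivlMr//; lra.
  pose K := [set p | b p <= C] `&` [set p | R0 <= b p].
  have cptK : compact K.
    apply: compact_closedI; first exact: cptb.
    exact: closed_geb.
  have Kq : K q by split; [apply: small; rewrite vq|exact: ltW].
  have [p3 [bp3C bp3] maxp3] := usc_attains_max cptK (ex_intro _ q Kq) uscv.
  have V0p3 : (V0%:E <= v p3)%E by rewrite -vq; exact: maxp3.
  have up3 : u p3 != -oo%E.
    by apply/eqP => E; move: V0p3; rewrite /v E addNye leNgt ltNyr.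
  pose V1 := fine (u p3) - e * b p3.
  have vp3 : v p3 = V1%:E by rewrite /v (fin p3 up3) -EFinD mulNr.
  have V01 : V0 <= V1 by rewrite -lee_fin -vp3.
  have maxV p : R0 <= b p -> (v p <= V1%:E)%E.
    move=> bp; have [vp|vp] := leP (v p) (V0%:E); first by apply: le_trans vp _; rewrite lee_fin.
    by rewrite -vp3; apply: maxp3; split=> //; apply: small; exact: ltW.
  have uv p (c : R) : (v p = c%:E) <-> (u p = (c + e * b p)%:E).
    split; rewrite /v => h.
      have up : u p != -oo%E by apply/eqP => E; move: h; rewrite E addNye.
      by move: h; rewrite (fin p up) -EFinD => -[<-]; rewrite mulNr subrK.
    by rewrite h -EFinD mulNr addrK.
  have uvle p (c : R) : (v p <= c%:E)%E -> (u p <= (c + e * b p)%:E)%E.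
    have [->|up] := eqVneq (u p) -oo%E; first by rewrite leNye.
    by rewrite /v (fin p up) -EFinD !lee_fin; lra.
  pose Z := [set p | R0 <= b p /\ v p = V1%:E].
  (* The maximum of v is not attained on the level b = R0: there u <= m, while V1 + e R0 > m. *)
  have Zgt p : Z p -> R0 < b p.
    move=> [bp /uv up]; rewrite lt_neqAle bp andbT; apply/eqP => E.
    have := maxp2 p; rewrite /= -E => /(_ (lexx _)); rewrite up um' lee_fin -E.
    have := mulr_gt0 e0 R0pos; move: V01 mV0; lra.
  have oZ : open Z.
    rewrite openE => p Zp; have bp := Zgt p Zp; have [_ /uv up] := Zp.
    have [W [k [oW Wp mk kb]]] := hb p (lt_trans R0pos bp).
    pose W' := W `&` [set p | R0 < b p].
    have oW' : open W'.
      by apply: openI => //; apply: (@open_comp _ _ b [set x | R0 < x]); [move=> x _; exact: cb|exact: open_gt].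
    have mk' : has_mean_on W' k.
      move=> c x cA [Wx bx] dx.
      have [r1 r10 [s1 m1]] := mk c x cA Wx dx.
      (* Used only for the radius of a disc contained in W'. *)
      have [r2 r20 [s2 _]] := has_mean_cst (0 : R) oW' cA (conj Wx bx) dx.
      exists (Num.min r1 r2); first by rewrite lt_min r10.
      split; first by move=> w h; apply: s2; apply: lt_le_trans h _; rewrite lecR ge_min lexx orbT.
      by move=> r; rewrite lt_min => /andP[r0 /andP[rr _]]; apply: m1; rewrite r0.
    have mk2 := has_mean_combo e 0 V1 mk' mk'.
    have kE x : W' x -> e * k x + 0 * k x + V1 = V1 + e * b x.
      by move=> [Wx _]; rewrite kb// mul0r addr0 addrC.
    have touch := subharmonic_touch su mk2 oW' (conj Wp bp).
    have N1 : \forall x \near p, W' x by apply: open_nbhs_nbhs.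
    have N2 : \forall x \near p, u x = (e * k x + 0 * k x + V1)%:E.
      apply: touch => [x W'x|]; last by rewrite kE.
      by rewrite kE//; apply: uvle; apply: maxV; case: W'x => _ /ltW.
    apply: filterS2 N1 N2 => x W'x ux; split; first by case: W'x => _ /ltW.
    by apply/uv; rewrite ux kE.
  have cZ : closed Z.
    move=> p clp; have bp : R0 <= b p.
      by apply: closed_geb; apply: closure_subset clp => x [].
    split=> //; apply/eqP; rewrite eq_le maxV//= leNgt; apply/negP => vlt.
    have := uscv p (- V1); rewrite EFinN lteN2 => /(_ vlt)[V Vp HV].
    have [x [[_ vx] Vx]] := clp V Vp.
    by have := HV x Vx; rewrite ?EFinN lteN2 vx ltxx.
  have ZT := connected_clopen cS oZ cZ (ex_intro _ p3 (conj bp3 vp3)).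
  have : Z p1 by rewrite ZT.
  by move=> /Zgt; rewrite /R0 ltNge lerDl ler01.
(* At fixed q the multiple e = d / (b q + 1) makes the term e b q at most d. *)
have um_le q : (u q <= m%:E)%E.
  apply/lee_addgt0Pr => d d0; have bpos : 0 < b q + 1 by rewrite ltr_wpDl.
  apply: le_trans (claim (d / (b q + 1)) (divr_gt0 d0 bpos) q) _.
  rewrite -EFinD lee_fin lerD2l -mulrA ler_piMr ?(ltW d0)// ler_pdivrMl// mulr1.
  by rewrite lerDl.
pose Z := [set p | u p = m%:E].
have oZ : open Z.
  rewrite openE => p up; have mc := @has_mean_cst setT m openT.
  by apply: (subharmonic_touch su mc openT).
have cZ : closed Z.
  move=> p clp; apply/eqP; rewrite eq_le um_le//= leNgt; apply/negP => vlt.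
  have := usc p (- m); rewrite EFinN lteN2 => /(_ vlt)[V Vp HV].
  have [x [vx Vx]] := clp V Vp.
  by have := HV x Vx; rewrite ?EFinN lteN2 vx ltxx.
have ZT := connected_clopen cS oZ cZ (ex_intro _ p2 um').
have Zp : Z p0 by rewrite ZT.
have Zq : Z q0 by rewrite ZT.
by apply: npq; rewrite Zp Zq.
Qed.

End MaximumPrinciple.

(** * The inverse function theorem *)

Section PlaneMaps.
Context {R : realType}.
Local Notation pt := 'rV[R]_2.
Implicit Types (x y v w : pt) (U : set pt).

Lemma ball_segment (x0 x y : pt) (r s : R) : ball x0 r x -> ball x0 r y -> 0 <= s <= 1 ->
  ball x0 r (x + s *: (y - x)).
Proof.
rewrite -ball_normE /= => xr yr /andP[s0 s1].
have -> : x0 - (x + s *: (y - x)) = (1 - s) *: (x0 - x) + s *: (x0 - y).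
  by apply: rowP2; rewrite !mxE; ring.
apply: le_lt_trans (ler_normD _ _) _; rewrite !normrZ !ger0_norm ?subr_ge0//.
have [->|sn0] := eqVneq s 0; first by rewrite subr0 mul1r mul0r addr0.
have spos : 0 < s by rewrite lt_neqAle eq_sym sn0.
have h1 : (1 - s) * `|x0 - x| <= (1 - s) * r by rewrite ler_wpM2l ?subr_ge0// ltW.
have h2 : s * `|x0 - y| < s * r by rewrite ltr_pM2l.
have := ler_ltD h1 h2; have -> : (1 - s) * r + s * r = r by ring.
by [].
Qed.

Lemma MVT_line U (f : pt -> R) x w : open U -> Ck 1 U f ->
  (forall s : R, 0 <= s <= 1 -> U (x + s *: w)) ->
  exists2 s : R, 0 <= s <= 1 &
    f (x + w) - f x = grad_form ('D_'e_0 f (x + s *: w)) ('D_'e_1 f (x + s *: w)) w.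
Proof.
move=> oU cf HU.
pose df (s : R) := grad_form ('D_'e_0 f (x + s *: w)) ('D_'e_1 f (x + s *: w)) w.
have D (s : R) : 0 <= s <= 1 -> is_derive s (1 : R) (fun s => f (x + s *: w)) (df s).
  by move=> /HU Us; exact: is_derive_segment oU cf Us.
have D' (s : R) : s \in `]0, 1[ -> is_derive s (1 : R) (fun s => f (x + s *: w)) (df s).
  by rewrite in_itv /= => /andP[s0 s1]; apply: D; rewrite !ltW.
have C : {within `[0, 1], continuous (fun s => f (x + s *: w))}.
  by apply: within_itv_continuous => s /D; exact: derive_continuous.
have [s + E] := MVT_segment ler01 D' C.
by rewrite in_itv => sI; exists s => //; move: E; rewrite scale1r scale0r addr0 subr0 mulr1.
Qed.

Lemma differentiable_row (f : pt -> pt) x (J : 'M[R]_2) :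
  (forall j, is_diff x (fun y => f y 0 j) (grad_form (J 0 j) (J 1 j))) -> is_diff x f (mulmxr J).
Proof.
move=> H.
have E v j : (v *m J) 0 j = grad_form (J 0 j) (J 1 j) v by rewrite mxE sum2.
apply: differentiable_linear_approx.
  move=> v; apply: row_continuous => j.
  have -> : (fun y : pt => mulmxr J y 0 j) = grad_form (J 0 j) (J 1 j) by apply/funext => y; exact: E.
  exact: grad_form_continuous.
move=> e e0.
have N j : \forall h \near (0 : pt), `|f (h + x) 0 j - f x 0 j - grad_form (J 0 j) (J 1 j) h| <= e * `|h|.
  have [D Dv] := H j; have := diff_locally D; rewrite Dv => /eqaddoP /(_ e e0).
  by apply: filterS => h; rewrite /= opprD addrA.
apply: filterS2 (N 0) (N 1) => h h0 h1.
have eh : 0 <= e * `|h| by rewrite mulr_ge0// ltW.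
have Ej j : (f (h + x) - f x - h *m J) 0 j = f (h + x) 0 j - f x 0 j - grad_form (J 0 j) (J 1 j) h.
  by rewrite -E !mxE.
by rewrite (norm_row_le _ eh) !Ej h0.
Qed.

Lemma jacobianE U (f : pt -> pt) x i j : open U -> Ck 1 U f -> U x ->
  'J f x i j = 'D_'e_i (fun y => f y 0 j) x.
Proof.
move=> oU /(Ck_row 1 f oU) cf Ux.
pose J := \matrix_(i < 2, j < 2) 'D_'e_i (fun y => f y 0 j) x.
have D : is_diff x f (mulmxr J).
  by apply: differentiable_row => k; rewrite !mxE; exact: (Ck1_is_diff oU (cf k) Ux).
have [Df dfE] := D.
have := deriveEjacobian 'e_i Df; rewrite deriveE// dfE /= -!rowE => /rowP/(_ j).
by rewrite !mxE => <-.
Qed.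

Lemma Ck1_differentiable U (f : pt -> pt) x : open U -> Ck 1 U f -> U x -> differentiable f x.
Proof.
move=> oU /(Ck_row 1 f oU) cf Ux.
pose J := \matrix_(i < 2, j < 2) 'D_'e_i (fun y => f y 0 j) x.
have D : is_diff x f (mulmxr J); last by case: D.
by apply: differentiable_row => k; rewrite !mxE; exact: (Ck1_is_diff oU (cf k) Ux).
Qed.

Lemma mx2_ext (A B : 'M[R]_2) : (forall i : 'I_2, ('e_i : pt) *m A = ('e_i : pt) *m B) -> A = B.
Proof. by move=> H; apply/row_matrixP => i; rewrite !rowE. Qed.

Lemma jacobian_comp U U' (f g : pt -> pt) x : open U -> open U' ->
  Ck 1 U g -> Ck 1 U' f -> U x -> U' (g x) -> 'J (f \o g) x = 'J g x *m 'J f (g x).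
Proof.
move=> oU oU' cg cf Ux U'gx.
have Dg := Ck1_differentiable oU cg Ux; have Df := Ck1_differentiable oU' cf U'gx.
have Dfg := differentiable_comp Dg Df.
apply: mx2_ext => i; rewrite mulmxA.
apply: (etrans (esym (deriveEjacobian 'e_i Dfg))).
apply: (etrans _ (congr1 (mulmx^~ ('J f (g x))) (deriveEjacobian 'e_i Dg))).
apply: (etrans _ (deriveEjacobian ('D_'e_i g x) Df)).
by rewrite (deriveE _ Dfg) (diff_comp Dg Df) /= (deriveE _ Df) (deriveE _ Dg).
Qed.

Lemma near_eq_jacobian (f g : pt -> pt) x : differentiable f x -> {near x, f =1 g} -> 'J f x = 'J g x.
Proof.
move=> Df fg; have Dg : differentiable g x.
  have /diff_locallyP[c E] := Df.
  have : is_diff x g ('d f x); last by case.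
  apply: differentiable_linear_approx => // e e0.
  have /eqaddoP/(_ e e0) N := E.
  have fgx := nbhs_singleton fg.
  have N2 : \forall h \near (0 : pt), f (h + x) = g (h + x).
    have /nbhs_ballP[r /= r0 Br] := fg; apply/nbhs_ballP; exists r => // h.
    by rewrite -ball_normE /= sub0r normrN => hr; apply: Br; rewrite -ball_normE /= opprD addrC subrK normrN.
  by apply: filterS2 N N2 => h; rewrite /= opprD addrA -fgx => + <-.
apply: mx2_ext => i.
apply: (etrans (esym (deriveEjacobian 'e_i Df))).
apply: (etrans _ (deriveEjacobian 'e_i Dg)).
exact: near_eq_derive.
Qed.

End PlaneMaps.

(** * Local expansion, openness and smooth inverses *)

Section InverseFunction.
Context {R : realType}.
Local Notation pt := 'rV[R]_2.
Implicit Types (x y v w : pt).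

(** Cramer's rule with an error term: u = w J + E is multiplied by the adjugate of J, whose entries
    are bounded by m. *)
Lemma mx2_lower_bound (a b c d w0 w1 u0 u1 E0 E1 m e W : R) :
  u0 = w0 * a + w1 * c + E0 -> u1 = w0 * b + w1 * d + E1 ->
  `|a| <= m -> `|b| <= m -> `|c| <= m -> `|d| <= m ->
  `|E0| <= e * W -> `|E1| <= e * W ->
  `|a * d - b * c| * `|w0| <= m * (`|u0| + `|u1|) + 2 * m * e * W /\
  `|a * d - b * c| * `|w1| <= m * (`|u0| + `|u1|) + 2 * m * e * W.
Proof.
move=> u0E u1E am bm cm dm e0 e1.
have T (p q : R) : `|p| <= m -> `|p * q| <= m * `|q| by move=> pm; rewrite normrM ler_wpM2r.
have T2 (p q : R) : `|p| <= m -> `|q| <= e * W -> `|p * q| <= m * (e * W).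
  by move=> pm qe; rewrite normrM ler_pM.
have -> : 2 * m * e * W = m * (e * W) + m * (e * W) by ring.
rewrite -!normrM mulrDr; split.
- have -> : (a * d - b * c) * w0 = (d * u0 - c * u1) - (d * E0 - c * E1) by rewrite u0E u1E; ring.
  apply: le_trans (ler_normB _ _) _; apply: lerD; apply: le_trans (ler_normB _ _) _; apply: lerD;
  by [exact: T|exact: T2].
- have -> : (a * d - b * c) * w1 = (a * u1 - b * u0) - (a * E1 - b * E0) by rewrite u0E u1E; ring.
  apply: le_trans (ler_normB _ _) _; apply: lerD; apply: le_trans (ler_normB _ _) _;
  [rewrite addrC; apply: lerD|apply: lerD]; by [exact: T|exact: T2].
Qed.

(** The Jacobian determinant, written in partial derivatives so that the C^k calculus applies to it
    directly. *)
Definition jdet (f : pt -> pt) x : R :=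
  'D_'e_0 (fun y => f y 0 0) x * 'D_'e_1 (fun y => f y 0 1) x -
  'D_'e_0 (fun y => f y 0 1) x * 'D_'e_1 (fun y => f y 0 0) x.

Lemma absorb_half (dt m F X : R) : 0 < dt -> dt * X <= m * (2 * F) + dt / 2 * X -> X <= 4 * m / dt * F.
Proof. by move=> dt0 h; rewrite mulrAC ler_pdivlMr//; lra. Qed.

Lemma two_le_three_sq (e : R) : 2 * e ^+ 2 <= (3 * e) ^+ 2.
Proof. by have := sqr_ge0 e; rewrite exprMn; lra. Qed.

Lemma grad_split (w : pt) (a b a' b' : R) :
  grad_form a b w = w 0 0 * a' + w 0 1 * b' + (w 0 0 * (a - a') + w 0 1 * (b - b')).
Proof. by rewrite /grad_form; ring. Qed.

Lemma inverse2 (a b c d dt : R) : dt != 0 -> dt = a * d - b * c ->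
  [/\ d / dt * a + - b / dt * c = 1, d / dt * b + - b / dt * d = 0,
      - c / dt * a + a / dt * c = 0 & - c / dt * b + a / dt * d = 1].
Proof.
move=> dn0 dtE; split; try ring.
- have -> : d / dt * a + - b / dt * c = (a * d - b * c) / dt by ring.
  by rewrite -dtE divff.
- have -> : - c / dt * b + a / dt * d = (a * d - b * c) / dt by ring.
  by rewrite -dtE divff.
Qed.

Lemma mx2_kernel (a b c d p q : R) : a * c - b * d != 0 ->
  2 * p * d + 2 * q * c = 0 -> 2 * p * a + 2 * q * b = 0 -> p = 0 /\ q = 0.
Proof.
move=> dn0 e1 e2.
have Ep : p * (a * c - b * d) = 0.
  have -> : p * (a * c - b * d) = 2^-1 * (c * (2 * p * a + 2 * q * b) - b * (2 * p * d + 2 * q * c)) by field.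
  by rewrite e1 e2; ring.
have Eq : q * (a * c - b * d) = 0.
  have -> : q * (a * c - b * d) = 2^-1 * (a * (2 * p * d + 2 * q * c) - d * (2 * p * a + 2 * q * b)) by field.
  by rewrite e1 e2; ring.
by move/eqP: Ep; move/eqP: Eq; rewrite !mulf_eq0 (negPf dn0) !orbF => /eqP -> /eqP ->.
Qed.

Lemma scale_rearrange (u k : pt) (h : R) : h != 0 -> u - h^-1 *: k = - (h^-1 *: (k - h *: u)).
Proof. by move=> h0; rewrite scalerBr scalerA mulVf// scale1r opprB. Qed.

Lemma sub_quarter (a b e : R) : 4 * e <= a -> b < e -> 3 * e <= a - b.
Proof. by lra. Qed.

Lemma mx_entries_bound (D : 'I_2 -> 'I_2 -> R) i j :
  `|D i j| <= `|D 0 0| + `|D 0 1| + `|D 1 0| + `|D 1 1| + 1.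
Proof.
have p00 := normr_ge0 (D 0 0); have p01 := normr_ge0 (D 0 1).
have p10 := normr_ge0 (D 1 0); have p11 := normr_ge0 (D 1 1).
by case: (ord2E i) => ->; case: (ord2E j) => ->; lra.
Qed.

Lemma near_and (T : Type) (F : set_system T) {FF : Filter F} (P Q : T -> Prop) :
  (\forall x \near F, P x) -> (\forall x \near F, Q x) -> \forall x \near F, P x /\ Q x.
Proof. exact: filterI. Qed.

(** The mean value theorem for each component gives f x - f y = (x - y) J + error, with J the
    Jacobian at x0. Inverting J by Cramer's rule, the error is absorbed into the left side. *)
Lemma local_expansion (B : set pt) (f : pt -> pt) x0 : open B -> Ck 1 B f -> B x0 -> jdet f x0 != 0 ->
  exists r c : R, [/\ 0 < r, 0 < c, ball x0 r `<=` B &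
    forall x y, ball x0 r x -> ball x0 r y -> `|x - y| <= c * `|f x - f y|].
Proof.
move=> oB /(Ck_row 1 f oB) cf Bx0 det0.
pose D i j := 'D_'e_i (fun y => f y 0 j).
set m := `|D 0 0 x0| + `|D 0 1 x0| + `|D 1 0 x0| + `|D 1 1 x0| + 1.
have m0 : 0 < m by rewrite ltr_wpDl// !addr_ge0.
set dt := `|jdet f x0|; have dt0 : 0 < dt by rewrite normr_gt0.
(* The error term of Cramer's rule is 2 m (2 e) |x - y|; this e makes it dt / 2 times |x - y|, half
   of the left side. *)
set e := dt / (8 * m); have e0 : 0 < e by rewrite divr_gt0// mulr_gt0.
have N i j : \forall y \near x0, `|D i j x0 - D i j y| <= e.
  have [_ c] := Ck_S_elim (cf j); have := Ck_cont (c i) Bx0.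
  by move=> /cvgrPdist_le; exact.
have NB : \forall y \near x0, B y by exact: open_nbhs_nbhs.
have [r r0 Br] : exists2 r : R, 0 < r & forall y, ball x0 r y -> B y /\ forall i j, `|D i j x0 - D i j y| <= e.
  have : \forall y \near x0, B y /\ ((`|D 0 0 x0 - D 0 0 y| <= e /\ `|D 0 1 x0 - D 0 1 y| <= e)
     /\ (`|D 1 0 x0 - D 1 0 y| <= e /\ `|D 1 1 x0 - D 1 1 y| <= e)).
    exact: near_and NB (near_and (near_and (N 0 0) (N 0 1)) (near_and (N 1 0) (N 1 1))).
  move=> /nbhs_ballP[r /= r0 Br]; exists r => // y /Br[By [[h1 h2] [h3 h4]]]; split=> // i j.
  by case: (ord2E i) => ->; case: (ord2E j) => ->.
exists r, (4 * m / dt); split=> //; first by rewrite !mulr_gt0 ?invr_gt0.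
  by move=> y /Br[].
move=> x y xr yr.
have seg s : 0 <= s <= 1 -> ball x0 r (y + s *: (x - y)) by exact: ball_segment.
have mv j : exists2 E, `|E| <= 2 * e * `|x - y| &
    f x 0 j - f y 0 j = (x - y) 0 0 * D 0 j x0 + (x - y) 0 1 * D 1 j x0 + E.
  have [s sI] := MVT_line oB (cf j) (fun s sI => proj1 (Br _ (seg s sI))).
  have yx : y + (x - y) = x by rewrite addrC subrK.
  rewrite yx => ->; set xi := y + _; have [_ Bxi] := Br _ (seg s sI).
  exists ((x - y) 0 0 * (D 0 j xi - D 0 j x0) + (x - y) 0 1 * (D 1 j xi - D 1 j x0)).
    have T i : `|(x - y) 0 i * (D i j xi - D i j x0)| <= `|x - y| * e.
      by rewrite normrM ler_pM ?coord_le// distrC.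
    apply: le_trans (ler_normD _ _) _; apply: le_trans (lerD (T 0) (T 1)) _.
    have dbl (a b : R) : a * b + a * b = 2 * b * a by ring.
    by rewrite -dbl.
  exact: grad_split.
have [E0 hE0 u0] := mv 0; have [E1 hE1 u1] := mv 1.
have mle i j : `|D i j x0| <= m := mx_entries_bound (fun i j => D i j x0) i j.
have [h0 h1] := mx2_lower_bound u0 u1 (mle 0 0) (mle 0 1) (mle 1 0) (mle 1 1) hE0 hE1.
have fxy j : `|f x 0 j - f y 0 j| <= `|f x - f y| by apply: le_trans (coord_le _ j); rewrite !mxE.
have fin_ (w : R) : dt * w <= m * (`|f x 0 0 - f y 0 0| + `|f x 0 1 - f y 0 1|) + 2 * m * (2 * e) * `|x - y| ->
  dt * w <= m * (2 * `|f x - f y|) + dt / 2 * `|x - y|.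
  move=> h; apply: le_trans h _; apply: lerD.
    by rewrite ler_pM2l// mulr2n mulrDl mul1r; apply: lerD.
  have -> : 2 * m * (2 * e) = dt / 2 by rewrite /e; field; rewrite gt_eqF.
  by [].
have {h0}h0 := fin_ _ h0; have {h1}h1 := fin_ _ h1.
have : dt * `|x - y| <= m * (2 * `|f x - f y|) + dt / 2 * `|x - y|.
  rewrite mulrC -ler_pdivlMr// norm_row_le; last by rewrite divr_ge0// ?(ltW dt0)// addr_ge0// mulr_ge0// ltW// divr_gt0.
  by rewrite !ler_pdivlMr// ![_ * dt]mulrC h0 h1.
exact: absorb_half.
Qed.

(** For y near f x1, minimise the squared Euclidean distance from f x to y over a closed box around
    x1. Expansion keeps the minimum off the boundary, and at an interior critical point
    invertibility of the Jacobian forces f x = y. *)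
Lemma expanding_open (V : set pt) (f : pt -> pt) (c : R) : open V -> Ck 1 V f ->
  (forall x, V x -> jdet f x != 0) -> 0 < c ->
  (forall x y, V x -> V y -> `|x - y| <= c * `|f x - f y|) ->
  forall W, open W -> W `<=` V -> open (f @` W).
Proof.
move=> oV cf det0 c0 ex W oW WV; rewrite openE => _ [x1 Wx1 <-].
have /(Ck_row 1 f oV) cfj := cf.
have [r r0 rW] := open_ball_sub oW Wx1.
set d := r / 2; have d0 : 0 < d by rewrite divr_gt0.
have dr : d < r by rewrite /d ltr_pdivrMr// ltr_pMr// ltr1n.
set K := [set x : pt | `|x - x1| <= d].
have KW x : K x -> W x by move=> xd; apply: rW; rewrite -ball_normE /= distrC (le_lt_trans xd).
(* On the boundary of the box f is at distance at least d / c = 4 eta from f x1, hence at least 3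
   eta from y; there F >= 9 eta^2, whereas F x1 < 2 eta^2. *)
set eta := d / (4 * c); have eta0 : 0 < eta by rewrite divr_gt0// mulr_gt0.
apply/nbhs_ballP; exists eta => // y; rewrite -ball_normE /= => yeta.
pose F x : R := (f x 0 0 - y 0 0) ^+ 2 + (f x 0 1 - y 0 1) ^+ 2.
have dF i x : V x -> is_derive x 'e_i F
   (2 * (f x 0 0 - y 0 0) * 'D_'e_i (fun x => f x 0 0) x + 2 * (f x 0 1 - y 0 1) * 'D_'e_i (fun x => f x 0 1) x).
  move=> Vx; have D j : is_derive x 'e_i (fun x => f x 0 j) ('D_'e_i (fun x => f x 0 j) x).
    by have [h _] := Ck_S_elim (cfj j); exact: h.
  have D2 j : is_derive x 'e_i (fun x => f x 0 j - y 0 j) ('D_'e_i (fun x => f x 0 j) x).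
    by have := is_deriveB (D j) (is_derive_cst (y 0 j) x 'e_i); rewrite subr0.
  apply: is_derive_eq (is_deriveD (is_deriveM (D2 0) (D2 0)) (is_deriveM (D2 1) (D2 1))) _.
  by rewrite /GRing.scale /=; ring.
have cF : {within K, continuous F}.
  apply: continuous_in_subspaceT => x /set_mem/KW/WV Vx.
  have cj j : {for x, continuous (fun x => f x 0 j - y 0 j)}.
    by apply: (@continuousB _ R^o); [exact: Ck_cont (cfj j) Vx|exact: cst_continuous].
  have cM j : {for x, continuous (fun x => (f x 0 j - y 0 j) ^+ 2)}.
    by apply: (@continuousM _ _ (fun x => f x 0 j - y 0 j) (fun x => f x 0 j - y 0 j)); exact: cj.
  exact: (@continuousD _ R^o _ _ _ _ (cM 0) (cM 1)).
have K0 : K !=set0 by exists x1; rewrite /K /= subrr normr0 ltW.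
have [x2 /set_mem Kx2 min] := EVT_min_rV K0 (@box_compact R x1 d) cF.
have Fx1 : F x1 < 2 * eta ^+ 2.
  move: yeta; rewrite norm_row_lt// !mxE => /andP[h0 h1].
  have sq (a : R) : `|a| < eta -> a ^+ 2 < eta ^+ 2.
    by move=> h; rewrite -(real_normK (num_real a)) ltrXn2r// nnegrE ltW.
  by rewrite mulr2n mulrDl mul1r; apply: ltrD; exact: sq.
have interior : `|x2 - x1| < d.
  rewrite lt_neqAle Kx2 andbT; apply/eqP => E.
  have h : d <= c * `|f x2 - f x1| by rewrite -E; apply: ex; apply: WV => //; exact: KW.
  have h2 : 4 * eta <= `|f x2 - f x1|.
    have -> : 4 * eta = d / c by rewrite /eta; field; rewrite gt_eqF.
    by rewrite ler_pdivrMr// mulrC.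
  have h3 : 3 * eta <= `|f x2 - y|.
    have -> : f x2 - y = (f x2 - f x1) - (y - f x1) by rewrite opprB addrA subrK.
    apply: le_trans (lerB_dist _ _); rewrite [`|y - _|]distrC.
    exact: sub_quarter.
  have h4 : (3 * eta) ^+ 2 <= F x2.
    have [j jE] : exists j, 3 * eta <= `|f x2 0 j - y 0 j|.
      apply: contrapT => H; have : `|f x2 - y| < 3 * eta; last by rewrite ltNge h3.
      have e3 : 0 < 3 * eta by rewrite mulr_gt0.
      rewrite (norm_row_lt _ e3) !mxE; apply/andP; split; rewrite ltNge; apply/negP => h';
      by apply: H; eexists; exact: h'.
    have sq : (3 * eta) ^+ 2 <= (f x2 0 j - y 0 j) ^+ 2.
      rewrite -(real_normK (num_real (_ - _))) lerXn2r// nnegrE ?normr_ge0//.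
      by rewrite mulr_ge0// ltW.
    apply: le_trans sq _; rewrite /F; case: (ord2E j) => ->; first by rewrite lerDl sqr_ge0.
    by rewrite lerDr sqr_ge0.
  have := min x1; rewrite inE /K /= subrr normr0 ltW// => /(_ isT).
  rewrite leNgt => /negP; apply; apply: lt_le_trans Fx1 (le_trans _ h4).
  exact: two_le_three_sq.
have crit i : 2 * (f x2 0 0 - y 0 0) * 'D_'e_i (fun x => f x 0 0) x2 + 2 * (f x2 0 1 - y 0 1) * 'D_'e_i (fun x => f x 0 1) x2 = 0.
  set dd := d - `|x2 - x1|; have dd0 : 0 < dd by rewrite subr_gt0.
  have inK (s : R) : s \in `](- dd), dd[ -> K (x2 + s *: 'e_i).
    rewrite in_itv /= -ltr_norml => sdd; rewrite /K /= addrAC.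
    apply: le_trans (ler_normD _ _) _; rewrite normrZ norm_delta_row mulr1.
    by rewrite -lerBrDl; exact: ltW.
  have z0 : (0 : R) \in `](- dd), dd[ by rewrite in_itv /= oppr_lt0 dd0.
  have Nd : - dd <= dd by rewrite ge0_cp// ltW.
  have DF (s : R) : s \in `](- dd), dd[ -> derivable (fun s : R => F (x2 + s *: 'e_i)) s 1.
    by move=> /inK/KW/WV Vs; have [] := is_derive_line (dF i _ Vs).
  have mF (s : R) : s \in `](- dd), dd[ -> F (x2 + 0 *: 'e_i) <= F (x2 + s *: 'e_i).
    by move=> /inK/mem_set/min; rewrite scale0r addr0.
  have [_ <-] := derive1_at_min Nd DF z0 mF.
  have V0 : V (x2 + 0 *: 'e_i) by apply/WV/KW/inK.
  have [_ ->] := is_derive_line (dF i _ V0).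
  by rewrite scale0r addr0.
have Vx2 : V x2 by apply/WV/KW.
have := crit 0; have := crit 1; have := det0 _ Vx2; rewrite /jdet.
set a := 'D_'e_0 _ x2; set b := 'D_'e_0 _ x2; set c' := 'D_'e_1 _ x2; set d' := 'D_'e_1 _ x2.
move=> dn0 e1 e2; exists x2; first exact: KW.
have [z1 z2] : f x2 0 0 - y 0 0 = 0 /\ f x2 0 1 - y 0 1 = 0.
  exact: mx2_kernel dn0 e1 e2.
by apply: rowP2; apply/eqP; rewrite -subr_eq0; apply/eqP.
Qed.

Definition row2 (a b : R) : pt := \row_j (if j == 0 then a else b).

Lemma row2_0 a b : row2 a b 0 0 = a. Proof. by rewrite mxE. Qed.
Lemma row2_1 a b : row2 a b 0 1 = b. Proof. by rewrite mxE. Qed.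

(** Row i of the inverse Jacobian matrix of f at x. *)
Definition inv_jac_row (f : pt -> pt) (i : 'I_2) x : pt :=
  if i == 0 then row2 ('D_'e_1 (fun y => f y 0 1) x / jdet f x) (- 'D_'e_0 (fun y => f y 0 1) x / jdet f x)
  else row2 (- 'D_'e_1 (fun y => f y 0 0) x / jdet f x) ('D_'e_0 (fun y => f y 0 0) x / jdet f x).

Lemma inv_jac_rowP (f : pt -> pt) i l x : jdet f x != 0 ->
  inv_jac_row f i x 0 0 * 'D_'e_0 (fun y => f y 0 l) x + inv_jac_row f i x 0 1 * 'D_'e_1 (fun y => f y 0 l) x
  = ('e_i : pt) 0 l.
Proof.
rewrite /inv_jac_row; set dt := jdet f x => dn0; rewrite mxE.
have [h1 h2 h3 h4] := inverse2 dn0 (erefl dt).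
by case: (ord2E i) => ->; case: (ord2E l) => ->; rewrite /= !row2_0 !row2_1.
Qed.

(** Openness of f makes g continuous, and the expansion bound turns the first-order expansion of f
    into one of g, so the partial derivatives of g are the rows of the inverse Jacobian evaluated at
    g. *)
Lemma inverse_smooth (V : set pt) (f g : pt -> pt) (c : R) : open V -> smooth V f ->
  (forall x, V x -> jdet f x != 0) -> 0 < c ->
  (forall x y, V x -> V y -> `|x - y| <= c * `|f x - f y|) ->
  (forall x, V x -> g (f x) = x) -> smooth (f @` V) g.
Proof.
move=> oV sf det0 c0 ex gK.
have cf : Ck 1 V f by exact: sf.
have opn := expanding_open oV cf det0 c0 ex.
have oI : open (f @` V) by exact: opn.
have sfj j k : Ck k V (fun x => f x 0 j) by exact: (Ck_row k f oV).1 (sf k) j.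
have cg y : (f @` V) y -> {for y, continuous g}.
  move=> [x Vx <-] N; rewrite /= gK// => Nx.
  have [W [oW Wx] WN] : exists2 W, open W /\ W x & W `<=` N.
    by move: Nx; rewrite nbhsE => -[W [oW Wx] WN]; exists W.
  have oWV : open (f @` (W `&` V)) by apply: opn; [exact: openI|exact: subIsetr].
  have : nbhs (f x) (f @` (W `&` V)) by apply: open_nbhs_nbhs; split => //; exists x.
  apply: filterS => _ [x' [Wx' Vx'] <-] /=; rewrite gK//; exact: WN.
have dg i y : (f @` V) y -> is_derive y 'e_i g (inv_jac_row f i (g y)).
  move=> Iy; have [x Vx xE] := Iy.
  have gy : g y = x by rewrite -xE gK.
  pose D k l := 'D_'e_k (fun y => f y 0 l) x.
  have dn0 : jdet f x != 0 by exact: det0.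
  have fj l : is_diff x (fun y => f y 0 l) (grad_form (D 0 l) (D 1 l)) by exact: (Ck1_is_diff oV (sfj l 1%N) Vx).
  set m := `|D 0 0| + `|D 0 1| + `|D 1 0| + `|D 1 1| + 1.
  have m0 : 0 < m by rewrite ltr_wpDl// !addr_ge0.
  set dt := `|jdet f x|; have dt0 : 0 < dt by rewrite normr_gt0.
  have cvg : (fun h : R => h^-1 *: ((g \o shift y) (h *: 'e_i) - g y)) @ 0^' --> inv_jac_row f i (g y).
    apply/cvgrPdist_le => e e0.
    (* Chosen so that the error 2 m e1 |k| of Cramer's rule, with |k| <= c |h|, is at most dt e
       |h|. *)
    set e1 := e * dt / (2 * m * c); have e10 : 0 < e1 by rewrite divr_gt0 ?mulr_gt0.
    have N l : \forall k \near (0 : pt), `|f (k + x) 0 l - f x 0 l - grad_form (D 0 l) (D 1 l) k| <= e1 * `|k|.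
      have [D_ Dv] := fj l; have := diff_locally D_; rewrite Dv => /eqaddoP /(_ e1 e10).
      by apply: filterS => k; rewrite /= opprD addrA.
    have N2 := @near_and _ _ (nbhs_filter (0 : pt)) _ _ (N 0) (N 1).
    have cgy : {for y, continuous g} by exact: cg.
    have cadd : {for (0 : R), continuous (fun h : R => y + h *: 'e_i)}.
      by apply: (@continuousD _ _ _ (cst y) (fun h : R => h *: 'e_i)); [exact: cst_continuous|exact: scalel_continuous].
    have cline : (fun h : R => g (y + h *: 'e_i) - x) @ 0 --> (0 : pt).
      have -> : (0 : pt) = g (y + (0 : R) *: 'e_i) - x by rewrite scale0r addr0 gy subrr.
      apply: (@continuousB _ _ _ (fun h : R => g (y + h *: 'e_i)) (cst x)); last exact: cst_continuous.
      apply: (@continuous_comp _ _ _ (fun h : R => y + h *: 'e_i) g); last by rewrite scale0r addr0.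
      exact: cadd.
    have N3 : \forall h \near (0 : R), (f @` V) (y + h *: 'e_i).
      have : (fun h : R => y + h *: 'e_i) @ 0 --> y + (0 : R) *: 'e_i.
        exact: cadd.
      by rewrite scale0r addr0; apply; exact: open_nbhs_nbhs.
    have N4 := cline _ N2.
    have N5 := nbhs_dnbhs (@near_and _ _ (nbhs_filter (0 : R)) _ _ N4 N3).
    have N6 : \forall h \near (0 : R)^', h != 0 by exact: nbhs_dnbhs_neq.
    apply: filterS2 N5 N6 => h [[h0 h1] Ih] hn0 /=.
    set k := g (y + h *: 'e_i) - x in h0 h1.
    have kx : k + x = g (y + h *: 'e_i) by rewrite subrK.
    have fk : f (k + x) = y + h *: 'e_i by rewrite kx; case: Ih => x' Vx' <-; rewrite gK.
    have Vk : V (k + x) by rewrite kx; case: Ih => x' Vx' <-; rewrite gK.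
    have kb : `|k| <= c * `|h|.
      have := ex _ _ Vk Vx; rewrite addrK fk xE [y + _]addrC addrK normrZ norm_delta_row mulr1.
      by [].
    rewrite fk xE [y + _]addrC in h0 h1.
    have el l : (h *: 'e_i + y) 0 l - y 0 l = h * ('e_i : pt) 0 l by rewrite !mxE addrK.
    rewrite !el in h0 h1.
    have -> : g (h *: 'e_i + y) - g y = k by rewrite gy /k [y + _]addrC.
    (* k - h e_i J^-1, multiplied by J, is the remainder of the expansion of f at x *)
    set q := k - h *: inv_jac_row f i x.
    have qE l : 0 = q 0 0 * D 0 l + q 0 1 * D 1 l + (h * ('e_i : pt) 0 l - grad_form (D 0 l) (D 1 l) k).
      have alg (h' e' k0 k1 a0 a1 d0 d1 : R) : a0 * d0 + a1 * d1 = e' ->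
          0 = (k0 - h' * a0) * d0 + (k1 - h' * a1) * d1 + (h' * e' - (k0 * d0 + k1 * d1)).
        by move=> <-; ring.
      have q0 j : q 0 j = k 0 j - h * inv_jac_row f i x 0 j by rewrite /q !mxE.
      by rewrite !q0; apply: alg; exact: inv_jac_rowP.
    have mle a b : `|D a b| <= m := mx_entries_bound D a b.
    have [q0 q1] := mx2_lower_bound (qE 0) (qE 1) (mle 0 0) (mle 0 1) (mle 1 0) (mle 1 1) h0 h1.
    rewrite normr0 addr0 mulr0 add0r -/dt in q0 q1.
    have qb : `|q| <= e * `|h|.
      have B : 2 * m * e1 * `|k| <= dt * (e * `|h|).
        have -> : dt * (e * `|h|) = 2 * m * e1 * (c * `|h|) by rewrite /e1; field; rewrite !gt_eqF.
        have p0 : 0 < 2 * m * e1 by apply: mulr_gt0 => //; apply: mulr_gt0.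
        by rewrite (ler_pM2l p0).
      rewrite norm_row_le; last by rewrite mulr_ge0// ltW.
      apply/andP; split; rewrite -(ler_pM2l dt0); [exact: le_trans q0 B|exact: le_trans q1 B].
    have -> : inv_jac_row f i (g y) - h^-1 *: k = - (h^-1 *: q).
      by rewrite gy; exact: scale_rearrange.
    rewrite normrN normrZ normfV -ler_pdivlMl ?invr_gt0 ?normr_gt0// invrK mulrC.
    exact: qb.
  by apply: DeriveDef; [apply/cvg_ex; eexists; exact: cvg|exact: cvg_lim cvg].
have cD i j k : Ck k V ('D_'e_i (fun y => f y 0 j)) by have [_] := Ck_S_elim (sfj j k.+1).
have cdet k : Ck k V (jdet f).
  by rewrite /jdet; apply: Ck_sub2 => //; apply: Ck_mul.
(* Bootstrap: the partial derivatives of g are smooth functions composed with g, hence of class C^k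
   as soon as g is. *)
elim=> [|k IH]; first by split=> // y /set_mem; exact: cg.
apply: (Ck_S_intro oI cg dg) => i; apply/Ck_row => // j.
have gV y : (f @` V) y -> V (g y) by move=> [x Vx <-]; rewrite gK.
have Q (u : pt -> R) : Ck k V u -> Ck k (f @` V) (fun y => u (g y)).
  by move=> cu; exact: (Ck_comp oI oV gV cu IH).
have dn y : (f @` V) y -> jdet f (g y) != 0 by move=> /gV; exact: det0.
have QD a b : Ck k (f @` V) (fun y => 'D_'e_a (fun y => f y 0 b) (g y) / jdet f (g y)).
  by apply: Ck_mul => //; [exact: (Q _ (cD a b k))|apply: Ck_inv => //; exact: (Q _ (cdet k))].
have QN a b : Ck k (f @` V) (fun y => - 'D_'e_a (fun y => f y 0 b) (g y) / jdet f (g y)).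
  by apply: Ck_eq (Ck_opp oI (QD a b)) => // y _; rewrite mulNr.
by case: (ord2E i) => ->; case: (ord2E j) => ->; rewrite /inv_jac_row /=;
  (under eq_fun do rewrite ?row2_0 ?row2_1).
Qed.

End InverseFunction.

(** * Flat metrics *)

Section FlatMetric.
Context {R : realType}.
Local Notation pt := 'rV[R]_2.

Definition mx2 (a b c d : R) : 'M[R]_2 :=
  \matrix_(i, j) (if i == 0 then if j == 0 then a else b else if j == 0 then c else d).

Lemma mx2_eqP (A B : 'M[R]_2) : A 0 0 = B 0 0 -> A 0 1 = B 0 1 -> A 1 0 = B 1 0 -> A 1 1 = B 1 1 -> A = B.
Proof. by move=> *; apply/matrixP => i j; case: (ord2E i) => ->; case: (ord2E j) => ->. Qed.

Lemma mul_mx2E m (A : 'M[R]_(m, 2)) n (B : 'M[R]_(2, n)) i j : (A *m B) i j = A i 0 * B 0 j + A i 1 * B 1 j.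
Proof. by rewrite mxE sum2. Qed.

Lemma det_mx2 (A : 'M[R]_2) : \det A = A 0 0 * A 1 1 - A 0 1 * A 1 0.
Proof.
rewrite (expand_det_row A 0) sum2 /cofactor !det_mx11 !mxE /=.
have -> : lift 0 0 = 1 :> 'I_2 by exact: val_inj.
have -> : lift 1 0 = 0 :> 'I_2 by exact: val_inj.
by rewrite expr0 expr1 mul1r mulN1r mulrN.
Qed.

(** The matrix is that of the metric (a dx + b dy)^2 + (c dy)^2. *)
Lemma invmx_gram (a b c : R) : a != 0 -> c != 0 ->
  invmx (mx2 (a * a) (a * b) (a * b) (b * b + c * c)) =
  mx2 ((b * b + c * c) / (a * a * (c * c))) (- b / (a * (c * c))) (- b / (a * (c * c))) (1 / (c * c)).
Proof.
move=> a0 c0; set A := mx2 _ _ _ _; set B := mx2 _ _ _ _.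
have AB : A *m B = 1%:M.
  by apply: mx2_eqP; rewrite mul_mx2E !mxE /=; field; rewrite ?a0 ?c0.
by have [uA _] := mulmx1_unit AB; rewrite -[invmx A]mulmx1 -AB mulmxA mulVmx// mul1mx.
Qed.

Lemma gram_derive (a b c : pt -> R) (g : pt -> 'M[R]_2) (V : set pt) : open V ->
  Ck 1 V a -> Ck 1 V b -> Ck 1 V c ->
  (forall x, V x -> g x = mx2 (a x * a x) (a x * b x) (a x * b x) (b x * b x + c x * c x)) ->
  forall x i, V x ->
  [/\ 'D_'e_i (fun y => g y 0 0) x = 2 * a x * 'D_'e_i a x,
      'D_'e_i (fun y => g y 0 1) x = a x * 'D_'e_i b x + b x * 'D_'e_i a x,
      'D_'e_i (fun y => g y 1 0) x = a x * 'D_'e_i b x + b x * 'D_'e_i a x &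
      'D_'e_i (fun y => g y 1 1) x = 2 * b x * 'D_'e_i b x + 2 * c x * 'D_'e_i c x].
Proof.
move=> oV /Ck_S_elim[da _] /Ck_S_elim[db _] /Ck_S_elim[dc _] gE x i Vx.
have NV : \forall y \near x, V y by exact: open_nbhs_nbhs.
have val (h h' : pt -> R) (d : R) : (forall y, V y -> h y = h' y) -> is_derive x 'e_i h' d -> 'D_'e_i h x = d.
  move=> hh [_ <-]; apply: near_eq_derive; apply: filterS NV => y; exact: hh.
have dax := da i x Vx; have dbx := db i x Vx; have dcx := dc i x Vx.
split.
- apply: (val _ (fun y => a y * a y)); first by move=> y /gE ->; rewrite mxE.
  by apply: is_derive_eq (is_deriveM dax dax) _; rewrite /GRing.scale /=; ring.
- have H := is_deriveM dax dbx.
  have e y : V y -> g y 0 1 = (a * b) y by move=> /gE ->; rewrite mxE.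
  exact: (val _ _ _ e H).
- have H := is_deriveM dax dbx.
  have e y : V y -> g y 1 0 = (a * b) y by move=> /gE ->; rewrite mxE.
  exact: (val _ _ _ e H).
- apply: (val _ (fun y => b y * b y + c y * c y)); first by move=> y /gE ->; rewrite mxE.
  by apply: is_derive_eq (is_deriveD (is_deriveM dbx dbx) (is_deriveM dcx dcx)) _; rewrite /GRing.scale /=; ring.
Qed.

(* G l j k stands for Christoffel symbols and d l i j for their derivatives. *)
Lemma gauss_algebra (a b c p q a0 a1 b0 b1 c0 c1 b01 b10 p1 q0
   G000 G001 G010 G011 G100 G101 G110 G111 d0011 d0101 d1011 d1101 : R) :
  b01 = b10 ->
  a * G000 + b * G100 = a0 -> a * G001 + b * G101 = b0 - p * c ->
  a * G010 + b * G110 = a1 -> a * G011 + b * G111 = b1 - q * c ->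
  c * G101 = c0 + p * b -> c * G111 = c1 + q * b ->
  a * d0011 + b * d1011 = b01 - (q * c0 + c * q0) - (a0 * G011 + b0 * G111) ->
  a * d0101 + b * d1101 = b10 - (p * c1 + c * p1) - (a1 * G001 + b1 * G101) ->
  (d0011 - d0101 + ((G000 * G011 - G010 * G001) + (G001 * G111 - G011 * G101))) * (a * a) +
  (d1011 - d1101 + ((G100 * G011 - G110 * G001) + (G101 * G111 - G111 * G101))) * (a * b)
  = - (a * c * (q0 - p1)).
Proof.
move=> Eb e00 e01 e10 e11 f01 f11 h1 h2.
transitivity (a * ((a * d0011 + b * d1011) - (a * d0101 + b * d1101) +
  ((a * G000 + b * G100) * G011 - (a * G010 + b * G110) * G001 + (a * G001 + b * G101) * G111
   - (a * G011 + b * G111) * G101))); first by ring.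
rewrite h1 h2 e00 e01 e10 e11 Eb.
transitivity (a * (- (c * (q0 - p1)) - q * c0 + p * c1 - p * (c * G111) + q * (c * G101))); first by ring.
by rewrite f01 f11; ring.
Qed.

Lemma riemann_tensorE (g : pt -> 'M[R]_2) l i j k x : riemann_tensor g l i j k x =
  'D_'e_i (christoffel g l j k) x - 'D_'e_j (christoffel g l i k) x
  + ((christoffel g l i 0 x * christoffel g 0 j k x - christoffel g l j 0 x * christoffel g 0 i k x)
   + (christoffel g l i 1 x * christoffel g 1 j k x - christoffel g l j 1 x * christoffel g 1 i k x)).
Proof. by rewrite /riemann_tensor sum2. Qed.

Lemma gauss_curvature_det (g : pt -> 'M[R]_2) x : \det (g x) != 0 ->
  gauss_curvature g x * \det (g x) =
  riemann_tensor g 0 0 1 1 x * g x 0 0 + riemann_tensor g 1 0 1 1 x * g x 1 0.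
Proof. by move=> d0; rewrite /gauss_curvature divfK// sum2. Qed.

(** The pointwise content of [christoffel_coframe], with all derivatives as independent symbols, so
    that it is an identity of rational functions. *)
Lemma christoffel_algebra (a b c : R) (a' b' c' : 'I_2 -> R) (D : 'I_2 -> 'I_2 -> 'I_2 -> R) j k :
  a != 0 -> c != 0 ->
  (forall i, [/\ D i 0 0 = 2 * a * a' i, D i 0 1 = a * b' i + b * a' i,
     D i 1 0 = a * b' i + b * a' i & D i 1 1 = 2 * b * b' i + 2 * c * c' i]) ->
  let p := (b' 0 - a' 1) / c in let q := (c' 0 + p * b) / a in
  let h := mx2 ((b * b + c * c) / (a * a * (c * c))) (- b / (a * (c * c)))
               (- b / (a * (c * c))) (1 / (c * c)) in
  let G l := 2^-1 * (h l 0 * (D j k 0 + D k j 0 - D 0 j k) + h l 1 * (D j k 1 + D k j 1 - D 1 j k)) in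
  let w := if j == 0 then p else q in
  a * G 0 + b * G 1 = (if k == 0 then a' j else b' j) - w * (if k == 0 then 0 else c) /\
  c * G 1 = (if k == 0 then 0 else c' j) + w * (if k == 0 then a else b).
Proof.
move=> an cn DE /=; have [D00 D01 D0' D11] := DE 0; have [E00 E01 E0' E11] := DE 1.
rewrite !mxE /=; case: (ord2E j) => ->; case: (ord2E k) => -> /=;
  rewrite ?(D00, D01, D0', D11, E00, E01, E0', E11); split; field; rewrite ?an ?cn //.
Qed.

Section SmoothFunctions.
Variable V : set pt.
Hypothesis oV : open V.
Implicit Types f h : pt -> R.

Lemma smooth_derive f i : smooth V f -> smooth V ('D_'e_i f).
Proof. by move=> sf k; have [_] := Ck_S_elim (sf k.+1); exact. Qed.

Lemma smooth_mul f h : smooth V f -> smooth V h -> smooth V (fun x => f x * h x).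
Proof. by move=> sf sh k; apply: Ck_mul. Qed.

Lemma smooth_add f h : smooth V f -> smooth V h -> smooth V (fun x => f x + h x).
Proof. by move=> sf sh k; apply: Ck_add. Qed.

Lemma smooth_opp f : smooth V f -> smooth V (fun x => - f x).
Proof. by move=> sf k; apply: Ck_opp. Qed.

Lemma smooth_div f h : (forall x, V x -> h x != 0) -> smooth V f -> smooth V h ->
  smooth V (fun x => f x / h x).
Proof. by move=> h0 sf sh k; apply: Ck_mul => //; apply: Ck_inv => //; exact: sh. Qed.

Lemma is_derive_smooth f i x : V x -> smooth V f -> is_derive x 'e_i f ('D_'e_i f x).
Proof. by move=> Vx sf; have [d _] := Ck_S_elim (sf 1%N); exact: d. Qed.

End SmoothFunctions.

(* For the orthonormal coframe theta1 = a dx + b dy, theta2 = c dy, the form w determined by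
   d theta1 = w /\ theta2 and d theta2 = - w /\ theta1. *)
Definition connection_form (a b c : pt -> R) (i : 'I_2) : pt -> R :=
  let p x := ('D_'e_0 b x - 'D_'e_1 a x) / c x in
  if i == 0 then p else fun x => ('D_'e_0 c x + p x * b x) / a x.

Lemma connection_form_smooth V a b c i : open V -> smooth V a -> smooth V b -> smooth V c ->
  (forall x, V x -> a x != 0) -> (forall x, V x -> c x != 0) -> smooth V (connection_form a b c i).
Proof.
move=> oV sa sb sc a0 c0.
have sp : smooth V (fun x => ('D_'e_0 b x - 'D_'e_1 a x) / c x).
  apply: smooth_div => //; apply: smooth_add; [by []|exact: smooth_derive|].
  by apply: smooth_opp => //; exact: smooth_derive.
rewrite /connection_form; case: ifP => _ //; apply: smooth_div => //.
by apply: smooth_add; [by []|exact: smooth_derive|exact: smooth_mul].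
Qed.

Section Coframe.
Variables (V : set pt) (a b c : pt -> R) (g : pt -> 'M[R]_2).
Hypothesis oV : open V.
Hypotheses (sa : smooth V a) (sb : smooth V b) (sc : smooth V c).
Hypotheses (a0 : forall x, V x -> a x != 0) (c0 : forall x, V x -> c x != 0).
Hypothesis gE : forall x, V x -> g x = mx2 (a x * a x) (a x * b x) (a x * b x) (b x * b x + c x * c x).

Let p := connection_form a b c 0.
Let q := connection_form a b c 1.

Let sp : smooth V p. Proof. exact: connection_form_smooth. Qed.
Let sq : smooth V q. Proof. exact: connection_form_smooth. Qed.

Let w := connection_form a b c.
Let A0 (k : 'I_2) := if k == 0 then a else b.
Let A1 (k : 'I_2) : pt -> R := if k == 0 then (fun=> 0) else c.

(** [A0 k] and [A1 k] are the values of theta1 and theta2 on d_k, and the left sides are theta1 and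
    theta2 of the covariant derivative of d_k along d_j: w is the connection form of the coframe. *)
Lemma christoffel_coframe x j k : V x ->
  a x * christoffel g 0 j k x + b x * christoffel g 1 j k x = 'D_'e_j (A0 k) x - w j x * A1 k x /\
  c x * christoffel g 1 j k x = 'D_'e_j (A1 k) x + w j x * A0 k x.
Proof.
move=> Vx; have D i := gram_derive oV (sa 1%N) (sb 1%N) (sc 1%N) gE i Vx.
have D10 i : 'D_'e_i (fun _ : pt => (0 : R)) x = 0 by exact: (derive_cst (0 : R)).
have inv := invmx_gram (b x) (a0 Vx) (c0 Vx).
have [H1 H2] := @christoffel_algebra (a x) (b x) (c x) _ _ _ (fun i k l => 'D_'e_i (fun y => g y k l) x) j k (a0 Vx) (c0 Vx) D.
rewrite /christoffel !sum2 (gE Vx) inv /w /A0 /A1.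
split; [apply: (etrans H1)|apply: (etrans H2)]; rewrite /connection_form;
  by case: (ord2E k) => ->; case: (ord2E j) => -> /=; rewrite ?D10.
Qed.

(** Cartan's second structure equation dw = - K theta1 /\ theta2. Here det g = (a c)^2, whence the
    additional factor a c. *)
Lemma gauss_equation x : V x ->
  gauss_curvature g x * \det (g x) = - (a x * c x * ('D_'e_0 q x - 'D_'e_1 p x)).
Proof.
move=> Vx.
have sw i : smooth V (w i) by exact: connection_form_smooth.
have sA0 i : smooth V (A0 i) by rewrite /A0; case: ifP.
have sA1 i : smooth V (A1 i).
  by rewrite /A1; case: ifP => // _ k; exact: (@Ck_cst R R^o k V 0 oV).
(* Smoothness of the Christoffel symbols is read off from the coframe identities, solved for them,
   and not from the formula with the inverse matrix. *)
have sG1 j k : smooth V (christoffel g 1 j k).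
  have sr : smooth V (fun x => ('D_'e_j (A1 k) x + w j x * A0 k x) / c x).
    by apply: smooth_div => //; apply: smooth_add => //; [exact: smooth_derive|exact: smooth_mul].
  move=> l; apply: Ck_eq (sr l) => // y Vy; have [_ <-] := christoffel_coframe j k Vy.
  by rewrite mulrC mulKf// c0.
have sG0 j k : smooth V (christoffel g 0 j k).
  have sr : smooth V (fun x => ('D_'e_j (A0 k) x - w j x * A1 k x - b x * christoffel g 1 j k x) / a x).
    apply: smooth_div => //; apply: smooth_add => //; last by apply: smooth_opp => //; exact: smooth_mul.
    by apply: smooth_add => //; [exact: smooth_derive|apply: smooth_opp => //; exact: smooth_mul].
  move=> l; apply: Ck_eq (sr l) => // y Vy; have [<- _] := christoffel_coframe j k Vy.
  by rewrite addrK mulrC mulKf// a0.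
have dv (f : pt -> R) i := @is_derive_smooth V f i x Vx.
have NV : \forall y \near x, V y by exact: open_nbhs_nbhs.
(* The first coframe identity for k = 1 holds on a neighbourhood, so it may be differentiated in the
   direction i. *)
have deq i j : a x * 'D_'e_i (christoffel g 0 j 1) x + b x * 'D_'e_i (christoffel g 1 j 1) x =
    'D_'e_i ('D_'e_j b) x - (w j x * 'D_'e_i c x + c x * 'D_'e_i (w j) x)
    - ('D_'e_i a x * christoffel g 0 j 1 x + 'D_'e_i b x * christoffel g 1 j 1 x).
  have L := is_deriveD (is_deriveM (dv a i sa) (dv _ i (sG0 j 1))) (is_deriveM (dv b i sb) (dv _ i (sG1 j 1))).
  have Rr := is_deriveB (dv _ i (smooth_derive j sb)) (is_deriveM (dv _ i (sw j)) (dv c i sc)).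
  have LR : {near x, (a * christoffel g 0 j 1 + b * christoffel g 1 j 1) =1 ('D_'e_j b - w j * c)}.
    by apply: filterS NV => y Vy; have [] := christoffel_coframe j 1 Vy.
  have := near_eq_derive 'e_i LR; have [_ ->] := L; have [_ ->] := Rr.
  rewrite /GRing.scale /= => E.
  by rewrite -E; ring.
have Sb := Schwarz oV (sb 2%N) Vx.
have [e00 _] := christoffel_coframe 0 0 Vx; have [e01 f01] := christoffel_coframe 0 1 Vx.
have [e10 _] := christoffel_coframe 1 0 Vx; have [e11 f11] := christoffel_coframe 1 1 Vx.
have h1 := deq 0 1; have h2 := deq 1 0.
rewrite /A0 /A1 /= ?mulr0 ?subr0 in e00 e01 f01 e10 e11 f11 h1 h2.
have dn0 : \det (g x) != 0.
  rewrite det_mx2 (gE Vx) !mxE /=.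
  have -> : a x * a x * (b x * b x + c x * c x) - a x * b x * (a x * b x) = (a x * c x) * (a x * c x) by ring.
  by rewrite !mulf_neq0 ?a0 ?c0.
have g00 : g x 0 0 = a x * a x by rewrite (gE Vx) mxE.
have g10 : g x 1 0 = a x * b x by rewrite (gE Vx) mxE.
rewrite (gauss_curvature_det dn0) !riemann_tensorE g00 g10.
exact: (gauss_algebra Sb e00 e01 e10 e11 f01 f11 h1 h2).
Qed.

End Coframe.

Lemma gram_coef (a E F G s : R) : a != 0 -> a * a = E -> E != 0 -> s ^+ 2 = E * G - F * F ->
  F / a * (F / a) + s / a * (s / a) = G.
Proof.
move=> a0 aE E0 sE; have -> : F / a * (F / a) + s / a * (s / a) = (F * F + s ^+ 2) / (a * a) by field.
by rewrite sE aE; field.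
Qed.

Lemma rotate_gram (a b c C S : R) : C ^+ 2 + S ^+ 2 = 1 ->
  [/\ C * a * (C * a) + S * a * (S * a) = a * a,
      C * a * (C * b + - (S * c)) + S * a * (S * b + C * c) = a * b &
      (C * b + - (S * c)) * (C * b + - (S * c)) + (S * b + C * c) * (S * b + C * c) = b * b + c * c].
Proof.
move=> cs; split; rewrite -[RHS]mul1r -cs; ring.
Qed.

Lemma flat_isometry (g : pt -> 'M[R]_2) (x0 : pt) (r : R) :
  smooth (ball x0 r) g -> (forall x, ball x0 r x -> (g x)^T = g x) ->
  (forall x (v : pt), ball x0 r x -> v != 0 -> 0 < (v *m g x *m v^T) 0 0) ->
  (forall x, ball x0 r x -> gauss_curvature g x = 0) ->
  exists phi : pt -> pt, [/\ smooth (ball x0 r) phi,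
    forall x, ball x0 r x -> jdet phi x != 0 &
    forall x, ball x0 r x -> 'J phi x *m ('J phi x)^T = g x].
Proof.
set B := ball x0 r => sg symg posg flatg.
have oB : open B by exact: ball_open.
have g10 x : B x -> g x 1 0 = g x 0 1 by move=> /symg E; rewrite -[in LHS]E mxE.
have quad x (v : pt) : (v *m g x *m v^T) 0 0 =
    (v 0 0 * g x 0 0 + v 0 1 * g x 1 0) * v 0 0 + (v 0 0 * g x 0 1 + v 0 1 * g x 1 1) * v 0 1.
  by rewrite !mul_mx2E !mxE.
have E0 x : B x -> 0 < g x 0 0.
  move=> Bx; have v0 : row2 1 0 != 0 :> pt.
    by apply/eqP => /rowP/(_ 0); rewrite !mxE /= => /eqP; rewrite oner_eq0.
  by have := posg x _ Bx v0; rewrite quad !row2_0 !row2_1 !(mul1r, mul0r, addr0, mulr1, mulr0).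
have D0 x : B x -> 0 < g x 0 0 * g x 1 1 - g x 0 1 * g x 0 1.
  (* On this vector the quadratic form takes the value g_00 det g. *)
  move=> Bx; have v0 : row2 (- g x 0 1) (g x 0 0) != 0 :> pt.
    by apply/eqP => /rowP/(_ 1); rewrite !mxE /= => E; have := E0 x Bx; rewrite E ltxx.
  have := posg x _ Bx v0; rewrite quad !row2_0 !row2_1 (g10 x Bx).
  have -> : (- g x 0 1 * g x 0 0 + g x 0 0 * g x 0 1) * - g x 0 1 + (- g x 0 1 * g x 0 1 + g x 0 0 * g x 1 1) * g x 0 0
    = g x 0 0 * (g x 0 0 * g x 1 1 - g x 0 1 * g x 0 1) by ring.
  by rewrite pmulr_rgt0// E0.
have sgij i j k : Ck k B (fun x => g x i j) by apply: Ck_mxcoord => //; exact: sg.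
(* Cholesky factorisation of g: a dx + b dy and c dy form an orthonormal coframe. *)
pose a (x : pt) : R := Num.sqrt (g x 0 0).
pose b (x : pt) : R := g x 0 1 / a x.
pose c (x : pt) : R := Num.sqrt (g x 0 0 * g x 1 1 - g x 0 1 * g x 0 1) / a x.
have apos x : B x -> 0 < a x by move=> Bx; rewrite sqrtr_gt0 E0.
have cpos x : B x -> 0 < c x by move=> Bx; rewrite divr_gt0 ?apos// sqrtr_gt0 D0.
have an0 x : B x -> a x != 0 by move=> /apos/lt0r_neq0.
have cn0 x : B x -> c x != 0 by move=> /cpos/lt0r_neq0.
have sa : smooth B a by move=> k; apply: Ck_sqrt => //; exact: sgij.
have sb : smooth B b by move=> k; apply: Ck_mul => //; apply: Ck_inv => //; exact: sa.
have sc : smooth B c.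
  move=> k; apply: Ck_mul => //; last by apply: Ck_inv => //; exact: sa.
  by apply: Ck_sqrt => //; apply: Ck_sub2 => //; apply: Ck_mul => //; exact: sgij.
have gE x : B x -> g x = mx2 (a x * a x) (a x * b x) (a x * b x) (b x * b x + c x * c x).
  move=> Bx; have a2 : a x * a x = g x 0 0 by rewrite -expr2 sqr_sqrtr// ltW// E0.
  have ab : a x * b x = g x 0 1 by rewrite /b mulrC divfK// an0.
  have c2 : b x * b x + c x * c x = g x 1 1.
    have s2 := sqr_sqrtr (ltW (D0 x Bx)).
    exact: (gram_coef (an0 x Bx) a2 (lt0r_neq0 (E0 x Bx)) s2).
  by apply: mx2_eqP; rewrite !mxE /= ?a2 ?ab ?c2 ?g10.
pose w := connection_form a b c.
have sw i : smooth B (w i) by exact: connection_form_smooth.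
have closed_w x : B x -> 'D_'e_0 (w 1) x = 'D_'e_1 (w 0) x.
  move=> Bx; have := gauss_equation oB sa sb sc an0 cn0 gE Bx.
  rewrite flatg// mul0r => /esym/eqP; rewrite oppr_eq0 mulf_eq0.
  by rewrite (negPf (mulf_neq0 (an0 x Bx) (cn0 x Bx))) subr_eq0 => /eqP.
pose th := primitive x0 w.
have dth i x : B x -> is_derive x 'e_i th (w i x).
  by move=> Bx; exact: (primitiveP (fun j => sw j _) closed_w i Bx).
have sth : smooth B th.
  move=> k; apply: (@Ck_le _ _ _ k.+1) => //; apply: primitive_Ck => [j|x Bx|j]; try exact: sw.
  exact: closed_w.
have sct : smooth B (fun x => cos (th x)) by move=> k; have [] := Ck_cos_sin oB (sth k).
have sst : smooth B (fun x => sin (th x)) by move=> k; have [] := Ck_cos_sin oB (sth k).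
(* The coframe rotated by the angle th: cos th theta1 - sin th theta2 and sin th theta1 + cos th
   theta2. As dth = w, the structure equations cancel the rotation terms and both forms are
   closed. *)
pose eta (j i : 'I_2) : pt -> R :=
  if j == 0 then if i == 0 then (fun x => cos (th x) * a x) else (fun x => cos (th x) * b x + - (sin (th x) * c x))
  else if i == 0 then (fun x => sin (th x) * a x) else (fun x => sin (th x) * b x + cos (th x) * c x).
have seta j i : smooth B (eta j i).
  rewrite /eta; case: ifP => _; case: ifP => _.
  - exact: smooth_mul.
  - by apply: smooth_add => //; [exact: smooth_mul|apply: smooth_opp => //; exact: smooth_mul].
  - exact: smooth_mul.
  - by apply: smooth_add => //; exact: smooth_mul.
have dv (f : pt -> R) i x := @is_derive_smooth B f i x.
have closed_eta j x : B x -> 'D_'e_0 (eta j 1) x = 'D_'e_1 (eta j 0) x.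
  move=> Bx.
  have dc i := is_derive_comp1 (dth i x Bx) (is_derive_cos (th x)).
  have ds i := is_derive_comp1 (dth i x Bx) (is_derive_sin (th x)).
  have pE : w 0 x * c x = 'D_'e_0 b x - 'D_'e_1 a x by rewrite /w /connection_form /= divfK// cn0.
  have qE : w 1 x * a x = 'D_'e_0 c x + w 0 x * b x by rewrite {1}/w /connection_form /= divfK// an0.
  case: (ord2E j) => ->; rewrite /eta /=.
  - have L := is_deriveD (is_deriveM (dc 0) (dv b 0 x Bx sb)) (is_deriveN (is_deriveM (ds 0) (dv c 0 x Bx sc))).
    have Rr := is_deriveM (dc 1) (dv a 1 x Bx sa).
    have [_ LE] := L; have [_ RE] := Rr.
    apply: (etrans LE); apply: (etrans _ (esym RE)).
    rewrite /GRing.scale /=.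
    have e1 : 'D_'e_0 b x = w 0 x * c x + 'D_'e_1 a x by rewrite pE subrK.
    have e2 : 'D_'e_0 c x = w 1 x * a x - w 0 x * b x by rewrite qE addrK.
    by rewrite e1 e2; ring.
  - have L := is_deriveD (is_deriveM (ds 0) (dv b 0 x Bx sb)) (is_deriveM (dc 0) (dv c 0 x Bx sc)).
    have Rr := is_deriveM (ds 1) (dv a 1 x Bx sa).
    have [_ LE] := L; have [_ RE] := Rr.
    apply: (etrans LE); apply: (etrans _ (esym RE)).
    rewrite /GRing.scale /=.
    have e1 : 'D_'e_0 b x = w 0 x * c x + 'D_'e_1 a x by rewrite pE subrK.
    have e2 : 'D_'e_0 c x = w 1 x * a x - w 0 x * b x by rewrite qE addrK.
    by rewrite e1 e2; ring.
pose phi (x : pt) : pt := \row_j primitive x0 (eta j) x.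
have dphi i j x : B x -> is_derive x 'e_i (fun y => phi y 0 j) (eta j i x).
  move=> Bx; have -> : (fun y => phi y 0 j) = primitive x0 (eta j) by apply/funext => y; rewrite mxE.
  by apply: primitiveP Bx => //; [move=> l; exact: seta|exact: closed_eta].
have sphi : smooth B phi.
  move=> k; apply/Ck_row => // j.
  have -> : (fun y => phi y 0 j) = primitive x0 (eta j) by apply/funext => y; rewrite mxE.
  apply: (@Ck_le _ _ _ k.+1) => //; apply: primitive_Ck => [l|x Bx|l]; try exact: seta.
  exact: closed_eta.
have Dphi i j x : B x -> 'D_'e_i (fun y => phi y 0 j) x = eta j i x by move=> Bx; have [_ ->] := dphi i j x Bx.
exists phi; split => // x Bx.
  rewrite /jdet !Dphi// /eta /=.
  have -> : cos (th x) * a x * (sin (th x) * b x + cos (th x) * c x) -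
     sin (th x) * a x * (cos (th x) * b x + - (sin (th x) * c x)) = (cos (th x) ^+ 2 + sin (th x) ^+ 2) * (a x * c x) by ring.
  by rewrite cos2Dsin2 mul1r mulf_neq0 ?an0 ?cn0.
have JE i j : 'J phi x i j = eta j i x by rewrite (jacobianE i j oB (sphi 1%N) Bx) Dphi.
have cs := cos2Dsin2 (th x).
have [R00 R01 R11] := rotate_gram (a x) (b x) (c x) cs.
rewrite (gE x Bx); apply: mx2_eqP; rewrite mul_mx2E [(_^T) 0 _]mxE [(_^T) 1 _]mxE !JE [in RHS]mxE /eta /=.
- exact: R00.
- exact: R01.
- by rewrite ![_ * (_ * a x)]mulrC.
- exact: R11.
Qed.

End FlatMetric.

(** * Isometric charts *)

Section Charts.
Context {R : realType} {M : riemannian_surface R}.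
Local Notation pt := 'rV[R]_2.
Local Notation ch := (chart M pt).
Implicit Types (c d phi psi : ch) (x y v : pt).

Lemma overlap_open (X : topologicalType) (c d : chart X pt) : open (overlap c d).
Proof. by rewrite /overlap setIC; apply: chart_image_open; exact: chart_dom_open. Qed.

Lemma chart_invK (X : topologicalType) (c : chart X pt) x : chart_img c x ->
  chart_dom c (chart_inv c x) /\ chart_map c (chart_inv c x) = x.
Proof. by move=> [p dp <-]; rewrite chart_mapK// inE. Qed.

Lemma chart_mapK' (X : topologicalType) (c : chart X pt) p : chart_dom c p -> chart_inv c (chart_map c p) = p.
Proof. by move=> dp; rewrite chart_mapK// inE. Qed.

Lemma overlapP (X : topologicalType) (c d : chart X pt) x :
  overlap c d x <-> chart_img c x /\ chart_dom d (chart_inv c x).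
Proof.
split=> [[p [dc dd] <-]|[/chart_invK[dc E] dd]].
  by rewrite chart_mapK' //; split => //; exists p.
by exists (chart_inv c x).
Qed.

Lemma chart_map_cont (X : topologicalType) (c : chart X pt) p : chart_dom c p -> {for p, continuous (chart_map c)}.
Proof. by move=> dp; apply: chart_map_continuous; rewrite inE. Qed.

Lemma chart_inv_cont (X : topologicalType) (c : chart X pt) x : chart_img c x -> {for x, continuous (chart_inv c)}.
Proof. by move=> dp; apply: chart_inv_continuous; rewrite inE. Qed.

Lemma chart_preimage_open (X : topologicalType) (c : chart X pt) (V : set pt) : open V ->
  open (chart_dom c `&` chart_map c @^-1` V).
Proof.
move=> oV; rewrite openE => p [dp Vp]; apply: filterI.
  by apply: open_nbhs_nbhs; split => //; exact: chart_dom_open.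
by apply: chart_map_cont => //; exact: open_nbhs_nbhs.
Qed.

(** G is the Gram matrix of the metric in the coordinates of c1, which need not belong to the atlas.
    This treats atlas charts and isometric charts, where G is the identity, alike. *)
Definition compatible (G : pt -> 'M[R]_2) (c1 : ch) := forall c, rm_atlas c ->
  [/\ smooth (overlap c c1) (transition c c1), smooth (overlap c1 c) (transition c1 c) &
      forall x, overlap c c1 x -> rm_metric c x = pullback_metric (transition c c1) G x].

Lemma pullback_comp (tau h : pt -> pt) (G : pt -> 'M[R]_2) x :
  'J (h \o tau) x = 'J tau x *m 'J h (tau x) -> 'J h (tau x) *m ('J h (tau x))^T = G (tau x) ->
  pullback_metric (h \o tau) (cst 1%:M) x = pullback_metric tau G x.
Proof.
by rewrite /pullback_metric => -> <-; rewrite trmx_mul mulmx1 !mulmxA.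
Qed.

(** Besides flattening an atlas chart, this moves an isometric chart by an isometry of the plane
    and, with h = id, shrinks its domain. *)
Lemma post_isometric (G : pt -> 'M[R]_2) (c1 : ch) (V : set pt) (h h' : pt -> pt) :
  compatible G c1 -> open V -> V `<=` chart_img c1 -> smooth V h -> open (h @` V) ->
  smooth (h @` V) h' -> (forall x, V x -> h' (h x) = x) ->
  (forall x, V x -> 'J h x *m ('J h x)^T = G x) ->
  exists phi : ch, [/\ isometric_chart phi, chart_dom phi = chart_dom c1 `&` chart_map c1 @^-1` V,
    chart_map phi = h \o chart_map c1 & chart_inv phi = chart_inv c1 \o h'].
Proof.
move=> comp oV Vimg sh ohV sh' h'K Jh.
set D := chart_dom c1 `&` chart_map c1 @^-1` V.
have imgE : (h \o chart_map c1) @` D = h @` V.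
  apply/seteqP; split=> [_ [p [dp Vp] <-]|_ [x Vx <-]]; first by exists (chart_map c1 p).
  have [d1 e1] := chart_invK (Vimg x Vx).
  by exists (chart_inv c1 x); rewrite /= ?e1 //; split => //=; rewrite e1.
have oI : open ((h \o chart_map c1) @` D) by rewrite imgE.
have K : {in D, cancel (h \o chart_map c1) (chart_inv c1 \o h')}.
  by move=> p /set_mem[dp Vp]; rewrite /= h'K// chart_mapK'.
have cm : {in D, continuous (h \o chart_map c1)}.
  move=> p /set_mem[dp Vp]; apply: (@continuous_comp _ _ _ (chart_map c1) h p); first exact: chart_map_cont.
  exact: (Ck_cont (sh 0%N) Vp).
have ci : {in (h \o chart_map c1) @` D, continuous (chart_inv c1 \o h')}.
  rewrite imgE => y hy; have [x Vx xy] := set_mem hy.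
  apply: (@continuous_comp _ _ _ h' (chart_inv c1) y); first exact: (Ck_cont (sh' 0%N) (set_mem hy)).
  by apply: chart_inv_cont; rewrite -xy h'K//; exact: Vimg.
exists (Chart (chart_preimage_open c1 oV) oI K cm ci); split => //.
move=> c cA; have [s1 s2 mE] := comp c cA.
set phi := Chart _ _ _ _ _.
have ov1 x : overlap c phi x -> overlap c c1 x /\ V (transition c c1 x).
  by move=> /overlapP[ix [dx Vx]]; split => //; apply/overlapP.
have ov2 y : overlap phi c y -> (h @` V) y /\ overlap c1 c (h' y).
  move=> /overlapP[iy]; have [x Vx <-] : (h @` V) y by rewrite -imgE.
  rewrite /= h'K// => dx.
  by split; [exists x|apply/overlapP; split => //; exact: Vimg].
have oo1 : open (overlap c phi) := @overlap_open _ c phi.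
split.
- move=> k; apply: (@Ck_comp_row _ k _ V h (transition c c1)) => //.
  + by move=> x /ov1[].
  + by apply: Ck_sub (s1 k) => x /ov1[].
- move=> k; apply: (@Ck_comp_row _ k _ (overlap c1 c) (transition c1 c) h') => //.
  + exact: overlap_open.
  + exact: overlap_open.
  + by move=> y /ov2[].
  + by apply: Ck_sub (sh' k) => x /ov2[].
- move=> x ox; have [cx Vx] := ov1 x ox.
  apply: (etrans (mE x cx)); apply/esym.
  apply: (@pullback_comp (transition c c1) h G x); last exact: Jh.
  apply: (jacobian_comp oo1 oV) => //.
  by apply: Ck_sub (s1 1%N) => z /ov1[].
Qed.

Lemma atlas_compatible c1 : rm_atlas c1 -> compatible (rm_metric c1) c1.
Proof.
by move=> c1A c cA; split; [exact: rm_compat|exact: rm_compat|move=> x; exact: rm_metric_compat].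
Qed.

Lemma isometric_chart_exists : flat M -> forall q : M, exists2 phi : ch, isometric_chart phi & chart_dom phi q.
Proof.
move=> fM q; have [c cA dq] := rm_cover q; set x0 := chart_map c q.
have ix0 : chart_img c x0 by exists q.
have [r r0 Br] := open_ball_sub (chart_img_open c) ix0.
have [phi [sphi jd Jphi]] : exists phi : pt -> pt, [/\ smooth (ball x0 r) phi,
    forall x, ball x0 r x -> jdet phi x != 0 &
    forall x, ball x0 r x -> 'J phi x *m ('J phi x)^T = rm_metric c x].
  apply: flat_isometry.
  - by move=> k; apply: Ck_sub (rm_metric_smooth cA k) => x /Br.
  - by move=> x /Br ix; exact: rm_metric_sym.
  - by move=> x v /Br ix v0; exact: rm_metric_pos.
  - by move=> x /Br ix; exact: fM.
have [r' [C [r'0 C0 sub ex]]] := local_expansion (ball_open x0 r) (sphi 1%N) (ballxx x0 r0) (jd x0 (ballxx x0 r0)).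
have oV : open (ball x0 r') by exact: ball_open.
have inj x y : ball x0 r' x -> ball x0 r' y -> phi x = phi y -> x = y.
  move=> bx by_ E; apply/eqP; rewrite -subr_eq0 -normr_le0.
  by have := ex x y bx by_; rewrite E subrr normr0 mulr0.
pose psi (y : pt) : pt := xget 0 [set x | ball x0 r' x /\ phi x = y].
have psiK x : ball x0 r' x -> psi (phi x) = x.
  move=> bx; rewrite /psi; case: xgetP => [z _ [bz]|/(_ x)]; first exact: inj.
  by case; split.
have sphi' : smooth (ball x0 r') phi by move=> k; apply: Ck_sub (sphi k).
have jd' x : ball x0 r' x -> jdet phi x != 0 by move=> /sub/jd.
have [ph [iph dph _ _]] := @post_isometric (rm_metric c) c (ball x0 r') phi psi (atlas_compatible cA) oV
  (fun x bx => Br x (sub x bx)) sphi' (expanding_open oV (sphi' 1%N) jd' C0 ex oV (fun x h => h))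
  (inverse_smooth oV sphi' jd' C0 ex psiK) psiK (fun x bx => Jphi x (sub x bx)).
exists ph => //; rewrite dph; split => //; exact: ballxx.
Qed.

End Charts.

(** * Isometries of the plane *)

Section PlaneIsometries.
Context {R : realType}.
Local Notation pt := 'rV[R]_2.
Implicit Types (x y u v w : pt) (f g : pt -> pt).

Definition dot u v : R := u 0 0 * v 0 0 + u 0 1 * v 0 1.

Lemma dotE u v : dot u v = (u *m v^T) 0 0.
Proof. by rewrite mul_mx2E !mxE. Qed.

Lemma dotC u v : dot u v = dot v u.
Proof. by rewrite /dot mulrC [u 0 1 * _]mulrC. Qed.

Lemma dotDl u v w : dot (u + v) w = dot u w + dot v w.
Proof. by rewrite /dot !mxE; ring. Qed.

Lemma dotNl u v : dot (- u) v = - dot u v.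
Proof. by rewrite /dot !mxE; ring. Qed.

Lemma dotZl (a : R) u v : dot (a *: u) v = a * dot u v.
Proof. by rewrite /dot !mxE; ring. Qed.

Lemma dotZr (a : R) u v : dot v (a *: u) = a * dot v u.
Proof. by rewrite !(dotC v) dotZl. Qed.

Lemma dot_ge0 u : 0 <= dot u u.
Proof. by rewrite /dot -!expr2 addr_ge0 ?sqr_ge0. Qed.

Lemma dot_eq0 u : dot u u = 0 -> u = 0.
Proof.
rewrite /dot -!expr2 => /eqP; rewrite paddr_eq0 ?sqr_ge0// !sqrf_eq0 => /andP[/eqP e0 /eqP e1].
by apply: rowP2; rewrite mxE.
Qed.

Lemma cauchy_schwarz u v : dot u v ^+ 2 <= dot u u * dot v v.
Proof.
rewrite -subr_ge0; have -> : dot u u * dot v v - dot u v ^+ 2 = (u 0 0 * v 0 1 - u 0 1 * v 0 0) ^+ 2.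
  by rewrite /dot; ring.
exact: sqr_ge0.
Qed.

Lemma dot_norm u : dot u u <= 2 * `|u| ^+ 2.
Proof.
rewrite /dot -!expr2 -[u 0 0 ^+ 2]real_normK ?num_real// -[u 0 1 ^+ 2]real_normK ?num_real// mulr2n mulrDl !mul1r.
by apply: lerD; rewrite lerXn2r ?nnegrE ?coord_le.
Qed.

Lemma norm_dot u : `|u| ^+ 2 <= dot u u.
Proof.
have /orP[/eqP|/eqP] : (`|u| == `|u 0 0|) || (`|u| == `|u 0 1|).
  have [le|/ltW le] := leP `|u 0 0| `|u 0 1|; apply/orP; [right|left]; rewrite eq_le coord_le norm_row_le ?le ?lexx //.
- by move=> ->; rewrite real_normK ?num_real// /dot -!expr2 lerDl sqr_ge0.
- by move=> ->; rewrite real_normK ?num_real// /dot -!expr2 lerDr sqr_ge0.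
Qed.

Lemma dot_mulmx (L : 'M[R]_2) u v : L *m L^T = 1%:M -> dot (u *m L) (v *m L) = dot u v.
Proof.
by move=> LL; rewrite !dotE trmx_mul mulmxA -(mulmxA u) LL mulmx1.
Qed.

Lemma dot_sub_sq u v : dot (u - v) (u - v) = dot u u - 2 * dot u v + dot v v.
Proof. by rewrite /dot !mxE; ring. Qed.

Lemma dot_lincomb w (a b : R) u v : dot (w - (a *: u + b *: v)) (w - (a *: u + b *: v)) =
  dot w w - 2 * a * dot w u - 2 * b * dot w v + a ^+ 2 * dot u u + 2 * a * b * dot u v + b ^+ 2 * dot v v.
Proof. by rewrite /dot !mxE; ring. Qed.

Lemma sq_ratio (a b : R) : 0 <= a -> a ^+ 2 <= b * a -> a <= b \/ a = 0.
Proof.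
move=> a0 h; have [->|an0] := eqVneq a 0; [by right|left].
have ap : 0 < a by rewrite lt_neqAle eq_sym an0.
by rewrite -(ler_pM2r ap) -expr2.
Qed.

(** The mean value theorem for the scalar function <f z, w> with w = f y - f x gives |w|^2 = <(y -
    x) J, w>, and J preserves lengths; conclude by Cauchy-Schwarz. *)
Lemma orthogonal_jacobian_contracts x0 (r : R) f : Ck 1 (ball x0 r) f ->
  (forall x, ball x0 r x -> 'J f x *m ('J f x)^T = 1%:M) ->
  forall x y, ball x0 r x -> ball x0 r y -> dot (f y - f x) (f y - f x) <= dot (y - x) (y - x).
Proof.
move=> Cf Jf x y bx by_; set w := f y - f x.
have oB : open (ball x0 r) by exact: ball_open.
pose h (z : pt) : R := f z 0 0 * w 0 0 + f z 0 1 * w 0 1.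
have Cfj j : Ck 1 (ball x0 r) (fun z => f z 0 j) by move/Ck_row: Cf; apply.
have Ch : Ck 1 (ball x0 r) h.
  by apply: Ck_add => //; apply: Ck_mul => //; apply: (@Ck_cst R R^o).
have [s s01 E] := MVT_line oB Ch (fun s s01 => ball_segment bx by_ s01).
set z := x + s *: (y - x) in E.
have bz : ball x0 r z by exact: ball_segment.
have Dh i : 'D_'e_i h z = 'J f z i 0 * w 0 0 + 'J f z i 1 * w 0 1.
  rewrite !(jacobianE _ _ oB Cf bz).
  have [d0 _] := Ck_S_elim (Cfj 0); have [d1 _] := Ck_S_elim (Cfj 1).
  have D0 := is_deriveM (d0 i z bz) (is_derive_cst (w 0 0) z 'e_i).
  have D1 := is_deriveM (d1 i z bz) (is_derive_cst (w 0 1) z 'e_i).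
  have [_ ->] := is_deriveD D0 D1.
  by rewrite /GRing.scale /= !mulr0 !add0r [w 0 0 * _]mulrC [w 0 1 * _]mulrC.
have {}E : dot w w = dot ((y - x) *m 'J f z) w.
  rewrite -[dot w w]/(w 0 0 * w 0 0 + w 0 1 * w 0 1).
  transitivity (h (x + (y - x)) - h x).
    by rewrite subrKC /h {1 3}/w !mxE; ring.
  by rewrite E /grad_form !Dh /dot !mul_mx2E; ring.
have := cauchy_schwarz ((y - x) *m 'J f z) w; rewrite -E dot_mulmx ?Jf// => h2.
by case: (sq_ratio (dot_ge0 w) h2) => // ->; exact: dot_ge0.
Qed.

Definition isom g := exists L c, L *m L^T = 1%:M /\ forall x, g x = x *m L + c.

Lemma isom_id : isom id.
Proof. by exists 1%:M, 0; split=> [|x]; rewrite ?trmx1 ?mulmx1 ?addr0. Qed.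

Lemma isom_comp f g : isom f -> isom g -> isom (f \o g).
Proof.
move=> [L [c [LL fE]]] [L' [c' [LL' gE]]]; exists (L' *m L), (c' *m L + c); split.
  by rewrite trmx_mul mulmxA -(mulmxA L') LL mulmx1.
by move=> x; rewrite /= fE gE mulmxDl mulmxA addrA.
Qed.

Lemma isom_inv g : isom g -> exists g', [/\ isom g', cancel g g' & cancel g' g].
Proof.
move=> [L [c [LL gE]]]; have LL' : L^T *m L = 1%:M by exact: mulmx1C.
exists (fun x => x *m L^T + - (c *m L^T)); split=> [|x|x].
- by exists L^T, (- (c *m L^T)); rewrite trmxK.
- by rewrite gE mulmxDl -mulmxA LL mulmx1 addrK.
- by rewrite gE mulmxDl mulNmx -!mulmxA LL' !mulmx1 subrK.
Qed.

Lemma isom_dot g x y : isom g -> dot (g x - g y) (g x - g y) = dot (x - y) (x - y).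
Proof.
move=> [L [c [LL gE]]]; rewrite !gE.
by rewrite opprD addrACA subrr addr0 -mulmxBl dot_mulmx.
Qed.

Lemma isom_lipschitz g x y : isom g -> `|g x - g y| <= 2 * `|x - y|.
Proof.
move=> ig; have h := norm_dot (g x - g y); rewrite isom_dot// in h.
have h2 := le_trans h (dot_norm _).
rewrite -(@ler_pXn2r _ 2 isT `|g x - g y|) ?nnegrE ?mulr_ge0// exprMn.
by apply: le_trans h2 _; rewrite ler_wpM2r ?sqr_ge0// expr2 ler_peMr// ler1n.
Qed.

Lemma isom_segment g x y (s : R) : isom g -> g (x + s *: (y - x)) = g x + s *: (g y - g x).
Proof.
move=> [L [c [_ gE]]]; rewrite !gE mulmxDl -scalemxAl mulmxBl addrAC.
by rewrite opprD addrACA subrr addr0.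
Qed.

(* Affine maps preserve ratios along lines through x0, so their values near x0 determine them. *)
Lemma isom_eq f g x0 : isom f -> isom g -> {near x0, f =1 g} -> f = g.
Proof.
move=> jf jg /nbhs_normP[r /= r0 E]; apply/funext => x.
pose n := 2 * `|x - x0| / r + 1.
have n1 : 1 <= n by rewrite lerDr !mulr_ge0// invr_ge0 ltW.
have n0 : 0 < n by exact: lt_le_trans n1.
have E0 : f x0 = g x0 by apply: E; rewrite /= subrr normr0.
have Ey : f (x0 + n^-1 *: (x - x0)) = g (x0 + n^-1 *: (x - x0)).
  apply: E; rewrite /= opprD addNKr normrN normrZ ger0_norm ?invr_ge0 ?ltW// mulrC ltr_pdivrMr//.
  rewrite /n mulrDr mulr1 mulrCA mulfV ?lt0r_neq0// mulr1.
  by rewrite -subr_gt0 mulr_natl mulr2n addrAC addrK ltr_wpDl.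
have xE : x = x0 + n *: ((x0 + n^-1 *: (x - x0)) - x0).
  by rewrite addrAC subrr add0r scalerA mulfV ?lt0r_neq0// scale1r subrKC.
by rewrite xE (isom_segment _ _ _ jf) (isom_segment _ _ _ jg) Ey E0.
Qed.

Lemma ck_coord k (U : set pt) i : open U -> Ck k U (fun x : pt => x 0 i).
Proof.
move=> oU; case: k => [|k]; first by split=> // x _; exact: coord_continuous.
apply: (@Ck_S_intro _ _ _ _ _ (fun j => cst (('e_j : pt) 0 i))) => [//|x _|j x _|j].
- exact: coord_continuous.
- by have := is_derive_id x ('e_j : pt); rewrite -is_derive_row; exact.
- exact: (@Ck_cst R R^o).
Qed.

Lemma isom_smooth (U : set pt) g : open U -> isom g -> smooth U g.
Proof.
move=> oU [L [c [LL gE]]] k; apply/Ck_row => // j.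
have -> : (fun x => g x 0 j) = (fun x : pt => x 0 0 * L 0 j + x 0 1 * L 1 j + c 0 j).
  by apply/funext => x; rewrite gE mxE mul_mx2E.
apply: Ck_add => //; last exact: (@Ck_cst R R^o).
by apply: Ck_add => //; apply: Ck_mul => //; [exact: ck_coord|exact: (@Ck_cst R R^o)|exact: ck_coord|exact: (@Ck_cst R R^o)].
Qed.

Lemma isom_continuous g : isom g -> continuous g.
Proof. by move=> ig x; exact: (Ck_cont (isom_smooth openT ig 0%N) I). Qed.

Lemma isom_jacobian g x : isom g -> 'J g x *m ('J g x)^T = 1%:M.
Proof.
move=> [L [c [LL gE]]]; have ig : isom g by exists L, c.
suff -> : 'J g x = L by [].
have sg := isom_smooth openT ig.
apply: mx2_ext => i; apply/rowP => j.
have -> : (('e_i : pt) *m L) 0 j = L i j by rewrite -rowE mxE.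
have -> : (('e_i : pt) *m 'J g x) 0 j = 'J g x i j by rewrite -rowE mxE.
rewrite (jacobianE i j openT (sg 1%N) I).
have H : is_derive x 'e_i (fun x : pt => x 0 0 * L 0 j + x 0 1 * L 1 j + c 0 j) (L i j).
  have di l : is_derive x 'e_i (fun y : pt => y 0 l) (('e_i : pt) 0 l).
    by have := is_derive_id x ('e_i : pt); rewrite -is_derive_row; exact.
  have D l (a : R) := is_deriveM (di l) (is_derive_cst a x 'e_i).
  have T := is_deriveD (is_deriveD (D 0 (L 0 j)) (D 1 (L 1 j))) (is_derive_cst (c 0 j) x 'e_i).
  apply: is_derive_eq T _; rewrite /GRing.scale /= !mulr0 !add0r addr0 !mxE /=.
  by case: (ord2E i) => -> /=; rewrite ?mulr0 ?mulr1 ?addr0 ?add0r.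
have -> : (fun y => g y 0 j) = (fun x : pt => x 0 0 * L 0 j + x 0 1 * L 1 j + c 0 j).
  by apply/funext => y; rewrite gE mxE mul_mx2E.
by have [_ ->] := H.
Qed.

Lemma orthonormal_rows u v : dot u u = 1 -> dot v v = 1 -> dot u v = 0 ->
  let L := mx2 (u 0 0) (u 0 1) (v 0 0) (v 0 1) in L *m L^T = 1%:M.
Proof.
move=> uu vv uv L; apply: mx2_eqP; rewrite mul_mx2E !mxE /=.
- exact: uu.
- exact: uv.
- exact: (etrans (dotC v u) uv).
- exact: vv.
Qed.

Lemma polarize (a b c a' b' c' : R) : a = a' -> c = c' -> a - 2 * b + c = a' - 2 * b' + c' -> b = b'.
Proof. by move=> -> -> h; lra. Qed.

(** By polarisation f - f x0 preserves inner products. The images of two small orthogonal vectors,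
    rescaled, are an orthonormal basis in which f x - f x0 has the coordinates of x - x0. *)
Lemma distance_preserving_isom f x0 (r : R) : 0 < r ->
  (forall x y, ball x0 r x -> ball x0 r y -> dot (f x - f y) (f x - f y) = dot (x - y) (x - y)) ->
  exists2 g, isom g & forall x, ball x0 r x -> f x = g x.
Proof.
move=> r0 fd; have [e e0 er] : exists2 e : R, 0 < e & e < r.
  by exists (r / 2); [rewrite divr_gt0|rewrite ltr_pdivrMr// ltr_pMr// ltr1n].
have b0 : ball x0 r x0 by exact: ballxx.
pose G x := f x - f x0.
have dG x y : ball x0 r x -> ball x0 r y -> dot (G x) (G y) = dot (x - x0) (y - x0).
  move=> bx by_; have h1 := fd x y bx by_; have hx := fd x x0 bx b0; have hy := fd y x0 by_ b0.
  have GE : f x - f y = G x - G y by rewrite /G opprB addrA subrK.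
  have xyE : x - y = (x - x0) - (y - x0) by rewrite opprB addrA subrK.
  rewrite GE xyE (dot_sub_sq (G x)) (dot_sub_sq (x - x0)) in h1.
  exact: polarize hx hy h1.
pose p (i : 'I_2) : pt := x0 + e *: 'e_i.
have bp i : ball x0 r (p i).
  rewrite -ball_normE /= opprD addNKr normrN normrZ norm_delta_row mulr1 ger0_norm ?ltW//.
have px i : p i - x0 = e *: 'e_i by rewrite /p addrC addKr.
pose a i : pt := e^-1 *: G (p i).
have aa i j : dot (a i) (a j) = (i == j)%:R.
  rewrite /a dotZl dotZr dG ?bp// !px dotZl dotZr !mulrA.
  have -> : e^-1 / e * e * e = 1 by field; rewrite lt0r_neq0.
  by rewrite mul1r /dot !mxE; case: (ord2E i) => ->; case: (ord2E j) => -> /=; rewrite ?mulr0 ?mulr1 ?addr0 ?add0r.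
have Ga x i : ball x0 r x -> dot (G x) (a i) = (x - x0) 0 i.
  move=> bx; rewrite /a dotZr dG ?bp// px dotZr mulrA mulVf ?lt0r_neq0// mul1r /dot !mxE.
  by case: (ord2E i) => -> /=; rewrite ?mulr0 ?mulr1 ?addr0 ?add0r.
have GE x : ball x0 r x -> G x = (x - x0) 0 0 *: a 0 + (x - x0) 0 1 *: a 1.
  move=> bx; apply/eqP; rewrite -subr_eq0; apply/eqP/dot_eq0.
  rewrite dot_lincomb !aa !Ga// dG// /dot eqxx /=; ring.
pose L := mx2 (a 0 0 0) (a 0 0 1) (a 1 0 0) (a 1 0 1).
exists (fun x => x *m L + (f x0 - x0 *m L)).
  exists L, (f x0 - x0 *m L); split => //; apply: orthonormal_rows; by rewrite aa.
move=> x bx; rewrite addrCA -mulmxBl -[LHS](subrK (f x0)) -/(G x) addrC; congr (_ + _).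
rewrite GE//; apply: rowP2; rewrite mul_mx2E !mxE /=; ring.
Qed.

End PlaneIsometries.

(** * Local isometries *)

Section Development.
Context {R : realType} {M : riemannian_surface R}.
Local Notation pt := 'rV[R]_2.
Local Notation ch := (chart M pt).
Implicit Types (c d phi psi : ch) (x y v : pt) (F G : pt -> M) (g : pt -> pt) (U : set pt).

Lemma near_cont (T T' : topologicalType) (f : T -> T') (x : T) (y : T') (P : T' -> Prop) : {for x, continuous f} ->
  f x = y -> (\forall z \near y, P z) -> \forall z \near x, P (f z).
Proof. by move=> cf <- NP; exact: (cf _ NP). Qed.

Lemma near_ball x (r : R) : 0 < r -> \forall z \near x, ball x r z.
Proof. exact: nbhsx_ballx. Qed.

Lemma ball_of_near x (P : pt -> Prop) : (\forall z \near x, P z) ->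
  exists2 r : R, 0 < r & forall z, ball x r z -> P z.
Proof. by move=> /nbhs_ballP[r /= r0 H]; exists r. Qed.

Lemma pullback_cst1 (tau : pt -> pt) x : pullback_metric tau (cst 1%:M) x = 'J tau x *m ('J tau x)^T.
Proof. by rewrite /pullback_metric mulmx1. Qed.

Lemma orthogonal_quotient (A A' B C : 'M[R]_2) : A *m A^T = A' *m A'^T -> B *m A' = C ->
  C *m C^T = 1%:M -> (B *m A) *m (B *m A)^T = 1%:M.
Proof.
move=> E BA CC; rewrite trmx_mul mulmxA -(mulmxA B) E -CC -BA.
by rewrite trmx_mul !mulmxA.
Qed.

(** Isometric charts need not lie in the atlas, so the transition is factored locally through an
    atlas chart c, whose metric both charts pull back from the Euclidean one. *)
Lemma transition_orthogonal phi psi : isometric_chart phi -> isometric_chart psi ->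
  smooth (overlap phi psi) (transition phi psi) /\
  forall x, overlap phi psi x -> 'J (transition phi psi) x *m ('J (transition phi psi) x)^T = 1%:M.
Proof.
move=> iphi ipsi.
suff loc x : overlap phi psi x -> exists W, [/\ open W, W x, W `<=` overlap phi psi,
    smooth W (transition phi psi) & 'J (transition phi psi) x *m ('J (transition phi psi) x)^T = 1%:M].
  split=> [k|x /loc[W []]//]; apply: Ck_local => x /loc[W [_ Wx _ sW _]].
  by exists W => //; exact: sW.
move=> oxx; have /overlapP[ix dpsi] := oxx.
have [c cA dc] := rm_cover (chart_inv phi x).
have [_ s1 _] := iphi c cA; have [s2 _ m2] := ipsi c cA; have [s3 _ m3] := iphi c cA.
pose W := overlap phi psi `&` overlap phi c.
have oW : open W by apply: openI; exact: overlap_open.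
have Wx : W x by split => //; apply/overlapP.
have inW y : W y -> overlap c psi (transition phi c y) /\ transition phi psi y = transition c psi (transition phi c y).
  move=> [/overlapP[_ d1] /overlapP[_ d2]]; split; first by exists (chart_inv phi y).
  by rewrite /transition /= chart_mapK'.
have inW3 y : W y -> overlap c phi (transition phi c y) /\ transition c phi (transition phi c y) = y.
  move=> [/overlapP[iy d1] /overlapP[_ d2]]; have [d3 E] := chart_invK iy.
  by split; [exists (chart_inv phi y)|rewrite /transition /= chart_mapK'].
have sW1 k : Ck k W (transition phi c) by apply: Ck_sub (s1 k) => y [].
have oc d : open (overlap c d) by exact: overlap_open.
have sW k : Ck k W (transition c psi \o transition phi c).
  by apply: (@Ck_comp_row _ k _ (overlap c psi)) => // y /inW[].
have NW : \forall y \near x, W y by exact: open_nbhs_nbhs.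
exists W; split => //; first by move=> y [].
  by move=> k; apply: Ck_eq (sW k) => // y /inW[].
have JE : 'J (transition phi psi) x = 'J (transition phi c) x *m 'J (transition c psi) (transition phi c x).
  have [z1 _] := inW x Wx.
  rewrite -(jacobian_comp oW (oc psi) (sW1 1%N) (s2 1%N) Wx z1).
  apply/esym/near_eq_jacobian; first exact: (Ck1_differentiable oW (sW 1%N) Wx).
  by apply: filterS NW => y /inW[_] /esym.
have JI : 'J (transition phi c) x *m 'J (transition c phi) (transition phi c x) = 'J (@id pt) x.
  have [z1 _] := inW3 x Wx.
  rewrite -(jacobian_comp oW (oc phi) (sW1 1%N) (s3 1%N) Wx z1).
  apply/near_eq_jacobian.
    have sWi : Ck 1 W (transition c phi \o transition phi c).
      by apply: (@Ck_comp_row _ 1 _ (overlap c phi)) => // y /inW3[].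
    exact: (Ck1_differentiable oW sWi Wx).
  by apply: filterS NW => y /inW3[_].
have [z1 _] := inW x Wx; have [z2 _] := inW3 x Wx.
have E := etrans (esym (m2 _ z1)) (m3 _ z2); rewrite !pullback_cst1 in E.
by rewrite JE; apply: (orthogonal_quotient E JI); exact: isom_jacobian isom_id.
Qed.

(** The transition and its inverse both contract distances locally, so the transition preserves them
    and is affine near x. *)
Lemma transition_isom phi psi x y : isometric_chart phi -> isometric_chart psi ->
  chart_img phi x -> chart_img psi y -> chart_inv phi x = chart_inv psi y ->
  exists g, [/\ isom g, g x = y & \forall z \near x, chart_inv phi z = chart_inv psi (g z)].
Proof.
move=> iphi ipsi ix iy E.
have [dx ex] := chart_invK ix; have [dy ey] := chart_invK iy.
have ov1 : overlap phi psi x by apply/overlapP; rewrite E.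
have ov2 : overlap psi phi y by apply/overlapP; rewrite -E.
have [s1 J1] := transition_orthogonal iphi ipsi; have [s2 J2] := transition_orthogonal ipsi iphi.
have [r r0 br] := open_ball_sub (@overlap_open _ _ phi psi) ov1.
have [r' r'0 br'] := open_ball_sub (@overlap_open _ _ psi phi) ov2.
have tx : transition phi psi x = y by rewrite /transition /= E.
have near1 : \forall z \near x, ball x r z /\ ball y r' (transition phi psi z).
  apply: near_and (near_ball x r0) (near_cont (Ck_cont (s1 0%N) ov1) tx (near_ball y r'0)).
have [e e0 be] := ball_of_near near1.
have s1' : Ck 1 (ball x r) (transition phi psi) by exact: Ck_sub br (s1 1%N).
have s2' : Ck 1 (ball y r') (transition psi phi) by exact: Ck_sub br' (s2 1%N).
have back z : overlap phi psi z -> transition psi phi (transition phi psi z) = z.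
  by move=> /overlapP[iz dz]; have [d3 E3] := chart_invK iz; rewrite /transition /= chart_mapK'.
have [g ig gE] : exists2 g, isom g & forall z, ball x e z -> transition phi psi z = g z.
  apply: distance_preserving_isom => // u v /be[bu bu'] /be[bv bv'].
  apply/eqP; rewrite eq_le; apply/andP; split.
    exact: (orthogonal_jacobian_contracts s1' (fun z h => J1 z (br z h))).
  have := orthogonal_jacobian_contracts s2' (fun z h => J2 z (br' z h)) bv' bu'.
  by rewrite !back //; apply: br.
exists g; split => //; first by rewrite -gE//; exact: ballxx.
apply/nbhs_ballP; exists e => // z bz /=; rewrite -gE//.
have [/br/overlapP[_ dz] _] := be z bz.
by rewrite /transition /= chart_mapK'.
Qed.

(** F is a local isometry at x. It is a condition on the germ only, so F can be a total function
    with arbitrary values elsewhere. *)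
Definition dev F x := exists phi, [/\ isometric_chart phi, chart_img phi x & {near x, F =1 chart_inv phi}].

Lemma dev_chart phi x : isometric_chart phi -> chart_img phi x -> dev (chart_inv phi) x.
Proof. by move=> i ix; exists phi; split => //; apply: (@nearW _ (nbhs x)). Qed.

Lemma dev_eq F G x : {near x, F =1 G} -> dev F x -> dev G x.
Proof.
move=> FG [phi [iphi ix E]]; exists phi; split => //.
by apply: filterS2 FG E => y ->.
Qed.

Lemma dev_cont F x : dev F x -> {for x, continuous F}.
Proof.
move=> [phi [iphi ix E]]; apply: (@near_continuous _ _ (chart_inv phi)); last exact: chart_inv_cont.
by apply: filterS E => y ->.
Qed.

Lemma dev_near F x : dev F x -> \forall y \near x, dev F y.
Proof.
move=> [phi [iphi ix E]].
have N : \forall y \near x, chart_img phi y by apply: open_nbhs_nbhs; split => //; exact: chart_img_open.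
have E' := nbhs_interior E.
by apply: filterS2 N E' => y iy Ey; exists phi.
Qed.

Lemma dev_inj F x : dev F x -> exists2 r : R, 0 < r & forall y z, ball x r y -> ball x r z -> F y = F z -> y = z.
Proof.
move=> [phi [iphi ix E]].
have N : \forall y \near x, chart_img phi y by apply: open_nbhs_nbhs; split => //; exact: chart_img_open.
have [r r0 H] := ball_of_near (near_and N E).
exists r => // y z /H[iy ->] /H[iz ->] e.
by have [_ <-] := chart_invK iy; have [_ <-] := chart_invK iz; rewrite e.
Qed.

Lemma dev_open F U : open U -> (forall x, U x -> dev F x) -> open (F @` U).
Proof.
move=> oU dF; rewrite openE => _ [x Ux <-]; have [phi [iphi ix E]] := dF x Ux.
have N : \forall y \near x, U y by exact: open_nbhs_nbhs.
have [r r0 H] := ball_of_near (near_and N E).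
have [dx ex] := chart_invK ix.
have Fx : F x = chart_inv phi x by exact: nbhs_singleton E.
apply: (@filterS _ _ _ (chart_dom phi `&` chart_map phi @^-1` ball x r)).
  move=> p [dp bp]; have [Up Ep] := H _ bp; exists (chart_map phi p) => //.
  by rewrite Ep chart_mapK'.
apply: open_nbhs_nbhs; split; first by apply: chart_preimage_open; exact: ball_open.
by rewrite Fx; split => //=; rewrite ex; exact: ballxx.
Qed.

Lemma dev_germ F G x y : dev F x -> dev G y -> F x = G y ->
  exists g, [/\ isom g, g x = y & \forall z \near x, F z = G (g z)].
Proof.
move=> [phi [iphi ix E]] [psi [ipsi iy E']] e.
rewrite (nbhs_singleton E) (nbhs_singleton E') in e.
have [g [ig gx gE]] := transition_isom iphi ipsi ix iy e.
exists g; split => //.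
have E2 : \forall z \near x, G (g z) = chart_inv psi (g z).
  exact: (near_cont (@isom_continuous _ _ ig x) gx E').
by apply: filterS3 E gE E2 => z -> -> ->.
Qed.

Lemma dev_comp F g y : isom g -> dev F (g y) -> dev (F \o g) y.
Proof.
move=> ig [phi [iphi iy E]]; have [g' [ig' gK g'K]] := isom_inv ig.
have oI := chart_img_open phi.
have gI : g' @` chart_img phi = g @^-1` chart_img phi.
  apply/seteqP; split=> [_ [x ix <-] /=|x ix]; first by rewrite g'K.
  by exists (g x) => //; rewrite gK.
have oI' : open (g' @` chart_img phi).
  by rewrite gI; apply: open_comp => // x _; exact: isom_continuous.
have [phi' [iphi' dE mE invE]] := @post_isometric R M (cst 1%:M) phi (chart_img phi) g' g iphi oI
  (fun x h => h) (isom_smooth oI ig') oI' (isom_smooth oI' ig) (fun x _ => g'K x) (fun x _ => isom_jacobian x ig').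
exists phi'; split => //.
  have [d1 e1] := chart_invK iy; exists (chart_inv phi (g y)).
    by rewrite dE; split => //=; rewrite e1.
  by rewrite mE /= e1 gK.
rewrite invE; exact: (near_cont (@isom_continuous _ _ ig y) erefl E).
Qed.

(** Connectedness of [0, 1] as a rule of continuous induction. *)
Lemma segment_clopen (A : set R) : A 0 -> (forall s : R, A s -> \forall t \near s, A t) ->
  (forall s : R, 0 <= s <= 1 -> (forall V, nbhs s V -> exists t, V t /\ A t) -> A s) -> A 1.
Proof.
move=> A0 oA cA.
have H : `[0, 1]%classic `&` A = `[0, 1]%classic.
  apply: (@segment_connected R 0 1).
  - by exists 0; split => //=; rewrite in_itv /= lexx ler01.
  - by exists A => //; rewrite openE => s /oA.
  - exists (closure (`[0, 1]%classic `&` A)); first exact: closed_closure.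
    apply/seteqP; split=> [s [s01 As]|s [s01 cs]]; first by split => //; apply: subset_closure.
    split => //; apply: cA => [|V NV]; first by move: s01; rewrite /= in_itv.
    by have [t [[_ At] Vt]] := cs V NV; exists t.
have : (`[0, 1]%classic `&` A) 1 by rewrite H /= in_itv /= lexx ler01.
by case.
Qed.

Definition convex U := forall x y (s : R), U x -> U y -> 0 <= s <= 1 -> U (x + s *: (y - x)).

Lemma line_continuous x v : continuous (fun s : R => x + s *: v).
Proof. by move=> s; apply: cvgD; [exact: cvg_cst|apply: cvgZr_tmp; exact: cvg_id]. Qed.

(** Uniqueness of continuation along segments. At a limit point x the values agree because M is
    Hausdorff, so F = G o g near x for an isometry g; at nearby points where the germs agree, local
    injectivity of G gives g = id. *)
Lemma dev_uniq F G U x0 y : convex U -> (forall x, U x -> dev F x) -> (forall x, U x -> dev G x) ->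
  U x0 -> U y -> {near x0, F =1 G} -> {near y, F =1 G}.
Proof.
move=> cU dF dG Ux0 Uy E0.
pose ga (s : R) := x0 + s *: (y - x0).
have cga s : {for s, continuous ga} by exact: line_continuous.
pose A := [set s | {near ga s, F =1 G}].
have -> : y = ga 1 by rewrite /ga scale1r subrKC.
apply: (@segment_clopen A).
- by rewrite /A /= /ga scale0r addr0.
- by move=> s As; exact: (cga s _ (nbhs_interior As)).
move=> s s01 H; set x := ga s.
have Ux : U x by exact: cU.
have dFx := dF x Ux; have dGx := dG x Ux.
have eFG : F x = G x.
  apply: contrapT => nFG; have := @rm_hausdorff R M.
  rewrite open_hausdorff => /(_ (F x) (G x)); case; first by apply/eqP.
  move=> [P Q] /= [/set_mem Px /set_mem Qx] [oP oQ /eqP PQ].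
  have NP : \forall t \near s, P (F (ga t)).
    exact: (near_cont (cga s) erefl (near_cont (dev_cont dFx) erefl (open_nbhs_nbhs (conj oP Px)))).
  have NQ : \forall t \near s, Q (G (ga t)).
    exact: (near_cont (cga s) erefl (near_cont (dev_cont dGx) erefl (open_nbhs_nbhs (conj oQ Qx)))).
  have [t [[Pt Qt] At]] := H _ (near_and NP NQ).
  have := nbhs_singleton At; rewrite /= => e; rewrite e in Pt.
  by have : (P `&` Q) (G (ga t)) by []; rewrite PQ.
have [g [ig gx gE]] := dev_germ dFx dGx eFG.
have [r r0 inj] := dev_inj dGx.
have Nx : \forall z \near x, F z = G (g z) /\ (ball x r z /\ ball x r (g z)).
  exact: near_and gE (near_and (near_ball x r0) (near_cont (@isom_continuous _ _ ig x) gx (near_ball x r0))).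
have [t [Nt At]] := H _ (cga s _ (nbhs_interior Nx)).
have gid : g = id.
  apply: (@isom_eq R g id (ga t)) => //; first exact: isom_id.
  by apply: filterS2 Nt At => z [e1 [b1 b2]] e2; apply: inj => //; rewrite -e1.
by rewrite gid in gE.
Qed.

End Development.

(** * Piecewise C^1 paths *)

Section Paths.
Context {R : realType} {M : riemannian_surface R}.
Local Notation pt := 'rV[R]_2.
Local Notation ch := (chart M pt).
Local Notation path := (@piecewise_C1_path R M).
Local Notation leb := (@lebesgue_measure R).
Implicit Types (c phi psi : ch) (x y v w : pt) (F G : pt -> M) (U : set pt) (p q : M).

Lemma curve_length_ge0 c s : 0 <= curve_length c s.
Proof. by apply: Rintegral_ge0 => t _; exact: sqrtr_ge0. Qed.

Lemma path_ge0 p q L : path p q L -> 0 <= L.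
Proof. by elim=> // c s q' L' _ _ _ _ L0; rewrite addr_ge0 ?curve_length_ge0. Qed.

Lemma path_cat p q r L L' : path p q L -> path q r L' -> path p r (L + L').
Proof.
move=> pq; elim: pq r L' => [p' r L' h|c s q' L1 cA Cs s01 _ IH r L' h]; first by rewrite add0r.
by rewrite -addrA; apply: path_cons => //; exact: IH.
Qed.

Lemma rm_dist_le p q L : path p q L -> rm_dist p q <= L.
Proof. by move=> h; apply: ge_inf => //; exists 0 => L'; exact: path_ge0. Qed.

(** Its values stay in [0, 1] for every real t, so a segment reparametrised by it never leaves the
    disc where the charts are under control. *)
Definition ease (t : R) : R := (1 - cos (pi * t)) / 2.

Lemma is_derive_ease (t : R) : is_derive t 1 ease (pi * sin (pi * t) / 2).
Proof.
have h : is_derive t (1 : R) (fun t : R => pi * t) pi.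
  by have := is_deriveM (is_derive_cst (pi : R) t 1) (is_derive_id t (1 : R)) => H; apply: is_derive_eq H _; rewrite /GRing.scale /= mulr1 mulr0 addr0.
have h2 := is_derive_comp1 h (is_derive_cos (pi * t)).
have h3 := is_deriveM (is_deriveB (is_derive_cst (1 : R) t 1) h2) (is_derive_cst (2^-1 : R) t 1).
by apply: is_derive_eq h3 _; rewrite /GRing.scale /=; ring.
Qed.

Lemma ease_range t : 0 <= ease t <= 1.
Proof.
have := cos_le1 (pi * t); have := cos_geN1 (pi * t); rewrite /ease.
by move: (cos _) => k k1 k2; apply/andP; split; lra.
Qed.

Lemma ease0 : ease 0 = 0.
Proof. by rewrite /ease mulr0 cos0 subrr mul0r. Qed.

Lemma ease1 : ease 1 = 1.
Proof. by rewrite /ease mulr1 cospi opprK -mulr2n divff. Qed.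

Lemma sin_pi_ge0 (t : R) : 0 <= t <= 1 -> 0 <= pi * sin (pi * t) / 2.
Proof.
move=> /andP[t0 t1]; rewrite divr_ge0// mulr_ge0 ?pi_ge0// sin_ge0_pi// mulr_ge0 ?pi_ge0//=.
by rewrite ler_piMr ?pi_ge0.
Qed.

Lemma mulr_continuous (T : topologicalType) (f g : T -> R) (x : T) :
  {for x, continuous f} -> {for x, continuous g} -> {for x, continuous (fun z : T => f z * g z)}.
Proof. exact: (@continuousM _ _ f g x). Qed.

Lemma addr_continuous (T : topologicalType) (f g : T -> R) (x : T) :
  {for x, continuous f} -> {for x, continuous g} -> {for x, continuous (fun z : T => f z + g z)}.
Proof. exact: (@continuousD _ R^o _ f g x). Qed.

Definition len v : R := Num.sqrt (dot v v).

Lemma len_le v : len v <= 2 * `|v|.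
Proof.
rewrite /len -(ger0_norm (mulr_ge0 (ler0n R 2) (normr_ge0 v))) -sqrtr_sqr ler_wsqrtr//.
by apply: le_trans (dot_norm v) _; rewrite exprMn ler_wpM2r ?sqr_ge0// expr2 ler_peMr// ler1n.
Qed.

Lemma lenZ (a : R) v : 0 <= a -> len (a *: v) = a * len v.
Proof.
by move=> a0; rewrite /len dotZl dotZr mulrA sqrtrM ?mulr_ge0// -expr2 sqrtr_sqr ger0_norm.
Qed.

(* The straight segment is run through with vanishing speed at its ends, so that the curve is C^1 on the whole line. *)
Lemma local_segment F x : dev F x -> exists2 r : R, 0 < r &
  forall a b, ball x r a -> ball x r b -> path (F a) (F b) (len (b - a)).
Proof.
move=> [phi [iphi ix E]]; have [c cA dc] := rm_cover (chart_inv phi x).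
have ovx : overlap phi c x by apply/overlapP.
have No : \forall y \near x, overlap phi c y by apply: open_nbhs_nbhs; split => //; exact: overlap_open.
have [r r0 H] := ball_of_near (near_and No E).
exists r => // a b ba bb; set w := b - a.
have [s1 s2 mE] := iphi c cA.
pose B := ball x r; have oB : open B by exact: ball_open.
have sk : Ck 1 B (transition phi c) by apply: Ck_sub (s2 1%N) => z /H[].
pose y (t : R) : pt := a + ease t *: w.
have By t : B (y t) by apply: ball_segment => //; exact: ease_range.
have dy t : is_derive t (1 : R) y ((pi * sin (pi * t) / 2) *: w).
  apply/is_derive_row => j.
  have -> : (fun t => y t 0 j) = (fun t => a 0 j + ease t * w 0 j) by apply/funext => u; rewrite !mxE.
  have h := is_deriveD (is_derive_cst (a 0 j) t 1) (is_deriveM (is_derive_ease t) (is_derive_cst (w 0 j) t 1)).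
  by apply: is_derive_eq h _; rewrite /GRing.scale /= !mxE; ring.
pose s t := transition phi c (y t).
have Ckj j : Ck 1 B (fun z => transition phi c z 0 j) by move/Ck_row: sk; apply.
have ds t : is_derive t (1 : R) s (((pi * sin (pi * t) / 2) *: w) *m 'J (transition phi c) (y t)).
  apply/is_derive_row => j.
  have h := is_derive_chain (Ck1_is_diff oB (Ckj j) (By t)) (dy t).
  by apply: is_derive_eq h _; rewrite mul_mx2E /grad_form !(jacobianE _ _ oB sk (By t)).
have s'E t : derive1 s t = ((pi * sin (pi * t) / 2) *: w) *m 'J (transition phi c) (y t).
  by rewrite derive1E; have [_ ->] := ds t.
have csin (t : R) : {for t, continuous (fun u : R => pi * sin (pi * u) / 2)}.
  apply: mulr_continuous; last exact: cst_continuous.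
  apply: mulr_continuous; first exact: cst_continuous.
  apply: (@continuous_comp _ _ _ (fun u : R => pi * u) sin t); last exact: continuous_sin.
  by apply: mulr_continuous; [exact: cst_continuous|exact: cvg_id].
have Cs : C1_curve s.
  split=> [t|t]; first by have [] := ds t.
  apply: row_continuous => j.
  have -> : (fun t => derive1 s t 0 j) = (fun t => (pi * sin (pi * t) / 2) * w 0 0 * 'D_'e_0 (fun z => transition phi c z 0 j) (y t)
      + (pi * sin (pi * t) / 2) * w 0 1 * 'D_'e_1 (fun z => transition phi c z 0 j) (y t)).
    by apply/funext => u; rewrite s'E mul_mx2E !(jacobianE _ _ oB sk (By u)) !mxE.
  have cy : {for t, continuous y} by have [/derivable1_diffP D _] := dy t; exact: differentiable_continuous.
  have cD i : {for t, continuous (fun t => 'D_'e_i (fun z => transition phi c z 0 j) (y t))}.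
    apply: (@continuous_comp _ _ _ y ('D_'e_i (fun z => transition phi c z 0 j)) t) => //.
    by have [_ h] := Ck_S_elim (Ckj j); exact: (Ck_cont (h i) (By t)).
  by apply: addr_continuous; apply: mulr_continuous => //; apply: mulr_continuous => //; exact: cst_continuous.
have inc t : chart_img c (s t) /\ chart_inv c (s t) = F (y t).
  have [/overlapP[i1 d1] E1] := H _ (By t).
  by rewrite E1 /s /transition /= chart_mapK' //; split => //; exists (chart_inv phi (y t)).
have y0 : y 0 = a by rewrite /y ease0 scale0r addr0.
have y1 : y 1 = b by rewrite /y ease1 scale1r /w subrKC.
(* The metric of c is the Euclidean one pulled back by [transition c phi], which undoes
   [transition phi c]; the Jacobians cancel and the Euclidean speed remains. *)
have speed t : 0 <= t <= 1 -> Num.sqrt ((derive1 s t *m rm_metric c (s t) *m (derive1 s t)^T) 0 0) =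
    pi * sin (pi * t) / 2 * len w.
  move=> t01; have [/overlapP[i1 d1] E1] := H _ (By t).
  have ov : overlap c phi (s t) by have [d2 _] := chart_invK i1; exists (chart_inv phi (y t)).
  have back : {near y t, transition c phi \o transition phi c =1 id}.
    have N : \forall z \near y t, B z by apply: open_nbhs_nbhs.
    apply: filterS N => z Bz; have [/overlapP[i2 d2] _] := H _ Bz.
    by rewrite /transition /= chart_mapK' //; have [] := chart_invK i2.
  have JI : 'J (transition phi c) (y t) *m 'J (transition c phi) (s t) = 'J (@id pt) (y t).
    have oc := @overlap_open _ _ c phi.
    have Bo z : B z -> overlap c phi (transition phi c z).
      by move=> /H[/overlapP[i2 d2] _]; have [d3 _] := chart_invK i2; exists (chart_inv phi z).
    rewrite -(jacobian_comp oB oc sk (s1 1%N) (By t) (Bo _ (By t))).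
    apply: near_eq_jacobian back.
    have sb : Ck 1 B (transition c phi \o transition phi c) by exact: (Ck_comp_row oB oc Bo (s1 1%N) sk).
    exact: (Ck1_differentiable oB sb (By t)).
  rewrite s'E (mE _ ov) pullback_cst1 -lenZ ?sin_pi_ge0// /len.
  set v := _ *: w; congr Num.sqrt.
  set J1 := 'J _ _; set J2 := 'J _ _ in JI *.
  rewrite !mulmxA -mulmxA -trmx_mul -(mulmxA v) JI.
  by rewrite -dotE dot_mulmx //; exact: isom_jacobian isom_id.
have L : curve_length c s = len w.
  transitivity (\int[leb]_(t in `[0, 1]) (pi * sin (pi * t) / 2 * len w)).
    by apply: eq_Rintegral => t; rewrite inE /= in_itv /= => t01; exact: speed.
  have h (t : R) : 0 <= t <= 1 -> is_derive t (1 : R) (fun t => ease t * len w) (pi * sin (pi * t) / 2 * len w).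
    move=> _; have h := is_deriveM (is_derive_ease t) (is_derive_cst (len w) t 1).
    by apply: is_derive_eq h _; rewrite /GRing.scale /=; ring.
  have ct (t : R) : 0 <= t <= 1 -> {for t, continuous (fun t : R => pi * sin (pi * t) / 2 * len w)}.
    by move=> _; apply: mulr_continuous => //; exact: cst_continuous.
  by rewrite (Rint_FTC ltr01 h ct) ease0 ease1 mul1r mul0r subr0.
have := @path_cons _ M c s (chart_inv c (s 1)) 0 cA Cs (fun t _ => (inc t).1) (path_nil _).
by rewrite addr0 L (inc 0).2 (inc 1).2 y0 y1.
Qed.

(** Compactness of [0, 1] for properties of intervals that can be concatenated: a path is assembled
    from pieces each known to exist only locally. *)
Lemma cousin (P : R -> R -> Prop) :
  (forall s : R, 0 <= s <= 1 -> exists2 d : R, 0 < d & forall a b, s - d < a -> a <= b -> b < s + d -> 0 <= a -> b <= 1 -> P a b) ->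
  (forall a b c : R, a <= b -> b <= c -> P a b -> P b c -> P a c) -> P 0 1.
Proof.
move=> loc tr.
pose A (s : R) := forall t, 0 <= t -> t <= s -> t <= 1 -> P 0 t.
have P00 : P 0 0.
  have [d d0 H] := loc 0 (introT andP (conj (lexx 0) ler01)).
  by apply: H; rewrite ?lexx ?ler01 //; lra.
suff : A 1 by apply; rewrite ?ler01 ?lexx.
apply: (@segment_clopen _ A).
- by move=> t t0 t0' _; have -> : t = 0 by apply/eqP; rewrite eq_le t0 t0'.
- move=> s As; have [s0|s0] := ltP s 0.
    near=> u; move=> t t0 tu _; exfalso; suff : u < 0 by lra.
    by near: u; exact: lt_nbhsl.
  have [s1|s1] := ltP s 1; last first.
    by apply: (@nearW _ (nbhs s)) => u t t0 _ t1; apply: As => //; exact: le_trans s1.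
  have [d d0 H] := loc s (introT andP (conj s0 (ltW s1))).
  have N : \forall u \near s, ball s d u by exact: nbhsx_ballx.
  apply: filterS N => u; rewrite -ball_normE /= ltr_distlC => /andP[u1 u2] t t0 tu t1.
  have [ts|st] := leP t s; first exact: As.
  apply: (tr 0 s) => //; [exact: ltW|by apply: As => //; exact: ltW|by apply: H => //; lra].
- move=> s s01 H t t0 ts t1; have [d d0 Hd] := loc s s01.
  have [u [bu Au]] := H _ (nbhsx_ballx s d d0).
  move: bu; rewrite -ball_normE /= ltr_distlC => /andP[u1 u2].
  have [tu|ut] := leP t u; first exact: Au.
  have [u0|u0] := ltP u 0; first by apply: Hd => //; lra.
  by apply: (tr 0 u) => //; [exact: ltW|apply: Au => //; lra|apply: Hd => //; lra].
Unshelve. all: by end_near. Qed.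

Lemma segment_path F U x y : convex U -> (forall x, U x -> dev F x) -> U x -> U y ->
  path (F x) (F y) (len (y - x)).
Proof.
move=> cU dF Ux Uy; pose ga (s : R) := x + s *: (y - x).
have gaD (a b : R) : ga b - ga a = (b - a) *: (y - x).
  by rewrite /ga opprD addrACA subrr add0r scalerBl.
suff : path (F (ga 0)) (F (ga 1)) (len (ga 1 - ga 0)) by rewrite /ga scale0r addr0 scale1r subrKC.
apply: (cousin (P := fun a b => path (F (ga a)) (F (ga b)) (len (ga b - ga a)))); last first.
  move=> a b c ab bc h1 h2; have := path_cat h1 h2.
  by rewrite !gaD !lenZ ?subr_ge0 ?(le_trans ab bc)// -mulrDl addrC addrA subrK.
move=> s s01; have [r r0 H] := local_segment (dF _ (cU x y s Ux Uy s01)).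
have cga : {for s, continuous ga} by exact: line_continuous.
have N := near_cont cga erefl (near_ball (ga s) r0).
have /nbhs_ballP[d /= d0 Hd] := N.
exists d => // a b sa ab bs a0 b1.
by apply: H; apply: Hd; rewrite -ball_normE /= ltr_distlC; apply/andP; split; lra.
Qed.

End Paths.

(** * Distances and neighbourhoods *)

Section Bump.
Context {R : realType}.
Local Notation pt := 'rV[R]_2.
Implicit Types (x y v w : pt).

Lemma sq_pos_part_expansion (u h : R) :
  `|Num.max 0 (h + u) ^+ 2 - Num.max 0 u ^+ 2 - 2 * Num.max 0 u * h| <= h ^+ 2.
Proof.
by rewrite ler_norml; have [a|a] := leP 0 (h + u); have [b|b] := leP 0 u; apply/andP; split; nra.
Qed.

Lemma is_derive_sq_pos_part (u : R) :
  is_derive u (1 : R) (fun t => Num.max 0 t ^+ 2) (2 * Num.max 0 u).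
Proof.
set m := (fun t : R => Num.max 0 t ^+ 2).
have C : h^-1 *: ((m \o shift u) (h *: 1) - m u) @[h --> (0 : R)^'] --> 2 * Num.max 0 u.
  apply/cvgrPdist_le => e e0; near=> h.
  have h0 : h != 0 by near: h; exact: nbhs_dnbhs_neq.
  have he : `|h| <= e by near: h; apply: dnbhs0_le.
  apply: le_trans he; rewrite /= /shift /GRing.scale /= mulr1 /m.
  have -> : 2 * Num.max 0 u - h^-1 * (Num.max 0 (h + u) ^+ 2 - Num.max 0 u ^+ 2) =
     - (h^-1 * (Num.max 0 (h + u) ^+ 2 - Num.max 0 u ^+ 2 - 2 * Num.max 0 u * h)).
    by move: (Num.max _ _) (Num.max _ _) => a b; field.
  rewrite normrN normrM normfV mulrC ler_pdivrMr ?normr_gt0// -expr2.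
  by rewrite real_normK ?num_real// sq_pos_part_expansion.
apply: DeriveDef; first by apply/cvg_ex; exists (2 * Num.max 0 u).
by apply: cvg_lim C => //; exact: norm_hausdorff.
Unshelve. all: by end_near. Qed.

Definition depth x0 (e : R) x : R := e ^+ 2 - dot (x - x0) (x - x0).
(** The squared positive part is C^1, which is enough since only first derivatives are used; the
    support is a Euclidean disc of radius e. *)
Definition bump x0 (e : R) x : R := Num.max 0 (depth x0 e x) ^+ 2.
Definition bump_grad x0 (e : R) i x : R := - (4 * Num.max 0 (depth x0 e x) * (x - x0) 0 i).

Lemma is_derive_depth x0 (e : R) i x : is_derive x 'e_i (depth x0 e) (- (2 * (x - x0) 0 i)).
Proof.
have dj j : is_derive x 'e_i (fun y : pt => y 0 j - x0 0 j) (('e_i : pt) 0 j).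
  have h : is_derive x ('e_i : pt) (fun y : pt => y 0 j) (('e_i : pt) 0 j).
    by have := is_derive_id x ('e_i : pt); rewrite -is_derive_row; exact.
  by apply: is_derive_eq (is_deriveB h (is_derive_cst (x0 0 j) x 'e_i)) _; rewrite subr0.
have -> : depth x0 e = (fun y => e ^+ 2 - ((y 0 0 - x0 0 0) * (y 0 0 - x0 0 0) + (y 0 1 - x0 0 1) * (y 0 1 - x0 0 1))).
  by apply/funext => y; rewrite /depth /dot !mxE.
have T := is_deriveB (is_derive_cst (e ^+ 2) x 'e_i) (is_deriveD (is_deriveM (dj 0) (dj 0)) (is_deriveM (dj 1) (dj 1))).
apply: is_derive_eq T _; rewrite /GRing.scale /= !mxE /=.
by case: (ord2E i) => -> /=; ring.
Qed.

Lemma depth_continuous x0 (e : R) : continuous (depth x0 e).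
Proof.
move=> x; have D : is_diff x (depth x0 e) (grad_form ('D_'e_0 (depth x0 e) x) ('D_'e_1 (depth x0 e) x)).
  apply: C1_is_diff => i.
    by apply: (@nearW _ (nbhs x)) => y; have [] := is_derive_depth x0 e i y.
  have -> : 'D_'e_i (depth x0 e) = (fun x => -2 * (x 0 i - x0 0 i)).
    by apply/funext => y; have [_ ->] := is_derive_depth x0 e i y; rewrite !mxE mulNr.
  apply: mulr_continuous; first exact: cst_continuous.
  by apply: addr_continuous; [exact: coord_continuous|exact: cst_continuous].
by have [d _] := D; exact: differentiable_continuous.
Qed.

Lemma bump_Ck1 x0 (e : R) : Ck 1 setT (bump x0 e) /\
  forall i x, 'D_'e_i (bump x0 e) x = bump_grad x0 e i x.
Proof.
have D i x : is_derive x 'e_i (bump x0 e) (bump_grad x0 e i x).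
  have h := is_derive_comp1 (is_derive_depth x0 e i x) (is_derive_sq_pos_part (depth x0 e x)).
  by apply: is_derive_eq h _; rewrite /bump_grad; ring.
split; last by move=> i x; have [_ ->] := D i x.
have cm x : {for x, continuous (fun x => Num.max 0 (depth x0 e x))}.
  apply: (@continuous_max R _ (fun=> 0) (depth x0 e) x); first exact: cst_continuous.
  exact: depth_continuous.
have c0 x : setT x -> {for x, continuous (bump x0 e)}.
  have -> : bump x0 e = (fun x => Num.max 0 (depth x0 e x) * Num.max 0 (depth x0 e x)) by [].
  by move=> _; exact: mulr_continuous.
have c1 i : Ck 0 setT (bump_grad x0 e i).
  split=> // x _.
  have -> : bump_grad x0 e i = (fun x => (- 4 * Num.max 0 (depth x0 e x)) * (x 0 i - x0 0 i)).
    by apply/funext => y; rewrite /bump_grad !mxE !mulNr.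
  have k1 : {for x, continuous (fun x => - 4 * Num.max 0 (depth x0 e x))}.
    by apply: mulr_continuous; [exact: cst_continuous|exact: cm].
  have k2 : {for x, continuous (fun x : pt => x 0 i - x0 0 i)}.
    by apply: addr_continuous; [exact: coord_continuous|exact: cst_continuous].
  exact: (mulr_continuous k1 k2).
exact: (Ck_S_intro openT c0 (fun i x _ => D i x) c1).
Qed.

(** On the support [depth] is at most e^2 and x - x0 has Euclidean length at most e, whence the
    constant 4 e^3. *)
Lemma bump_grad_bound x0 (e : R) x w : 0 < e ->
  `|grad_form (bump_grad x0 e 0 x) (bump_grad x0 e 1 x) w| <= 4 * e ^+ 3 * len w.
Proof.
move=> e0; set k := Num.max 0 (depth x0 e x); set d := dot (x - x0) w.
have -> : grad_form (bump_grad x0 e 0 x) (bump_grad x0 e 1 x) w = - (4 * k * d).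
  by rewrite /grad_form /bump_grad -/k /d /dot; ring.
have [d0|d0] := leP (depth x0 e x) 0.
  have -> : k = 0 by apply/max_idPl.
  by rewrite mulr0 mul0r oppr0 normr0 !mulr_ge0 ?exprn_ge0 ?sqrtr_ge0// ltW.
have kE : k = depth x0 e x by apply/max_idPr; exact: ltW.
have xe : dot (x - x0) (x - x0) <= e ^+ 2 by rewrite ltW// -subr_gt0.
have ke : k <= e ^+ 2 by rewrite kE /depth gerBl dot_ge0.
have de : `|d| <= e * len w.
  rewrite -(@ler_pXn2r _ 2 isT `|d|) ?nnegrE ?mulr_ge0 ?sqrtr_ge0 ?(ltW e0)//.
  rewrite real_normK ?num_real// exprMn sqr_sqrtr ?dot_ge0//.
  by apply: le_trans (cauchy_schwarz _ _) _; rewrite ler_wpM2r ?dot_ge0.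
have k0 : 0 <= k by rewrite kE ltW.
have -> : `|- (4 * k * d)| = 4 * (k * `|d|).
  by rewrite normrN !normrM (ger0_norm (ler0n R 4)) (ger0_norm k0) mulrA.
have -> : 4 * e ^+ 3 * len w = 4 * (e ^+ 2 * (e * len w)) by ring.
by rewrite ler_pM2l ?ltr0n//; exact: ler_pM.
Qed.

Lemma bump_pos x0 (e : R) x : 0 < e -> 0 < bump x0 e x -> `|x - x0| < e.
Proof.
move=> e0; rewrite /bump => h; have d0 : 0 < depth x0 e x.
  by rewrite ltNge; apply/negP => d0; move: h; rewrite (max_idPl d0) expr0n /= ltxx.
rewrite -(@ltr_pXn2r _ 2 isT `|x - x0|) ?nnegrE// ?(ltW e0)//.
by apply: le_lt_trans (norm_dot _) _; rewrite -subr_gt0.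
Qed.

Lemma bump_center x0 (e : R) : bump x0 e x0 = e ^+ 4.
Proof.
rewrite /bump /depth subrr; have -> : dot 0 0 = 0 :> R by rewrite /dot !mxE mulr0 addr0.
by rewrite subr0 (max_idPr (sqr_ge0 e)) -exprM.
Qed.

End Bump.

Section DistanceTopology.
Context {R : realType} {M : riemannian_surface R}.
Local Notation pt := 'rV[R]_2.
Local Notation ch := (chart M pt).
Local Notation path := (@piecewise_C1_path R M).
Local Notation leb := (@lebesgue_measure R).
Implicit Types (c phi psi : ch) (x y v w : pt) (F G : pt -> M) (U : set pt) (p q : M).

Lemma speed_continuous c (s : R -> pt) (t : R) : rm_atlas c -> C1_curve s -> chart_img c (s t) ->
  {for t, continuous (fun t => Num.sqrt ((derive1 s t *m rm_metric c (s t) *m (derive1 s t)^T) 0 0))}.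
Proof.
move=> cA [ds cs] ist.
have cc j : {for t, continuous (fun t => derive1 s t 0 j)}.
  by apply: (@continuous_comp _ _ _ (derive1 s) (fun v : pt => v 0 j) t); [exact: cs|exact: coord_continuous].
have cst_ : {for t, continuous s} by apply: differentiable_continuous; apply/derivable1_diffP.
have cg i j : {for t, continuous (fun t => rm_metric c (s t) i j)}.
  apply: (@continuous_comp _ _ _ s (fun y => rm_metric c y i j) t) => //.
  have := Ck_mxcoord i j (chart_img_open c) (rm_metric_smooth cA 0%N) => h; exact: (Ck_cont h ist).
apply: (@continuous_comp _ _ _ _ (@Num.sqrt R) t); last exact: sqrt_continuous.
have -> : (fun t => (derive1 s t *m rm_metric c (s t) *m (derive1 s t)^T) 0 0) =
  (fun t => (derive1 s t 0 0 * rm_metric c (s t) 0 0 + derive1 s t 0 1 * rm_metric c (s t) 1 0) * derive1 s t 0 0 +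
     (derive1 s t 0 0 * rm_metric c (s t) 0 1 + derive1 s t 0 1 * rm_metric c (s t) 1 1) * derive1 s t 0 1).
  by apply/funext => u; rewrite !mul_mx2E !mxE.
by apply: addr_continuous; apply: mulr_continuous => //; apply: addr_continuous; apply: mulr_continuous.
Qed.

(* A C^1 function supported in a coordinate disc changes along a path by at most a constant times the
   length of the path, so a path that is short enough cannot leave the disc. *)
Section Growth.
Variables (psi : ch) (x0 : pt) (e : R).
Hypotheses (ipsi : isometric_chart psi) (e0 : 0 < e) (boxI : forall x, `|x - x0| <= e -> chart_img psi x).

Definition bump_at p : R := if `[< chart_dom psi p >] then bump x0 e (chart_map psi p) else 0.

Let K := chart_inv psi @` [set x | `|x - x0| <= e].

(** Compact sets are closed because M is Hausdorff. Hence [bump_at] vanishes near each point outside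
    the chart domain, and the extension by zero stays C^1 along curves. *)
Lemma bump_support_closed : closed K.
Proof.
apply: (compact_closed (@rm_hausdorff R M)).
apply: continuous_compact; last exact: box_compact.
by apply: continuous_in_subspaceT => x /set_mem /boxI; exact: chart_inv_cont.
Qed.

Lemma bump_at_outside p : ~ K p -> bump_at p = 0.
Proof.
rewrite /bump_at => nK; case: asboolP => // dp.
apply/eqP/negPn/negP => b0; apply: nK; exists (chart_map psi p); last exact: chart_mapK'.
have b1 : 0 < bump x0 e (chart_map psi p) by rewrite lt_neqAle eq_sym b0 sqr_ge0.
by apply/ltW; exact: bump_pos b1.
Qed.

Lemma bump_derive c (s : R -> pt) (t0 : R) : rm_atlas c -> C1_curve s -> chart_img c (s t0) ->
  exists D : R -> R, [/\ \forall t \near t0, is_derive t (1 : R) (fun t => bump_at (chart_inv c (s t))) (D t),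
    {for t0, continuous D} &
    `|D t0| <= 4 * e ^+ 3 * Num.sqrt ((derive1 s t0 *m rm_metric c (s t0) *m (derive1 s t0)^T) 0 0)].
Proof.
move=> cA [ds cs] ist.
have sc t : {for t, continuous s} by apply: differentiable_continuous; apply/derivable1_diffP.
have [dp|ndp] := pselect (chart_dom psi (chart_inv c (s t0))); last first.
  exists (fun=> 0); split; [|exact: cst_continuous|by rewrite normr0 !mulr_ge0 ?exprn_ge0 ?sqrtr_ge0// ltW].
  have nK : ~ K (chart_inv c (s t0)) by move=> [x /boxI/chart_invK[d _] E]; apply: ndp; rewrite -E.
  have NK : \forall p \near chart_inv c (s t0), ~ K p.
    by apply: open_nbhs_nbhs; split => //; apply: closed_openC bump_support_closed.
  have N := nbhs_interior (near_cont (sc t0) erefl (near_cont (chart_inv_cont ist) erefl NK)).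
  apply: filterS N => t Nt.
  have E : {near t, (fun=> 0) =1 (fun t => bump_at (chart_inv c (s t)))}.
    by apply: filterS Nt => u /bump_at_outside.
  exact: near_eq_is_derive E (is_derive_cst (0 : R) t 1).
have [s1 _ mE] := ipsi cA.
have oo := @overlap_open _ _ c psi.
have ov : overlap c psi (s t0) by apply/overlapP.
have No : \forall y \near s t0, overlap c psi y by apply: open_nbhs_nbhs.
have N := near_cont (sc t0) erefl No.
have [Cb Db] := bump_Ck1 x0 e.
have Ckj j : Ck 1 (overlap c psi) (fun z => transition c psi z 0 j) by have /Ck_row := s1 1%N; apply.
pose g t := transition c psi (s t).
pose D t := grad_form ('D_'e_0 (bump x0 e) (g t)) ('D_'e_1 (bump x0 e) (g t)) (derive1 s t *m 'J (transition c psi) (s t)).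
have dg t : overlap c psi (s t) -> is_derive t (1 : R) g (derive1 s t *m 'J (transition c psi) (s t)).
  move=> ot; apply/is_derive_row => j.
  have h1 : is_derive t (1 : R) s (derive1 s t) by apply: DeriveDef; [exact: ds|rewrite derive1E].
  have h := is_derive_chain (Ck1_is_diff oo (Ckj j) ot) h1.
  by apply: is_derive_eq h _; rewrite mul_mx2E /grad_form !(jacobianE _ _ oo (s1 1%N) ot).
exists D; split.
- apply: filterS (nbhs_interior N) => t Nt.
  have h := is_derive_chain (Ck1_is_diff openT Cb I) (dg t (nbhs_singleton Nt)).
  apply: near_eq_is_derive h; apply: filterS Nt => u /overlapP[iu du].
  by rewrite /bump_at asboolT.
- have cgt : {for t0, continuous g} by apply: (@continuous_comp _ _ _ s (transition c psi) t0); [exact: sc|exact: (Ck_cont (s1 0%N) ov)].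
  have cDb i : {for t0, continuous (fun t => 'D_'e_i (bump x0 e) (g t))}.
    apply: (@continuous_comp _ _ _ g ('D_'e_i (bump x0 e)) t0) => //.
    by have [_ h] := Ck_S_elim Cb; exact: (Ck_cont (h i) I).
  have cv j : {for t0, continuous (fun t => (derive1 s t *m 'J (transition c psi) (s t)) 0 j)}.
    apply: (@near_continuous _ _ (fun t => derive1 s t 0 0 * 'D_'e_0 (fun z => transition c psi z 0 j) (s t)
       + derive1 s t 0 1 * 'D_'e_1 (fun z => transition c psi z 0 j) (s t))).
      by apply: filterS N => t ot; rewrite mul_mx2E !(jacobianE _ _ oo (s1 1%N) ot).
    have cD i : {for t0, continuous (fun t => 'D_'e_i (fun z => transition c psi z 0 j) (s t))}.
      apply: (@continuous_comp _ _ _ s ('D_'e_i (fun z => transition c psi z 0 j)) t0); first exact: sc.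
      by have [_ h] := Ck_S_elim (Ckj j); exact: (Ck_cont (h i) ov).
    have cc k : {for t0, continuous (fun t => derive1 s t 0 k)}.
      by apply: (@continuous_comp _ _ _ (derive1 s) (fun v : pt => v 0 k) t0); [exact: cs|exact: coord_continuous].
    by apply: addr_continuous; apply: mulr_continuous.
  by rewrite /D /grad_form; apply: addr_continuous; apply: mulr_continuous.
- rewrite /D !Db; apply: le_trans (bump_grad_bound _ _ _ e0) _.
  rewrite ler_wpM2l ?mulr_ge0 ?exprn_ge0 ?(ltW e0)// /len (mE _ ov) pullback_cst1.
  by rewrite dotE trmx_mul !mulmxA.
Qed.

Lemma bump_growth c (s : R -> pt) : rm_atlas c -> C1_curve s -> (forall t, 0 <= t <= 1 -> chart_img c (s t)) ->
  `|bump_at (chart_inv c (s 1)) - bump_at (chart_inv c (s 0))| <= 4 * e ^+ 3 * curve_length c s.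
Proof.
move=> cA Cs sI; pose f t := bump_at (chart_inv c (s t)).
pose v (t : R) := Num.sqrt ((derive1 s t *m rm_metric c (s t) *m (derive1 s t)^T) 0 0).
have main (t : R) : 0 <= t <= 1 -> is_derive t (1 : R) f ('D_1 f t) /\ {for t, continuous ('D_1 f)} /\ `|'D_1 f t| <= 4 * e ^+ 3 * v t.
  move=> t01; have [D [ND cD bD]] := bump_derive cA Cs (sI t t01).
  have h := nbhs_singleton ND; have [h1 h2] := h.
  split; first by apply: is_derive_eq h _; rewrite h2.
  split; last by rewrite h2.
  apply: (@near_continuous _ _ D) => //.
  by apply: filterS ND => u [_ ->].
have F := Rint_FTC ltr01 (fun t t01 => (main t t01).1) (fun t t01 => (main t t01).2.1).
rewrite -/(f 1) -/(f 0) -F.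
have mI : measurable (`[0, 1] : set (measurableTypeR R)) by [].
have i1 := integrable_itv (fun t t01 => (main t t01).2.1).
have cv t : 0 <= t <= 1 -> {for t, continuous v} by move=> t01; apply: speed_continuous => //; exact: sI.
have iv := integrable_itv cv.
apply: le_trans (le_normr_Rintegral mI i1) _.
rewrite /curve_length -RintegralZl//.
apply: le_Rintegral => //.
- apply: integrable_itv => t t01; apply: (@continuous_comp _ _ _ ('D_1 f) (fun x : R => `|x|) t); first exact: (main t t01).2.1.
  exact: norm_continuous.
- by apply: integrable_itv => t t01; apply: mulr_continuous; [exact: cst_continuous|exact: cv].
- by move=> t; rewrite /= in_itv /= => t01; exact: (main t t01).2.2.
Qed.

Lemma bump_path p q L : path p q L -> `|bump_at q - bump_at p| <= 4 * e ^+ 3 * L.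
Proof.
elim=> [p'|c s q' L' cA Cs sI _ IH]; first by rewrite subrr normr0 mulr0.
have E : bump_at q' - bump_at (chart_inv c (s 0)) =
    (bump_at (chart_inv c (s 1)) - bump_at (chart_inv c (s 0))) + (bump_at q' - bump_at (chart_inv c (s 1))).
  by rewrite [RHS]addrC addrA subrK.
rewrite mulrDr E; apply: le_trans (ler_normD _ _) _.
exact: lerD (bump_growth cA Cs sI) IH.
Qed.

End Growth.

(** Compares path length with the topology of M. The bump function is e^4 at q and changes along a
    path by at most 4 e^3 times its length, so it is still positive at the other end of a path
    shorter than e / 4. *)
Lemma path_close psi q (r : R) : isometric_chart psi -> chart_dom psi q -> 0 < r ->
  exists2 e : R, 0 < e & forall p L, path p q L -> L < e ->
    chart_dom psi p /\ ball (chart_map psi q) r (chart_map psi p).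
Proof.
move=> ipsi dq r0; set x0 := chart_map psi q.
have ix0 : chart_img psi x0 by exists q.
have [r' r'0 br'] := open_ball_sub (chart_img_open psi) ix0.
have [e [e0 er er']] : exists e : R, [/\ 0 < e, e < r & e < r'].
  have m0 : 0 < Num.min r r' by rewrite lt_min r0.
  exists (Num.min r r' / 2); have h : Num.min r r' / 2 < Num.min r r' by rewrite ltr_pdivrMr// ltr_pMr// ltr1n.
  by split; [rewrite divr_gt0|apply: lt_le_trans h _; rewrite ge_min lexx|apply: lt_le_trans h _; rewrite ge_min lexx orbT].
have boxI x : `|x - x0| <= e -> chart_img psi x.
  by move=> h; apply: br'; rewrite -ball_normE /= distrC; exact: le_lt_trans er'.
exists (e / 4); first by rewrite divr_gt0.
move=> p L pL Le; have := bump_path ipsi e0 boxI pL.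
have -> : bump_at psi x0 e q = e ^+ 4 by rewrite /bump_at asboolT// bump_center.
move=> h.
have bp : 0 < bump_at psi x0 e p.
  have h2 : 4 * e ^+ 3 * L < e ^+ 4.
    have -> : e ^+ 4 = 4 * e ^+ 3 * (e / 4) by field.
    by rewrite ltr_pM2l// mulr_gt0// exprn_gt0.
  have := le_lt_trans (le_trans (ler_norm _) h) h2.
  by rewrite ltrBlDr -[ltLHS]addr0 ltrD2l.
have dp : chart_dom psi p by move: bp; rewrite /bump_at; case: asboolP => //; rewrite ltxx.
split => //; move: bp; rewrite /bump_at asboolT// => /(bump_pos e0) h1.
by rewrite -ball_normE /= distrC; exact: lt_trans er.
Qed.

(** [rm_dist] is an infimum, and a small value yields a short path only when some path exists. *)
Lemma path_connected (fM : flat M) p q : exists L, path p q L.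
Proof.
have loc p1 : \forall p2 \near p1, (exists L, path p1 p2 L) /\ (exists L, path p2 p1 L).
  have [phi iphi d1] := isometric_chart_exists fM p1.
  have i1 : chart_img phi (chart_map phi p1) by exists p1.
  have [r r0 H] := local_segment (dev_chart iphi i1).
  have N : \forall p2 \near p1, (chart_dom phi `&` chart_map phi @^-1` ball (chart_map phi p1) r) p2.
    apply: open_nbhs_nbhs; split; first by apply: chart_preimage_open; exact: ball_open.
    by split => //=; exact: ballxx.
  apply: filterS N => p2 [d2 b2].
  have b1 : ball (chart_map phi p1) r (chart_map phi p1) by exact: ballxx.
  by split; [have := H _ _ b1 b2|have := H _ _ b2 b1]; rewrite !chart_mapK' //; eexists; eassumption.
suff : [set p' | exists L, path p' q L] = setT by move=> /seteqP[_ /(_ p I)].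
apply: connected_clopen; first exact: rm_connected.
- rewrite openE => p1 [L h]; apply: filterS (loc p1) => p2 [_ [L' h']].
  by exists (L' + L); exact: path_cat h' h.
- move=> p1 cl; have [p2 [[L h] [[L' h'] _]]] := cl _ (loc p1).
  by exists (L' + L); exact: path_cat h' h.
- by exists q; exists 0; exact: path_nil.
Qed.

End DistanceTopology.

(** * The developing map *)

Section DevelopingMap.
Context {R : realType} {M : riemannian_surface R}.
Local Notation pt := 'rV[R]_2.
Local Notation ch := (chart M pt).
Local Notation path := (@piecewise_C1_path R M).
Hypotheses (fM : flat M) (cM : complete_metric M).
Implicit Types (c phi psi : ch) (x y z v w : pt) (F G : pt -> M) (U : set pt) (p q : M).

Lemma convex_ball x (r : R) : convex (ball x r).
Proof. by move=> y z s by_ bz s01; exact: ball_segment. Qed.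

Lemma convexI U V : convex U -> convex V -> convex (U `&` V).
Proof. by move=> cU cV x y s [Ux Vx] [Uy Vy] s01; split; [exact: cU|exact: cV]. Qed.

Lemma in_ball x (r : R) y : ball x r y = (`|y - x| < r) :> Prop.
Proof. by rewrite -ball_normE /= distrC. Qed.

(** Where completeness enters. The images of points tending to x radially form a Cauchy sequence
    with a limit q, and a chart at q covers the images of all y near x with room to spare. Hence the
    germ of F at each such y extends to a ball of a radius independent of y. *)
Lemma closest_chart F x (s : R) : 0 < s -> (forall x, ball 0 s x -> dev F x) -> `|x| <= s ->
  exists r e : R, [/\ 0 < r, 0 < e & forall y, ball x r y -> ball 0 s y ->
    exists G, (forall z, ball y e z -> dev G z) /\ {near y, G =1 F}].
Proof.
move=> s0 dF xs.
(* The offset 2 keeps the factor strictly between 0 and 1, so that Y n lies in the open ball even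
   when |x| = s. *)
pose Y (n : nat) : pt := (1 - n.+2%:R^-1) *: x.
have inv01 n : 0 < (n.+2%:R^-1 : R) < 1 by rewrite invr_gt0 ltr0n /= invf_lt1 ?ltr0n// ltr1n.
have YI n : ball 0 s (Y n).
  have /andP[i0 i1] := inv01 n.
  rewrite in_ball subr0 /Y normrZ ger0_norm ?subr_ge0 ?(ltW i1)//.
  have [->|x0] := eqVneq x 0; first by rewrite normr0 mulr0.
  by apply: lt_le_trans xs; rewrite gtr_pMl ?normr_gt0// gtrBl.
have Yx (e : R) : 0 < e -> exists N, forall n, (N <= n)%N -> `|Y n - x| < e.
  move=> e0; have [N HN] : exists N : nat, s / e < N%:R.
    by exists (Num.bound (s / e)); apply: archi_boundP; rewrite divr_ge0 // ltW.
  exists N => n Nn; have /andP[i0 i1] := inv01 n.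
  rewrite /Y scalerBl scale1r addrAC subrr sub0r normrN normrZ ger0_norm ?(ltW i0)//.
  rewrite mulrC ltr_pdivrMr ?ltr0n//; apply: le_lt_trans xs _.
  rewrite -ltr_pdivrMl// mulrC; apply: lt_le_trans HN _.
  by rewrite ler_nat (leq_trans Nn)// -addn2 leq_addr.
have cB := @convex_ball 0 s.
have pathF y z : ball 0 s y -> ball 0 s z -> path (F y) (F z) (len (z - y)).
  by move=> by_ bz; exact: (segment_path cB dF).
have [q Hq] : exists q, forall e : R, 0 < e -> exists N, forall n, (N <= n)%N -> rm_dist (F (Y n)) q < e.
  apply: cM => e e0; have [N HN] := Yx (e / 4) (divr_gt0 e0 (ltr0Sn _ _)).
  exists N => m n Nm Nn; apply: le_lt_trans (rm_dist_le (pathF _ _ (YI m) (YI n))) _.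
  apply: le_lt_trans (len_le _) _.
  have -> : Y n - Y m = (Y n - x) - (Y m - x) by rewrite opprB addrA subrK.
  have h := ler_normB (Y n - x) (Y m - x).
  by have h1 := HN m Nm; have h2 := HN n Nn; lra.
have [psi ipsi dq] := isometric_chart_exists fM q.
have iq : chart_img psi (chart_map psi q) by exists q.
have [rho rho0 brho] := open_ball_sub (chart_img_open psi) iq.
have [e e0 He] := path_close ipsi dq (divr_gt0 rho0 (ltr0Sn _ 3) : 0 < rho / 4).
have [N1 H1] := Hq (e / 2) (divr_gt0 e0 (ltr0Sn _ 1)).
have [N2 H2] := Yx (e / 16) (divr_gt0 e0 (ltr0Sn _ 15)).
pose n := maxn N1 N2.
have d1 := H1 n (leq_maxl _ _); have d2 := H2 n (leq_maxr _ _).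
have [L pL Le] := inf_lt (path_connected fM (F (Y n)) q) d1.
(* With the factor 2 from [len_le], the segment from y to Y n has length below e / 4 and joins a
   path shorter than e / 2, in total less than e. With the factor 2 from [isom_lipschitz], g z stays
   within 2 (rho / 8) + rho / 4 < rho of the image of q. *)
exists (e / 16), (rho / 8); split; [by rewrite divr_gt0|by rewrite divr_gt0|].
move=> y; rewrite in_ball => yx ys.
have [dy by_] : chart_dom psi (F y) /\ ball (chart_map psi q) (rho / 4) (chart_map psi (F y)).
  apply: He (path_cat (pathF _ _ ys (YI n)) pL) _.
  have -> : Y n - y = (Y n - x) - (y - x) by rewrite opprB addrA subrK.
  have h := ler_normB (Y n - x) (y - x); have h' := len_le ((Y n - x) - (y - x)).
  by lra.
have iy : chart_img psi (chart_map psi (F y)) by exists (F y).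
have [g [ig gy gE]] := dev_germ (dF y ys) (dev_chart ipsi iy) (esym (chart_mapK' dy)).
exists (chart_inv psi \o g); split; last by apply: filterS gE => z ->.
move=> z bz; apply: dev_comp => //; apply: dev_chart => //; apply: brho.
move: bz by_; rewrite !in_ball => bz by_; rewrite -gy in by_.
have -> : g z - chart_map psi q = (g z - g y) + (g y - chart_map psi q) by rewrite addrA subrK.
have h := ler_normD (g z - g y) (g y - chart_map psi q); have h' := isom_lipschitz z y ig.
by lra.
Qed.

(** Compactness of the closed box makes the radius uniform; therefore [closest_chart] admits
    boundary points x. *)
Lemma uniform_charts F (s : R) : 0 < s -> (forall x, ball 0 s x -> dev F x) ->
  exists2 d : R, 0 < d & forall y, ball 0 s y ->
    exists G, (forall z, ball y d z -> dev G z) /\ {near y, G =1 F}.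
Proof.
move=> s0 dF.
have /compact_near_coveringP cK := @box_compact R 0 s.
have := cK R (0 : R)^'+ (fun (d : R) y => ball 0 s y ->
    exists G, (forall z, ball y d z -> dev G z) /\ {near y, G =1 F}).
case.
  move=> x /=; rewrite subr0 => xs; have [r [e [r0 e0 H]]] := closest_chart s0 dF xs.
  exists (ball x r, [set d : R | d <= e]).
    by split => /=; [exact: near_ball|exact: nbhs_right_le].
  move=> [y d] /= [by_ de] ys; have [G [dG E]] := H y by_ ys.
  by exists G; split => // z bz; apply: dG; exact: le_ball de _ bz.
move=> e /= e0 H; exists (e / 2); first by rewrite divr_gt0.
move=> y ys; have [] := H (e / 2) _ _ y.
- by rewrite /= sub0r normrN ger0_norm ?ltr_pdivrMr ?ltr_pMr ?ltr1n// divr_ge0// ltW.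
- by rewrite /= divr_gt0.
- by rewrite /= subr0 ltW//; move: ys; rewrite in_ball subr0.
- by [].
- by move=> G HG; exists G.
Qed.

Lemma dev_agree F G U x0 y : convex U -> (forall x, U x -> dev F x) -> (forall x, U x -> dev G x) ->
  U x0 -> U y -> {near x0, F =1 G} -> F y = G y.
Proof. by move=> cU dF dG U0 Uy E; exact: (nbhs_singleton (dev_uniq cU dF dG U0 Uy E)). Qed.

(* The extension at z is the germ of F at the nearby point s / (s + d / 2) *: z, which lies in the ball
   where F is already given. *)
Lemma dev_enlarge F (s : R) : 0 < s -> (forall x, ball 0 s x -> dev F x) ->
  exists s' F', [/\ s < s', forall x, ball 0 s' x -> dev F' x & {near (0 : pt), F' =1 F}].
Proof.
move=> s0 dF; have [d d0 H] := uniform_charts s0 dF.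
have H' y : exists Gy, ball 0 s y -> (forall z, ball y d z -> dev Gy z) /\ {near y, Gy =1 F}.
  by have [/H[Gy h]|ny] := pselect (ball 0 s y); [exists Gy|exists F].
have [G HG] := choice H'.
have h0 : 0 < s + d / 2 by rewrite addr_gt0// divr_gt0.
pose la := s / (s + d / 2).
have la0 : 0 < la by rewrite divr_gt0.
have la1 : la * (s + d / 2) = s by rewrite /la divfK// lt0r_neq0.
have cI z : ball 0 (s + d / 2) z -> ball 0 s (la *: z).
  by rewrite !in_ball !subr0 => h; rewrite normrZ ger0_norm ?(ltW la0)// -la1 ltr_pM2l.
have la_le : la <= 1 by rewrite ler_pdivrMr// mul1r lerDl divr_ge0// ltW.
have cz z : ball 0 (s + d / 2) z -> ball (la *: z) d z.
  rewrite !in_ball subr0 => h.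
  have -> : z - la *: z = (1 - la) *: z by rewrite scalerBl scale1r.
  rewrite normrZ ger0_norm ?subr_ge0//.
  have E : (1 - la) * (s + d / 2) = d / 2 by rewrite mulrBl mul1r la1 addrAC subrr add0r.
  have h2 : (1 - la) * `|z| <= (1 - la) * (s + d / 2) by rewrite ler_wpM2l ?subr_ge0// ltW.
  by rewrite E in h2; lra.
have agreeF y z : ball 0 s y -> ball y d z -> ball 0 s z -> {near z, G y =1 F}.
  move=> ys bz zs; have [dG E] := HG y ys.
  apply: (@dev_uniq _ _ (G y) F (ball 0 s `&` ball y d) y z) => //.
  - by apply: convexI; exact: convex_ball.
  - by move=> x [_]; exact: dG.
  - by move=> x [+ _]; exact: dF.
  - by split => //; exact: ballxx.
exists (s + d / 2), (fun z => G (la *: z) z); split; first by rewrite ltrDl divr_gt0.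
  move=> z zs; have [dG E] := HG _ (cI z zs).
  apply: (dev_eq _ (dG z (cz z zs))).
  have cla : {for z, continuous (fun z : pt => la *: z)}.
    apply: row_continuous => j.
    have -> : (fun y : pt => (la *: y) 0 j) = (fun y => la * y 0 j) by apply/funext => y; rewrite mxE.
    by apply: mulr_continuous; [exact: cst_continuous|exact: coord_continuous].
  have N0 : \forall u \near z, ball 0 (s + d / 2) u by apply: open_nbhs_nbhs; split => //; exact: ball_open.
  have N1 := near_cont cla erefl (near_ball (la *: z) d0).
  have N2 : \forall u \near z, ball (la *: z) d u by apply: open_nbhs_nbhs; split; [exact: ball_open|exact: cz].
  apply: filterS3 N0 N1 N2 => u u0 u1 u2; have [dG' E'] := HG _ (cI u u0).
  apply: (@dev_agree (G (la *: z)) (G (la *: u)) (ball (la *: z) d `&` ball (la *: u) d) (la *: z)).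
  - by apply: convexI; exact: convex_ball.
  - by move=> x [+ _]; exact: dG.
  - by move=> x [_]; exact: dG'.
  - by split; [exact: ballxx|exact: ball_sym].
  - by split => //; exact: cz.
  - have E2 : {near la *: z, G (la *: u) =1 F} by apply: agreeF; [exact: cI|exact: ball_sym|exact: cI].
    by apply: filterS2 E E2 => x -> ->.
have N : \forall z \near (0 : pt), ball 0 s z by exact: near_ball.
apply: filterS N => z zs.
have zs' : ball 0 (s + d / 2) z by apply: le_ball zs; rewrite lerDl divr_ge0// ltW.
exact: (nbhs_singleton (agreeF _ _ (cI z zs') (cz z zs') zs)).
Qed.

Lemma dev_glue (A : set R) (F_ : R -> pt -> M) F0 : (forall r, A r -> 0 < r) ->
  (forall r x, A r -> ball 0 r x -> dev (F_ r) x) -> (forall r, A r -> {near (0 : pt), F_ r =1 F0}) ->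
  exists F, forall r x, A r -> ball 0 r x -> dev F x /\ F x = F_ r x.
Proof.
move=> A0 dF E.
(* Any radius in A that reaches x serves, since the maps agree on common balls; the default 0 occurs
   only where none does. *)
pose rho x : R := xget 0 [set r | A r /\ ball 0 r x].
have rhoP r x : A r -> ball 0 r x -> A (rho x) /\ ball 0 (rho x) x.
  by move=> Ar bx; rewrite /rho; case: xgetP => [r' _ //|/(_ r)]; case.
have agree r x : A r -> ball 0 r x -> F_ (rho x) x = F_ r x.
  move=> Ar bx; have [Ar' bx'] := rhoP r x Ar bx.
  apply: (@dev_agree _ _ (ball 0 r `&` ball 0 (rho x)) 0 x) => //.
  - by apply: convexI; exact: convex_ball.
  - by move=> y [_]; exact: dF.
  - by move=> y [+ _]; exact: dF.
  - by split; apply: ballxx; exact: A0.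
  - by apply: filterS2 (E _ Ar) (E _ Ar') => y -> ->.
exists (fun x => F_ (rho x) x) => r x Ar bx; split; last exact: agree.
apply: (dev_eq _ (dF r x Ar bx)).
have N : \forall u \near x, ball 0 r u by apply: open_nbhs_nbhs; split => //; exact: ball_open.
by apply: filterS N => u bu; rewrite (agree r).
Qed.

Lemma developing_map (p0 : M) : exists E : pt -> M, forall x, dev E x.
Proof.
have [phi iphi dp] := isometric_chart_exists fM p0.
have ip : chart_img phi (chart_map phi p0) by exists p0.
have it : isom (fun x : pt => x + chart_map phi p0).
  by exists 1%:M, (chart_map phi p0); rewrite trmx1 mulmx1; split => // x; rewrite mulmx1.
pose F0 := chart_inv phi \o (fun x => x + chart_map phi p0).
have d0 : dev F0 0 by apply: dev_comp => //; apply: dev_chart; rewrite ?add0r.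
have [r0 r00 H0] := ball_of_near (dev_near d0).
pose ext (r : R) := 0 < r /\ exists F, (forall x, ball 0 r x -> dev F x) /\ {near (0 : pt), F =1 F0}.
have ext_le r r' : ext r -> 0 < r' -> r' <= r -> ext r'.
  move=> [_ [F [dF E]]] r'0 rr'; split => //; exists F; split => // x bx; apply: dF.
  exact: le_ball bx.
have ext_near0 : ext r0 by split => //; exists F0; split => //; exact: (@nearW _ (nbhs (0 : pt))).
have HF' r : exists F, ext r -> (forall x, ball 0 r x -> dev F x) /\ {near (0 : pt), F =1 F0}.
  by have [[r_ [F h]]|nr] := pselect (ext r); [exists F|exists F0].
have [F_ HF] := choice HF'.
have [F glue] := dev_glue (fun r => @proj1 _ _) (fun r x er => (HF r er).1 x) (fun r er => (HF r er).2).
have all r : 0 < r -> ext r.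
  move=> r1; apply: contrapT => nr.
  have ub : has_ubound ext.
    exists r => r' er'; rewrite leNgt; apply/negP => rr'; apply: nr; apply: ext_le er' r1 _; exact: ltW.
  have ne : ext !=set0 by exists r0.
  set s := sup ext.
  have s0 : 0 < s by apply: lt_le_trans r00 _; exact: ub_le_sup.
  have dF x : ball 0 s x -> dev F x.
    rewrite in_ball subr0 => /(sup_gt ne)[r' er' xr'].
    by have [] := glue r' x er' _; rewrite ?in_ball ?subr0.
  have [s' [F' [ss' dF' E']]] := dev_enlarge s0 dF.
  have : ext s'.
    split; first exact: lt_trans ss'.
    exists F'; split => //.
    have N : \forall x \near (0 : pt), ball 0 r0 x by exact: near_ball.
    apply: filterS3 N E' (HF r0 ext_near0).2 => x bx -> <-.
    by have [_ ->] := glue r0 x ext_near0 bx.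
  by move=> /(ub_le_sup ub); rewrite leNgt ss'.
exists F => x; have x1 : 0 < `|x| + 1 by rewrite ltr_wpDl.
by have [] := glue _ x (all _ x1) _; rewrite ?in_ball ?subr0 ?ltrDl.
Qed.

(** * Covering properties of a developing map *)

Section Covering.
Variable E : pt -> M.
Hypothesis dE : forall x, dev E x.

(** The image is open. If q is in its closure, an inverse chart around q agrees near one point with
    E o g for an isometry g, hence on its whole ball, and so q is in the image. *)
Lemma developing_surjective q : exists x, E x = q.
Proof.
suff : E @` setT = setT by move=> /seteqP[_ /(_ q I)[x _ <-]]; exists x.
apply: connected_clopen; first exact: rm_connected.
- by apply: dev_open => //; exact: openT.
- move=> {}q cl; have [psi ipsi dq] := isometric_chart_exists fM q.
  have iq : chart_img psi (chart_map psi q) by exists q.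
  have [r r0 br] := open_ball_sub (chart_img_open psi) iq.
  have N : \forall p \near q, (chart_dom psi `&` chart_map psi @^-1` ball (chart_map psi q) r) p.
    apply: open_nbhs_nbhs; split; first by apply: chart_preimage_open; exact: ball_open.
    by split => //=; exact: ballxx.
  have [_ [[x _ <-] [dx bx]]] := cl _ N.
  have ix : chart_img psi (chart_map psi (E x)) by exists (E x).
  have [g [ig gx gE]] := dev_germ (dev_chart ipsi ix) (dE x) (chart_mapK' dx).
  exists (g (chart_map psi q)) => //; rewrite -[RHS](chart_mapK' dq); apply/esym.
  apply: (@dev_agree _ (E \o g) (ball (chart_map psi q) r) (chart_map psi (E x))) => //.
  - exact: convex_ball.
  - by move=> y /br iy; exact: dev_chart.
  - by move=> y _; exact: dev_comp.
  - exact: ballxx.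
- by exists (E 0); exists 0.
Qed.

(** E o g and E are both local isometries on the whole plane, so their equality near a propagates
    everywhere. *)
Lemma deck_isom a b : E a = E b -> exists g, [/\ isom g, g a = b & E \o g = E].
Proof.
move=> Eab; have [g [ig ga gE]] := dev_germ (dE a) (dE b) Eab.
exists g; split => //; apply/funext => x.
apply: (@dev_agree (E \o g) E setT a x) => //.
- by move=> y _; exact: dev_comp.
- by apply: filterS gE => y ->.
Qed.

Lemma developing_continuous : continuous E.
Proof. by move=> x; exact: dev_cont. Qed.

(** The inverse of E is a global chart, and near each point it coincides with an isometric chart,
    from which smoothness and the metric are read off. *)
Lemma injective_isometric : injective E -> isometric_to_plane M.
Proof.
move=> injE.
have [e eK] := choice developing_surjective.
have Ee x : e (E x) = x by apply: injE; rewrite eK.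
have imgT : e @` setT = setT by apply/seteqP; split=> // x _; exists (E x).
have oI : open (e @` setT) by rewrite imgT; exact: openT.
have ce : {in setT, continuous e}.
  move=> q _ V NV; apply: (@filterS _ _ _ (E @` V^°)).
    by move=> _ [x Wx <-] /=; rewrite Ee; exact: interior_subset.
  by apply: open_nbhs_nbhs; split; [apply: dev_open => //; exact: open_interior|exists (e q)].
pose phi : ch := Chart openT oI (fun q _ => eK q) ce (fun x _ => @developing_continuous x).
have iT : chart_img phi = setT by exact: imgT.
exists phi; split => // c cA.
have loc q : exists psi, [/\ isometric_chart psi, chart_dom psi q, e q = chart_map psi q,
    \forall p \near q, e p = chart_map psi p & \forall y \near e q, E y = chart_inv psi y].
  have [psi [ipsi ix NE]] := dE (e q).
  have qE : q = chart_inv psi (e q) by rewrite -{1}(eK q); exact: nbhs_singleton NE.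
  have [d1 e1] := chart_invK ix; rewrite -qE in d1 e1.
  have N : \forall p \near q, e p = chart_map psi p.
    have N1 : \forall p \near q, chart_dom psi p by apply: open_nbhs_nbhs; split => //; exact: chart_dom_open.
    have N2 := near_cont (chart_map_cont d1) e1 NE.
    by apply: filterS2 N1 N2 => p dp h; apply: injE; rewrite eK h chart_mapK'.
  by exists psi; split => //; exact: nbhs_singleton N.
have near_trans x : chart_img c x -> exists2 psi, isometric_chart psi &
    overlap c psi x /\ \forall y \near x, overlap c psi y /\ transition c phi y = transition c psi y.
  move=> ix; have [psi [ipsi dq _ Nq _]] := loc (chart_inv c x).
  have ov : overlap c psi x by apply/overlapP.
  have No : \forall y \near x, overlap c psi y by apply: open_nbhs_nbhs; split => //; exact: overlap_open.
  exists psi => //; split => //; exact: near_and No (near_cont (chart_inv_cont ix) erefl Nq).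
split.
- move=> k; apply: Ck_local => x /overlapP[ix _].
  have [psi ipsi [ov N]] := near_trans x ix; have [s1 _ _] := ipsi c cA.
  have [r r0 br] := ball_of_near N.
  exists (ball x r); first exact: ballxx.
  apply: Ck_eq (ball_open x r) _ (Ck_sub (U := overlap c psi) _ (s1 k)).
    by move=> y /br[_ ->].
  by move=> y /br[].
- move=> k; apply: Ck_local => x /overlapP[_ dx].
  have [psi [ipsi dq eq_ _ Nx]] := loc (E x); rewrite Ee in eq_ Nx.
  have [_ s2 _] := ipsi c cA.
  have ov : overlap psi c x by apply/overlapP; rewrite -(nbhs_singleton Nx); split => //; exists (E x).
  have No : \forall y \near x, overlap psi c y by apply: open_nbhs_nbhs; split => //; exact: overlap_open.
  have [r r0 br] := ball_of_near (near_and No Nx).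
  exists (ball x r); first exact: ballxx.
  apply: Ck_eq (ball_open x r) _ (Ck_sub (U := overlap psi c) _ (s2 k)).
    by move=> y /br[_ h]; rewrite /transition /= h.
  by move=> y /br[].
- move=> x /overlapP[ix _]; have [psi ipsi [ov N]] := near_trans x ix; have [s1 _ m] := ipsi c cA.
  rewrite (m x ov) !pullback_cst1.
  rewrite (@near_eq_jacobian _ (transition c psi) (transition c phi) x) //.
    exact: (Ck1_differentiable (@overlap_open _ _ c psi) (s1 1%N) ov).
  by apply: filterS N => y [_ /esym].
Qed.

End Covering.
End DevelopingMap.

(** * Deck transformations *)

Section DeckAlgebra.
Context {R : realType}.
Local Notation pt := 'rV[R]_2.
Implicit Types (x y v w t : pt).

(** An orthogonal matrix with eigenvalue 1 is the identity if its determinant is 1, and a reflection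
    if it is -1; both are involutions. *)
Lemma orthogonal_square (a b c d : R) : a * a + b * b = 1 -> c * c + d * d = 1 -> a * c + b * d = 0 ->
  (a - 1) * (d - 1) - b * c = 0 ->
  [/\ a * a + b * c = 1, a * b + b * d = 0, c * a + d * c = 0 & c * b + d * d = 1].
Proof.
move=> h1 h2 h3 h4.
have : (a * d - b * c) ^+ 2 = 1.
  have -> : (a * d - b * c) ^+ 2 = (a * a + b * b) * (c * c + d * d) - (a * c + b * d) ^+ 2 by ring.
  by rewrite h1 h2 h3; ring.
move/eqP; rewrite sqrf_eq1 => /orP[|] /eqP D.
  have tr : a + d = 2 by lra.
  have a1 : a <= 1 by nra.
  have d1 : d <= 1 by nra.
  have aE : a = 1 by lra.
  have dE : d = 1 by lra.
  have b0 : b = 0 by apply/eqP; rewrite -sqrf_eq0 expr2; apply/eqP; rewrite aE in h1; lra.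
  have c0 : c = 0 by apply/eqP; rewrite -sqrf_eq0 expr2; apply/eqP; rewrite dE in h2; lra.
  by rewrite aE dE b0 c0; split; ring.
have tr : a + d = 0 by lra.
have dE : d = - a by lra.
by split; rewrite ?dE in D *; lra.
Qed.

(** The determinant of the rows x and t: the coordinate of x perpendicular to t, multiplied by the
    length of t. *)
Definition area x t : R := x 0 0 * t 0 1 - x 0 1 * t 0 0.

Lemma areaD x y t : area (x + y) t = area x t + area y t.
Proof. by rewrite /area !mxE; ring. Qed.

Lemma areaB x y t : area (x - y) t = area x t - area y t.
Proof. by rewrite /area !mxE; ring. Qed.

Lemma areaZ (a : R) x t : area (a *: x) t = a * area x t.
Proof. by rewrite /area !mxE; ring. Qed.

Lemma area_self t : area t t = 0.
Proof. by rewrite /area mulrC subrr. Qed.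

Lemma area_mulmx (L : 'M[R]_2) x t : area (x *m L) (t *m L) = \det L * area x t.
Proof. by rewrite /area !mul_mx2E det_mx2; ring. Qed.

Lemma dot_area x t : dot x t ^+ 2 + area x t ^+ 2 = dot x x * dot t t.
Proof. by rewrite /dot /area; ring. Qed.

Lemma parallel_scale x t : t != 0 -> area x t = 0 -> x = (dot x t / dot t t) *: t.
Proof.
move=> t0 xt; have tt : dot t t != 0 by apply: contra t0 => /eqP/dot_eq0 ->.
have E : dot t t *: x = dot x t *: t.
  move: xt; rewrite /area /dot => xt; apply: rowP2; rewrite !mxE.
    transitivity (x 0 0 * t 0 0 * t 0 0 + t 0 1 * (x 0 0 * t 0 1 - x 0 1 * t 0 0 + x 0 1 * t 0 0)); first by ring.
    by rewrite xt; ring.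
  transitivity (x 0 1 * t 0 1 * t 0 1 - t 0 0 * (x 0 0 * t 0 1 - x 0 1 * t 0 0 - x 0 0 * t 0 1)); first by ring.
  by rewrite xt; ring.
by rewrite mulrC -scalerA -E scalerA mulVf// scale1r.
Qed.

(** L preserves the line of t, so t is an eigenvector with eigenvalue [la] equal to 1 or -1, and the
    perpendicular coordinate is multiplied by [la * \det L]. *)
Lemma area_orthogonal (L : 'M[R]_2) t : L *m L^T = 1%:M -> t != 0 -> area (t *m L) t = 0 ->
  exists2 mu : R, mu = 1 \/ mu = -1 & forall x, area (x *m L) t = mu * area x t.
Proof.
move=> LL t0 h; have tt : dot t t != 0 by apply: contra t0 => /eqP/dot_eq0 ->.
have E := parallel_scale t0 h; set la := _ / _ in E.
have la2 : la ^+ 2 = 1.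
  have := dot_mulmx t t LL; rewrite E dotZl dotZr mulrA -expr2 => /(canRL (mulfK tt)) ->.
  by rewrite divff.
have d2 : \det L ^+ 2 = 1 by have := congr1 determinant LL; rewrite det_mulmx det_tr det1 -expr2.
exists (la * \det L).
  move/eqP: la2; move/eqP: d2; rewrite !sqrf_eq1 => /orP[|] /eqP -> /orP[|] /eqP ->.
  - by left; rewrite mulr1.
  - by right; rewrite mulr1.
  - by right; rewrite mul1r.
  - by left; rewrite mulrNN mulr1.
move=> x; have A := area_mulmx L x t; rewrite E in A.
have {}A : la * area (x *m L) t = \det L * area x t by rewrite -A /area !mxE; ring.
by rewrite -mulrA -A mulrA -expr2 la2 mul1r.
Qed.

Lemma area_continuous t : continuous (area ^~ t).
Proof.
move=> x; apply: (@addr_continuous R pt (fun x : pt => x 0 0 * t 0 1) (fun x : pt => - (x 0 1 * t 0 0))).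
  by apply: mulr_continuous; [exact: coord_continuous|exact: cst_continuous].
apply: (@continuousN _ R^o _ (fun x : pt => x 0 1 * t 0 0)).
by apply: mulr_continuous; [exact: coord_continuous|exact: cst_continuous].
Qed.

(** Bounds a fundamental strip via [dot_area]. The bound serves only compactness, and |x|^2 <= y <=
    (1 + y)^2 avoids a square root. *)
Lemma bounded_from_area x t (C : R) : t != 0 -> 0 <= dot x t < dot t t -> `|area x t| <= C ->
  `|x| <= 1 + (dot t t + C ^+ 2 / dot t t).
Proof.
move=> t0 /andP[d0 d1] aC.
have C0 : 0 <= C by exact: le_trans aC.
have T0 : 0 < dot t t by exact: le_lt_trans d0 d1.
set y := dot t t + C ^+ 2 / dot t t.
have y0 : 0 <= y by rewrite addr_ge0 ?divr_ge0 ?sqr_ge0// ltW.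
have a2 : area x t ^+ 2 <= C ^+ 2 by rewrite -real_normK ?num_real// lerXn2r ?nnegrE.
have d2 : dot x t ^+ 2 <= dot t t ^+ 2 by rewrite lerXn2r ?nnegrE// ltW.
have xx : dot x x <= y.
  rewrite -(ler_pM2r T0) -dot_area /y mulrDl divfK ?lt0r_neq0// -expr2; exact: lerD.
have le1 (a : R) : 0 <= a -> a <= (1 + a) ^+ 2 by move=> ?; nra.
have y1 : 0 <= 1 + y by rewrite addr_ge0.
rewrite -(@ler_pXn2r _ 2 isT `|x|) ?nnegrE ?y1//.
exact: le_trans (norm_dot x) (le_trans xx (le1 y y0)).
Qed.

End DeckAlgebra.

(** * The deck group and the exhaustion function *)

Section DeckGroup.
Context {R : realType} {M : riemannian_surface R}.
Local Notation pt := 'rV[R]_2.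
Local Notation ch := (chart M pt).
Hypotheses (fM : flat M) (cM : complete_metric M).
Variable E : pt -> M.
Hypothesis dE : forall x, dev E x.
Implicit Types (x y z v w t : pt) (g : pt -> pt) (p q : M).

Definition deck g := isom g /\ forall x, E (g x) = E x.

Lemma deck_comp g g' : deck g -> deck g' -> deck (g \o g').
Proof. by move=> [ig Eg] [ig' Eg']; split=> [|x]; [exact: isom_comp|rewrite /= Eg Eg']. Qed.

Lemma deck_fix g a : deck g -> g a = a -> g = id.
Proof.
move=> [ig Eg] ga; have [r r0 inj] := dev_inj (dE a).
apply: (@isom_eq R g id a) => //; first exact: isom_id.
have N : \forall z \near a, ball a r z /\ ball a r (g z).
  exact: near_and (near_ball a r0) (near_cont (@isom_continuous _ _ ig a) ga (near_ball a r0)).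
by apply: filterS N => z [bz bgz]; exact: inj.
Qed.

Definition period t := forall x, E (x + t) = E x.

(** A nontrivial deck transformation has no fixed point, so L - 1 is singular, since otherwise - c
    (L - 1)^-1 would be fixed. Then L is an involution, and the square is the translation by c L +
    c. *)
Lemma deck_square (L : 'M[R]_2) c : L *m L^T = 1%:M -> deck (fun x => x *m L + c) ->
  (exists x, x *m L + c != x) -> L *m L = 1%:M /\ period (c *m L + c).
Proof.
move=> LL dg [x0 gx0].
have nofix x : x *m L + c != x.
  by apply: contra gx0 => /eqP /(deck_fix dg) h; rewrite -[X in _ == X]/(id x0) -h.
have dz : \det (L - 1%:M) = 0.
  apply/eqP/negPn/negP => d0; have u : L - 1%:M \in unitmx by rewrite unitmxE unitfE.
  have := nofix (- (c *m invmx (L - 1%:M))); apply/negP/negPn; set x := - _.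
  have : x *m (L - 1%:M) = - c by rewrite mulNmx -mulmxA mulVmx// mulmx1.
  by rewrite mulmxBr mulmx1 => /eqP; rewrite subr_eq => /eqP ->; rewrite addrAC addNr add0r.
have L2 : L *m L = 1%:M.
  have e i j : (L *m L^T) i j = (1%:M : 'M[R]_2) i j by rewrite LL.
  have := e 0 0; have := e 1 1; have := e 0 1; rewrite !mul_mx2E !mxE /= => h01 h11 h00.
  move: dz; rewrite det_mx2 !mxE /= !subr0 => h4.
  have [k1 k2 k3 k4] := orthogonal_square h00 h11 h01 h4.
  by apply: mx2_eqP; rewrite mul_mx2E [in RHS]mxE /=.
split => // x; have [_ Eg] := dg.
have -> : x + (c *m L + c) = (x *m L + c) *m L + c by rewrite mulmxDl -mulmxA L2 mulmx1 addrA.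
by rewrite !Eg.
Qed.

Lemma period_mulz t (n : int) : period t -> period (n%:~R *: t).
Proof.
move=> pt_; have nat_ (m : nat) x : E (x + m%:R *: t) = E x.
  elim: m x => [|m IH] x; first by rewrite scale0r addr0.
  by rewrite -natr1 scalerDl scale1r addrA pt_ IH.
case: n => m x; first exact: nat_.
have := nat_ m.+1 (x - m.+1%:R *: t); rewrite subrK => ->.
by rewrite NegzE mulrNz scaleNr.
Qed.

Lemma period_exists : ~ injective E -> exists2 t, t != 0 & period t.
Proof.
move=> ninj.
have [a [b [Eab nab]]] : exists a b, E a = E b /\ a <> b.
  apply: contrapT => h; apply: ninj => a b Eab; apply: contrapT => nab.
  by apply: h; exists a, b.
have [g [ig ga Eg]] := deck_isom dE Eab.
have dg : deck g by split => // x; rewrite -[LHS]/((E \o g) x) Eg.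
have [L [c [LL gE]]] := ig.
have gE' : g = (fun x => x *m L + c) by apply/funext.
rewrite gE' in dg.
have nfa : a *m L + c != a by rewrite -gE ga; apply/eqP => /esym.
have [L2 per] := deck_square LL dg (ex_intro _ a nfa).
exists (c *m L + c) => //; apply/eqP => c0.
(* If the square were the identity, then c L = - c and c / 2 would be a fixed point. *)
have /(deck_fix dg) h : (2^-1 *: c) *m L + c = 2^-1 *: c.
  rewrite -scalemxAl; have -> : c *m L = - c by apply/eqP; rewrite -addr_eq0 c0.
  rewrite scalerN addrC -{1}[c]scale1r -scalerBl; congr (_ *: _); by field.
by apply: nab; rewrite -ga gE -[LHS]/(id a) -h.
Qed.

(** Conjugating the translation by t with a deck transformation gives the translation by t L. *)
Lemma period_image (L : 'M[R]_2) c t : L *m L^T = 1%:M -> deck (fun x => x *m L + c) -> period t -> period (t *m L).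
Proof.
move=> LL [_ Eg] pt_ x; have LL' : L^T *m L = 1%:M by exact: mulmx1C.
have [y xE] : exists y, x = y *m L + c.
  by exists ((x - c) *m L^T); rewrite -mulmxA LL' mulmx1 subrK.
have -> : x + t *m L = (y + t) *m L + c by rewrite mulmxDl addrAC -xE.
by rewrite [in RHS]xE !Eg pt_.
Qed.

(* This makes b o f harmonic near the points that a harmonic map f sends to q. *)
Definition adapted (b : M -> R) q := exists (phi : ch) (a0 a1 a2 : R),
  [/\ isometric_chart phi, chart_dom phi q &
      forall q', chart_dom phi q' -> b q' = a0 * chart_map phi q' 0 0 + a1 * chart_map phi q' 0 1 + a2].

(** Removing integer parts of the coordinates in the basis t1, t2 moves every point into a fixed
    compact box. *)
Lemma cocompact_case t1 t2 : period t1 -> period t2 -> area t1 t2 != 0 -> compact [set: M].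
Proof.
move=> p1 p2 a0.
have -> : [set: M] = E @` [set y | `|y - 0| <= `|t1| + `|t2|].
  apply/seteqP; split=> [q _|//]; have [x <-] := developing_surjective fM dE q.
  pose u := area x t2 / area t1 t2; pose v := - area x t1 / area t1 t2.
  have xE : x = u *: t1 + v *: t2.
    by apply: rowP2; rewrite !mxE /u /v; move: a0; rewrite /area => a0; field.
  pose y := x - (Num.floor u)%:~R *: t1 - (Num.floor v)%:~R *: t2.
  exists y; last first.
    rewrite /y; have q1 := period_mulz (- Num.floor u) p1; have q2 := period_mulz (- Num.floor v) p2.
    by rewrite -!scaleNr -!mulrNz q2 q1.
  have frac (a : R) : `|a - (Num.floor a)%:~R| <= 1.
    have := floor_le_tmp a; have := floorD1_gt a; rewrite intrD => h1 h2.
    by rewrite ger0_norm ?subr_ge0// lerBlDl ltW.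
  have yE : y = (u - (Num.floor u)%:~R) *: t1 + (v - (Num.floor v)%:~R) *: t2.
    by rewrite /y xE !scalerBl -!addrA; congr (_ + _); rewrite addrCA.
  rewrite /= subr0 yE.
  apply: le_trans (ler_normD _ _) _; rewrite !normrZ; apply: lerD; exact: ler_piMl (frac _).
apply: continuous_compact; last exact: box_compact.
by apply: continuous_subspaceT; exact: developing_continuous.
Qed.

Section Parallel.
Variable t : pt.
Hypotheses (t0 : t != 0) (pt_ : period t) (par : forall s, period s -> area s t = 0).

Lemma deck_area g : deck g -> (forall x, area (g x) t = area x t) \/
  exists k, forall x, area (g x) t = - area x t + k.
Proof.
move=> dg; have [[L [c [LL gE]]] Eg] := dg.
have dg' : deck (fun x => x *m L + c) by rewrite (_ : (fun x => x *m L + c) = g)//; apply/funext => x.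
have [mu mu1 aE] := area_orthogonal LL t0 (par (period_image LL dg' pt_)).
have ag x : area (g x) t = mu * area x t + area c t by rewrite gE areaD aE.
case: mu1 => muE; last by right; exists (area c t) => x; rewrite ag muE mulN1r.
left => x; rewrite ag muE mul1r.
(* In the sign-preserving case the period c L + c has area 2 area c t, which vanishes because all
   periods are parallel to t. *)
have [[y gy]|h] := pselect (exists x, x *m L + c != x).
  have [_ /par] := deck_square LL dg' (ex_intro _ y gy).
  rewrite areaD aE muE mul1r => h; suff -> : area c t = 0 by rewrite addr0.
  by lra.
have : g 0 = 0 by apply: contrapT => g0; apply: h; exists 0; rewrite -gE; exact/eqP.
by rewrite gE mul0mx add0r => ->; rewrite /area !mxE !mul0r subrr addr0.
Qed.

Lemma area_nonzero : exists x, area x t != 0.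
Proof.
exists (row2 (t 0 1) (- t 0 0)); rewrite /area row2_0 row2_1.
have -> : t 0 1 * t 0 1 - - t 0 0 * t 0 0 = dot t t by rewrite /dot; ring.
by apply: contra t0 => /eqP/dot_eq0 ->.
Qed.

(** The product of two sign-reversing elements cannot reverse the sign again, so it preserves area
    and their constants k agree. Hence all of them reflect area in the same value k / 2. *)
Lemma deck_axis : exists c0 : R, forall g x, deck g -> `|area (g x) t - c0| = `|area x t - c0|.
Proof.
have [[g1 [dg1 [k gk]]]|none] := pselect (exists g, deck g /\ exists k, forall x, area (g x) t = - area x t + k).
  exists (k / 2) => g x dg; have [->//|[k' gk']] := deck_area dg.
  have kk : k' = k.
    have [h|[d h]] := deck_area (deck_comp dg1 dg).
      by have := h 0; rewrite /= gk gk'; lra.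
    have [y y0] := area_nonzero; have := h 0; have := h y; rewrite /= !gk !gk'.
    have -> : area (0 : pt) t = 0 by rewrite /area !mxE; ring.
    by move: y0; set a := area y t => a0 h1 h2; exfalso; move/eqP: a0; apply; lra.
  rewrite gk' kk -normrN; congr (`| _ |); by field.
exists 0 => g x dg; have [->//|[k gk]] := deck_area dg.
by exfalso; apply: none; exists g; split => //; exists k.
Qed.

(** Up to the factor |t|, b is the distance to the axis where area equals c0; it descends to M
    because deck transformations preserve this axis. *)
Lemma parallel_case : exists b : M -> R, [/\ continuous b, forall C, compact [set q | b q <= C],
  forall q, 0 <= b q & forall q, 0 < b q -> adapted b q].
Proof.
have [c0 axis] := deck_axis.
have [e eK] := choice (developing_surjective fM dE).
pose h x := area x t - c0.
pose b q := `|h (e q)|.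
(* The chosen preimage does not matter: any two differ by a deck transformation, which keeps |h|. *)
have bE x : b (E x) = `|h x|.
  have [g [ig gx Eg]] := deck_isom dE (esym (eK (E x))).
  have dg : deck g by split => // y; rewrite -[LHS]/((E \o g) y) Eg.
  by rewrite /b /h -gx axis.
have ch : continuous h.
  move=> x; apply: (@addr_continuous R pt (area ^~ t) (fun=> - c0)); [exact: area_continuous|exact: cst_continuous].
have T0 : 0 < dot t t by rewrite lt_neqAle dot_ge0 andbT eq_sym; apply: contra t0 => /eqP/dot_eq0 ->.
exists b; split.
- move=> q V; rewrite -{1}(eK q) bE => NV.
  have N : nbhs (e q) [set x | V `|h x|].
    apply: (@near_cont _ _ (fun x => `|h x|) (e q) _ V) NV => //.
    apply: (@continuous_comp _ _ _ h (fun a : R => `|a|) (e q)); [exact: ch|exact: norm_continuous].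
  apply: (@filterS _ _ _ (E @` [set x | V `|h x|]^°)).
    by move=> _ [x Wx <-] /=; rewrite bE; exact: interior_subset Wx.
  by apply: open_nbhs_nbhs; split; [apply: dev_open => //; exact: open_interior|exists (e q)].
- move=> C.
  pose r := 1 + (dot t t + (C + `|c0|) ^+ 2 / dot t t).
  have -> : [set q | b q <= C] = E @` ([set y | `|y - 0| <= r] `&` [set y | `|h y| <= C]).
    apply/seteqP; split=> [q|_ [y [_ /= hy] <-]]; last by rewrite /= bE.
    rewrite -(eK q); move: (e q) => x /=; rewrite bE => hx.
    (* Subtracting an integer multiple of t brings the component along t into a period interval and
       leaves area unchanged, so y lies in a fixed box. *)
    pose u := dot x t / dot t t; pose y := x - (Num.floor u)%:~R *: t.
    have Ey : E y = E x by rewrite /y -scaleNr -mulrNz; exact: period_mulz.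
    have ay : area y t = area x t by rewrite /y areaB areaZ area_self mulr0 subr0.
    exists y => //; split => /=; last by rewrite /h ay.
    rewrite subr0; apply: bounded_from_area => //.
      have -> : dot y t = (u - (Num.floor u)%:~R) * dot t t.
        by rewrite /y dotDl dotNl dotZl mulrBl /u divfK// lt0r_neq0.
      have := floor_le_tmp u; have := floorD1_gt u; rewrite intrD => h1 h2.
      rewrite mulr_ge0 ?subr_ge0 ?(ltW T0)//=.
      by rewrite gtr_pMl// ltrBlDl.
    rewrite ay; have -> : area x t = h x + c0 by rewrite /h subrK.
    by apply: le_trans (ler_normD _ _) _; rewrite lerD2r.
  apply: continuous_compact.
    by apply: continuous_subspaceT; exact: developing_continuous.
  apply: compact_closedI; first exact: box_compact.
  apply: (@preimage_closed _ _ (fun x : pt => `|h x|) [set a : R | a <= C]); last exact: closed_le.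
  by move=> x _; apply: (@continuous_comp _ _ _ h (fun a : R => `|a|) x); [exact: ch|exact: norm_continuous].
- by move=> q; exact: normr_ge0.
- move=> q; set x := e q => bq.
  have [phi [iphi ix NE]] := dE x.
  have hx0 : h x != 0 by rewrite -normr_gt0.
  have [sg NS] : exists sg : R, \forall y \near x, `|h y| = sg * h y.
    have [hx|hx] := ltP 0 (h x).
      exists 1; have N := near_cont (ch x) erefl (lt_nbhsr hx).
      by apply: filterS N => y hy; rewrite mul1r gtr0_norm.
    have {}hx : h x < 0 by rewrite lt_neqAle hx0.
    exists (-1); have N := near_cont (ch x) erefl (lt_nbhsl hx).
    by apply: filterS N => y hy; rewrite mulN1r ltr0_norm.
  have Ni : \forall y \near x, chart_img phi y by apply: open_nbhs_nbhs; split => //; exact: chart_img_open.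
  have [r r0 br] := ball_of_near (near_and Ni (near_and NE NS)).
  have oB : open (ball x r) by exact: ball_open.
  have imid : id @` ball x r = ball x r by rewrite image_id.
  (* The chart is shrunk to a box where it inverts E and h keeps its sign, so that |h| is affine
     there. *)
  have [phi' [iphi' dphi mphi _]] := @post_isometric R M (cst 1%:M) phi (ball x r) id id iphi oB
    (fun y hy => (br y hy).1) (isom_smooth oB isom_id) (eq_ind_r open oB imid)
    (eq_ind_r (fun U => smooth U id) (isom_smooth oB isom_id) imid) (fun y _ => erefl) (fun y _ => isom_jacobian y isom_id).
  have xq : chart_inv phi x = q by rewrite -(nbhs_singleton NE) eK.
  have [dx ex] := chart_invK ix.
  exists phi', (sg * t 0 1), (- sg * t 0 0), (- sg * c0); split => //.
    by rewrite dphi; split; rewrite /= -xq ?ex //; exact: ballxx.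
  move=> q'; rewrite dphi mphi => -[dq' bq']; have [_ [E1 S1]] := br _ bq'.
  rewrite -{1}(chart_mapK' dq') -E1 bE S1 /= /h /area; ring.
Qed.

End Parallel.

Lemma exhaustion : ~ injective E -> exists b : M -> R, [/\ continuous b, forall C, compact [set q | b q <= C],
  forall q, 0 <= b q & forall q, 0 < b q -> adapted b q].
Proof.
move=> ninj; have [t t0 pt_] := period_exists ninj.
have [[s [ps st]]|h] := pselect (exists s, period s /\ area s t != 0); last first.
  apply: (parallel_case t0 pt_) => s ps; apply/eqP/negPn/negP => st.
  by apply: h; exists s.
have cM' := cocompact_case ps pt_ st.
exists (fun=> 0); split => //; [exact: cst_continuous| |by move=> q; rewrite ltxx].
move=> C; have [C0|C0] := leP 0 C.
  by rewrite (_ : [set _ | _] = setT)//; apply/seteqP; split.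
rewrite (_ : [set _ | _] = set0); first exact: compact0.
by apply/seteqP; split.
Qed.

End DeckGroup.

(** * Nonexistence of proper harmonic maps *)

Theorem proposition1 (R : realType) (S : riemann_surface R)
    (M : riemannian_surface R) :
  hyperbolic_type S ->
  complete_metric M -> flat M -> ~ isometric_to_plane M ->
  ~ exists f : S -> M, harmonic_map f /\ proper_map f.
Proof.
move=> [u [su uneg unc]] cM fM nplane [f [[cf hf] pf]].
(* A point of S provides the base point of M from which to develop. *)
have [p0 _] := unc.
have [E dE] := developing_map fM cM (f p0).
have ninj : ~ injective E by move=> /(injective_isometric fM dE).
have [b [cb cptb b0 ad]] := exhaustion fM dE ninj.
apply: (@no_harmonic_exhaustion R S u (b \o f)) => //.
- by move=> p; apply: (@continuous_comp _ _ _ f b p); [exact: cf|exact: cb].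
- by move=> C; exact: pf (cptb C).
- by move=> p; exact: b0.
move=> p /ad[phi [a0 [a1 [a2 [iphi dp bE]]]]].
have oW : open (f @^-1` chart_dom phi).
  by apply: open_comp => [q _|]; [exact: cf|exact: chart_dom_open].
have hm i := harmonic_has_mean oW (hf phi iphi i).
exists (f @^-1` chart_dom phi), (fun q => a0 * chart_map phi (f q) 0 0 + a1 * chart_map phi (f q) 0 1 + a2).
by split => //; [exact: has_mean_combo|move=> q dq; rewrite /= bE].
Qed.
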